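(* Let $0<r<1$, $\alpha>0$, $1<p<\infty$, $\frac1p+\frac1{p'}=1$, $\beta\in\mathbb{R}$ and $n\in\mathbb{N}$. (i) For every $x\in\mathbb{R}$, every function $f\in C^{\alpha,r}_{\beta}L_{p}$ and every $n\ge n_{*}(\alpha,r,p)$ there is a real number $\gamma^{*}_{n,p}=\gamma^{*}_{n,p}(\alpha,r,\beta,f,x)$ with $|\gamma^{*}_{n,p}|<20\pi^{4}$ such that $$|\tilde{\rho}_{n}(f;x)|\le 2e^{-\alpha n^{r}}n^{\frac{1-r}{p}}\left|\sin\frac{2n-1}{2}x\right|\left(\frac{\|\cos t\|_{p'}}{\pi^{1+\frac{1}{p'}}(\alpha r)^{\frac1p}}F^{\frac1{p'}}\left(\frac12,\frac{3-p'}{2};\frac32;1\right)+\gamma^{*}_{n,p}\left(\left(1+\frac{(\alpha r)^{\frac{p'-1}{p}}}{p'-1}\right)\frac{1}{n^{\frac{1-r}{p}}}+\frac{p^{\frac1{p'}}}{(\alpha r)^{1+\frac1p}n^{r}}\right)\right)E_{n}(f^{\alpha,r}_{\beta})_{L_{p}}.$$ (ii) Moreover, for every $x\in\mathbb{R}$, every function $f\in C^{\alpha,r}_{\beta}L_{p}$ and every $n\ge n_{*}(\alpha,r,p)$ there exists a function $\mathcal{F}(\cdot)=\mathcal{F}(f;n;x,\cdot)\in C^{\alpha,r}_{\beta}L_{p}$ such that $E_{n}(\mathcal{F}^{\alpha,r}_{\beta})_{L_{p}}=E_{n}(f^{\alpha,r}_{\beta})_{L_{p}}$ and $$|\tilde{\rho}_{n}(\mathcal{F};x)|=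 2e^{-\alpha n^{r}}n^{\frac{1-r}{p}}\left|\sin\frac{2n-1}{2}x\right|\left(\frac{\|\cos t\|_{p'}}{\pi^{1+\frac{1}{p'}}(\alpha r)^{\frac1p}}F^{\frac1{p'}}\left(\frac12,\frac{3-p'}{2};\frac32;1\right)+\gamma^{*}_{n,p}\left(\left(1+\frac{(\alpha r)^{\frac{p'-1}{p}}}{p'-1}\right)\frac{1}{n^{\frac{1-r}{p}}}+\frac{p^{\frac1{p'}}}{(\alpha r)^{1+\frac1p}n^{r}}\right)\right)E_{n}(f^{\alpha,r}_{\beta})_{L_{p}}$$ for some real number $\gamma^{*}_{n,p}=\gamma^{*}_{n,p}(\alpha,r,\beta,f,x)$ (not necessarily the same as in (i)) with $|\gamma^{*}_{n,p}|<20\pi^{4}$.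
   Context: Spaces. For $1\le p<\infty$, $L_p$ is the space of $2\pi$-periodic functions with $\|f\|_p=\left(\int_0^{2\pi}|f(t)|^p\,dt\right)^{1/p}<\infty$; $L_\infty$ is the space of measurable essentially bounded $2\pi$-periodic functions with the essential supremum norm $\|\cdot\|_\infty$. In particular $\|\cos t\|_{p'}$ is the $L_{p'}$-norm over one period. Generalized Poisson integrals. For $\alpha,r>0$, $\beta\in\mathbb{R}$ let $P_{\alpha,r,\beta}(t)=\sum_{k=1}^{\infty}e^{-\alpha k^{r}}\cos\left(kt-\frac{\beta\pi}{2}\right)$. For $\mathfrak{N}\subset L_1$, $C^{\alpha,r}_{\beta}\mathfrak{N}$ is the set of $2\pi$-periodic functions $f$ representable for all $x\in\mathbb{R}$ as $$f(x)=\frac{a_0}{2}+\frac1\pi\int_{-\pi}^{\pi}P_{\alpha,r,\beta}(x-t)\varphi(t)\,dt,\quad a_0\in\mathbb{R},\ \varphi\in\mathfrak{N},\ \int_{-\pi}^{\pi}\varphi(t)\,dt=0.$$ The function $\varphi$ (determined up to a null set) is called the generalized derivative of $f$ and denoted $f^{\alpha,r}_{\beta}$. Interpolation polynomials. For a continuous $2\pi$-periodic $f$, $\tilde S_{n-1}(f;\cdot)$ is the unique trigonometric polynomial of order at most $n-1$ with $\tilde S_{n-1}(f;x_k^{(n-1)})=f(x_k^{(n-1)})$, $k=0,1,\dots,2n-2$, where $x_k^{(n-1)}=\frac{2k\pi}{2n-1}$. Put $\tilde\rho_n(f;x)=f(x)-\tilde S_{n-1}(f;x)$. Best approximation. $\mathcal{T}_{2n-1}$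 is the space of trigonometric polynomials of order at most $n-1$, and $E_n(g)_{L_p}=\inf_{t_{n-1}\in\mathcal{T}_{2n-1}}\|g-t_{n-1}\|_p$. Hypergeometric function. $F(a,b;c;z)=1+\sum_{k=1}^{\infty}\frac{(a)_k(b)_k}{(c)_k}\frac{z^k}{k!}$, $(y)_k=y(y+1)\cdots(y+k-1)$; $F^{s}(\cdot)$ means $(F(\cdot))^{s}$. The number $n_*$. For $\alpha>0$, $r\in(0,1)$, $1\le p\le\infty$, $n_*(\alpha,r,p)$ is the smallest $n\in\mathbb{N}$ such that $$\frac{\ln(\pi n)}{\alpha r n^{r}}+\frac{\alpha r\,\chi(p)}{n^{1-r}}\le\begin{cases}\frac1{14},&p=1,\\ \frac{1}{(3\pi)^3}\cdot\frac{p-1}{p},&1<p<\infty,\\ \frac1{(3\pi)^3},&p=\infty,\end{cases}$$ where $\chi(p)=p$ for $1\le p<\infty$ and $\chi(\infty)=1$. *)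

(* Defs.v *)
From HB Require Import structures.
From mathcomp Require Import all_boot all_order all_algebra.
From mathcomp Require Import all_classical all_reals all_analysis.
Import Order.TTheory GRing.Theory Num.Theory.
Import numFieldNormedType.Exports.

Set Implicit Arguments.
Unset Strict Implicit.
Unset Printing Implicit Defensive.

Local Open Scope classical_set_scope.
Local Open Scope ring_scope.

Section Spaces.
Context {R : realType}.
Implicit Types (p : \bar R) (f g phi T : R -> R) (n : nat).

Definition period_measure : {measure set (measurableTypeR R) -> \bar R} :=
  [the {measure set (measurableTypeR R) -> \bar R} of
     mrestr (@lebesgue_measure R) (measurable_itv `[0, 2 * pi])].

Definition Lp p : set (R -> R) :=
  [set f | periodic f (2 * pi) /\ f \in Lfun period_measure p].

Definition normLp p f : R := fine ('N[period_measure]_p[EFin \o f])%E.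

(* Trigonometric polynomials of order at most n - 1 (for 0 < n).  The sine
   coefficient of index 0 plays no role. *)
Definition trig_poly n : set (R -> R) :=
  [set T | exists a b : nat -> R, forall t,
     T t = \sum_(k < n) (a k * cos (k%:R * t) + b k * sin (k%:R * t))].

(* E_n(g)_{L_p}; the infimum is finite when g is in L_p. *)
Definition best_approx n p g : R :=
  fine (ereal_inf [set 'N[period_measure]_p[EFin \o (g \- T)%R]%E
                             | T in trig_poly n]).

Definition interp_node n (k : nat) : R := 2 * k%:R * pi / (2 * n%:R - 1).

Definition is_interpolant n f T :=
  trig_poly n T /\
  forall k, (k <= 2 * n - 2)%N -> T (interp_node n k) = f (interp_node n k).

(* For 0 < n there is exactly one interpolant, so the default is never used. *)
Definition interpolant n f : R -> R := xget (cst 0) (is_interpolant n f).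

Definition interp_error n f x : R := f x - interpolant n f x.

End Spaces.

Section GeneralizedPoissonIntegrals.
Context {R : realType}.
Implicit Types (alpha r beta : R) (f phi : R -> R) (N : set (R -> R)).

Definition poisson_kernel alpha r beta (t : R) : R :=
  limn (fun m : nat => \sum_(1 <= k < m)
    expR (- alpha * k%:R `^ r) * cos (k%:R * t - beta * pi / 2)).

(* phi is a function of N representing f as a generalized Poisson integral,
   i.e. phi is the generalized derivative of f up to a null set. *)
Definition is_gen_derivative alpha r beta N f phi :=
  [/\ N phi,
      \int[lebesgue_measure]_(t in `[- pi, pi]) phi t = 0 &
      exists a0 : R, forall x : R,
        f x = a0 / 2 + pi^-1 *
          \int[lebesgue_measure]_(t in `[- pi, pi])
            (poisson_kernel alpha r beta (x - t) * phi t)].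

Definition poisson_class alpha r beta N : set (R -> R) :=
  [set f | periodic f (2 * pi) /\ exists phi, is_gen_derivative alpha r beta N f phi].

End GeneralizedPoissonIntegrals.

Section Hypergeometric.
Context {R : realType}.

Definition pochhammer (y : R) (k : nat) : R := \prod_(i < k) (y + i%:R).

Definition hypergeometric (a b c z : R) : R :=
  limn (fun m : nat => 1 + \sum_(1 <= k < m)
    pochhammer a k * pochhammer b k / pochhammer c k * (z ^+ k / k`!%:R)).

End Hypergeometric.

Section ThresholdIndex.
Context {R : realType}.
Implicit Types (alpha r : R) (p : \bar R).

(* Only 1 <= p <= +oo is meaningful; the value at -oo is irrelevant. *)
Definition chi p : R := if p is p%:E then p else 1.

Definition threshold p : R :=
  match p with
  | p%:E => if p == 1 then 14^-1 else ((3 * pi) ^+ 3)^-1 * ((p - 1) / p)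
  | _ => ((3 * pi) ^+ 3)^-1
  end.

Definition below_threshold alpha r p (n : nat) :=
  ln (pi * n%:R) / (alpha * r * n%:R `^ r)
    + alpha * r * chi p / n%:R `^ (1 - r) <= threshold p.

Definition is_nstar alpha r p (n : nat) :=
  [/\ (0 < n)%N, below_threshold alpha r p n &
      forall k, (0 < k)%N -> below_threshold alpha r p k -> (n <= k)%N].

Definition nstar alpha r p : nat := xget 0 (is_nstar alpha r p).

Lemma nstarP alpha r p : 0 < alpha -> 0 < r < 1 -> (1 <= p)%E ->
  is_nstar alpha r p (nstar alpha r p).
Proof.
move=> alpha0 /andP[r0 r1] p1.
have chi0 : 0 < chi p.
  by case: p p1 => [p| |] //; rewrite lee_fin => /(lt_le_trans ltr01).
have pi0 : 0 < pi :> R by exact: pi_gt0.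
have c0 : 0 < threshold p.
  have d0 : 0 < ((3 * pi) ^+ 3)^-1 :> R by rewrite invr_gt0 exprn_gt0 ?mulr_gt0.
  case: p p1 {chi0} => [p| |] //=; rewrite lee_fin => p1.
  have [_|pN1] := eqVneq p 1; first by rewrite invr_gt0.
  rewrite mulr_gt0// divr_gt0 ?(lt_le_trans ltr01 p1)//.
  by rewrite subr_gt0 lt_neqAle eq_sym pN1.
set c := threshold p in c0 *; have ar0 : 0 < alpha * r by exact: mulr_gt0.
have decay (s K : R) : 0 < s -> 0 < K ->
    exists m : nat, forall n : nat, (m < n)%N -> K / n%:R `^ s <= c / 2.
  move=> s0 K0; pose y := (2 * K / c) `^ s^-1.
  exists (Num.truncn y) => n yn.
  have n0 : (0 : R) < n%:R by rewrite ltr0n (leq_ltn_trans _ yn).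
  rewrite ler_pdivrMr ?powR_gt0// -ler_pdivrMl ?divr_gt0//.
  rewrite invfM invrK (_ : c^-1 * 2 * K = y `^ s); last first.
    rewrite /y -powRrM mulVf ?gt_eqF// powRr1 ?divr_ge0 ?mulr_ge0// ?ltW//.
    by rewrite -mulrA mulrC.
  apply: ge0_ler_powR; rewrite ?nnegrE ?powR_ge0 ?(ltW s0) ?(ltW n0)//.
  apply: (le_trans (ltW (truncnS_gt _))).
  by rewrite ler_nat.
suff [n n0 Pn] : exists2 n, (0 < n)%N & below_threshold alpha r p n.
  have ex : exists n, (0 < n)%N && `[< below_threshold alpha r p n >].
    by exists n; rewrite n0; apply/asboolP.
  apply: xgetPex; case: (ex_minnP ex) => m /andP[m0 /asboolP Pm] mmin.
  exists m; split=> // k k0 Pk; apply: mmin; rewrite k0; exact/asboolP.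
have r20 : 0 < r / 2 by rewrite divr_gt0.
pose K := 2 / r * pi `^ (r / 2) / (alpha * r).
have K0 : 0 < K by rewrite !(mulr_gt0, divr_gt0, powR_gt0)// ?invr_gt0.
have r10 : 0 < 1 - r by rewrite subr_gt0.
have [m1 H1] := decay _ _ r20 K0.
have [m2 H2] := decay _ _ r10 (mulr_gt0 ar0 chi0).
exists (maxn m1 m2).+1 => //; rewrite /below_threshold -/c.
set n := (maxn m1 m2).+1; have n0 : (0 : R) < n%:R by rewrite ltr0n.
rewrite (splitr c) lerD//; last by rewrite H2// ltnS leq_maxr.
apply: le_trans (H1 n _); last by rewrite ltnS leq_maxl.
have pn0 : 0 < pi * n%:R :> R by exact: mulr_gt0.
have lnE : ln (pi * n%:R) <= 2 / r * (pi `^ (r / 2) * n%:R `^ (r / 2)).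
  rewrite -powRM ?(ltW pi0) ?(ltW n0)//.
  have -> : ln (pi * n%:R) = 2 / r * ln ((pi * n%:R) `^ (r / 2)) :> R.
    by rewrite ln_powR mulrA [_ * (r / 2)]mulrA divfK ?gt_eqF// mulfV ?mul1r ?gt_eqF//.
  rewrite ler_pM2l ?divr_gt0//; exact/ltW/ln_sublinear/powR_gt0.
rewrite ler_pdivrMr ?mulr_gt0 ?powR_gt0//; apply: (le_trans lnE).
have -> : (n%:R : R) `^ r = n%:R `^ (r / 2) * n%:R `^ (r / 2).
  by rewrite -powRD ?gt_eqF ?implybT// -splitr.
set u := n%:R `^ (r / 2); have u0 : u != 0 by rewrite gt_eqF ?powR_gt0.
have arN0 : alpha * r != 0 by rewrite gt_eqF.
rewrite /K le_eqVlt; apply/orP; left; apply/eqP.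
move: (alpha * r) arN0 (pi `^ _) (2 / r) u u0 => a a0 v w u u0.
rewrite [a * _]mulrC mulrA -[LHS]mulr1 !mulrA divfK// -!mulrA.
by congr (w * (v * _)); rewrite mulrCA mulVf.
Qed.

End ThresholdIndex.

Section Bound.
Context {R : realType}.

(* The common right-hand side of the estimate and of the equality, with
   q the exponent conjugate to p, gamma the bounded factor, and
   E the best approximation of the generalized derivative. *)
Definition interp_bound (alpha r p q : R) (n : nat) (x gamma E : R) : R :=
  2 * expR (- alpha * n%:R `^ r) * n%:R `^ ((1 - r) / p)
  * `|sin ((2 * n%:R - 1) / 2 * x)|
  * (normLp q%:E cos / (pi `^ (1 + q^-1) * (alpha * r) `^ p^-1)
       * hypergeometric (1 / 2) ((3 - q) / 2) (3 / 2) 1 `^ q^-1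
     + gamma * ((1 + (alpha * r) `^ ((q - 1) / p) / (q - 1))
                  * (1 / n%:R `^ ((1 - r) / p))
                + p `^ q^-1 / ((alpha * r) `^ (1 + p^-1) * n%:R `^ r)))
  * E.

End Bound.

(* Main.v *)
(* Write N = 2n - 1.  Since Lagrange interpolation at the nodes reproduces
   trigonometric polynomials of order < n, the error at x is [pi^-1 * \int K phi] for a kernel
   K orthogonal to all of them; by duality both parts of the theorem amount to evaluating the
   L_q norm of K, the extremal phi of Hoelder's inequality giving (ii).  Aliasing turns the
   cosine series of K into blocks of sines whose common factor is a multiple of sin (N x / 2).
   The coefficients satisfy a_(k+1) >= rho a_k with rho = exp (- alpha r n^(r-1)), so Abel
   summation against 1 - rho e^(iu) shows that, up to an error small relative to the envelope,
   K(x + u) is 2 a_n sin (N x / 2) Im (e^(i (n u + theta)) / (1 - rho e^(iu))).  Averaging in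
   theta replaces the rapidly oscillating numerator by the constant (2 pi)^(-1/q) ||cos||_q, and
   the envelope |1 - rho e^(iu)|^(-1) is within O(1) of (l^2 + u^2)^(-1/2), l = alpha r n^(r-1),
   whose L_q norm over the line is the hypergeometric value of the main term. *)
From HB Require Import structures.
Require Import Defs.
From mathcomp Require Import all_boot all_order all_algebra.
From mathcomp Require Import all_classical all_reals all_analysis.
From mathcomp Require Import measurable_realfun ring lra.
Import Order.TTheory GRing.Theory Num.Theory.
Import numFieldNormedType.Exports.

Set Implicit Arguments.
Unset Strict Implicit.
Unset Printing Implicit Defensive.

Local Open Scope classical_set_scope.
Local Open Scope ring_scope.

(** * Integrals and norms over a period *)

(** The remainder must be uniform in [p], [beta], [x] and [alpha * r], which dictates how each loss
    is measured. Write [l = alpha * r * n ^ (r - 1)] and [w = n * l]. Replacing the envelope by its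
    model costs a constant, the 1 of the remainder. Restricting the line to one period loses a tail
    which, after taking [q]-th roots, is of order [l ^ ((q - 1) / p) / (q - 1)]. Averaging and the
    later blocks lose a fraction [O(1 / w)] of the envelope norm, which is at most
    [2 * p ^ (1 / q) * l ^ (- 1 / p)]: this is the last term. Abel summation also loses a fraction
    [l], but [l] times the envelope norm is at most 2 once [l * p <= 1 / 100]. The threshold is used
    in the form [w >= 300] and [l * p <= 1 / 100]. The delicate point is the hypergeometric value: 1
    lies on the boundary of the disc of convergence and [(3 - q) / 2] may be negative. Remainders of
    constant sign settle both convergence and the exchange of limits. One [gamma], found by solving
    for the norm of [K], serves both parts; its bound [150 / pi] lies far below [20 * pi ^ 4], so
    crude numerical constants suffice. *)

Section PeriodicIntegrals.
Context {R : realType}.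
Local Notation mu := (@lebesgue_measure R).
Implicit Types (a b c d T : R).

Lemma lebesgue_measure_shift c (A : set R) : measurable A ->
  pushforward mu (fun x : R => x + c : measurableTypeR R) A = mu A.
Proof.
have mc : measurable_fun [set: measurableTypeR R]
    (fun x : R => x + c : measurableTypeR R) by exact: measurable_funD.
pose f : {mfun (measurableTypeR R) >-> (measurableTypeR R)} :=
  HB.pack (fun x : R => x + c : measurableTypeR R)
    (isMeasurableFun.Build _ _ _ _ _ mc).
move=> mA; apply/esym/(@lebesgue_measure_unique R
  [the measure _ _ of pushforward mu f]) => //= _ [[a b]] _ <-.
rewrite /pushforward (_ : _ @^-1` _ = `]a - c, b - c]%classic); last first.
  by apply/seteqP; split=> x /=; rewrite !in_itv/= ltrBlDr lerBrDr.
rewrite !lebesgue_measure_itv/= !lte_fin ltrD2r.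
by case: ifPn => // _; congr (_%:E); ring.
Qed.

Lemma ge0_integral_shift c (D : set R) (f : R -> \bar R) :
  measurable D -> measurable_fun setT f -> (forall x, 0 <= f x)%E ->
  (\int[mu]_(x in D) f x = \int[mu]_(x in [set x | D (x + c)%R]) f (x + c)%R)%E.
Proof.
move=> mD mf f0.
have mc : measurable_fun [set: measurableTypeR R]
    (fun x : R => x + c : measurableTypeR R) by exact: measurable_funD.
rewrite (_ : [set x | D (x + c)%R] =
  (fun x : R => x + c : measurableTypeR R) @^-1` D) //.
rewrite -(ge0_integral_pushforward mc)//=; last exact: measurable_funS mf.
by apply: eq_measure_integral => //= A mA AS; exact/esym/lebesgue_measure_shift.
Qed.

Lemma ge0_integral_itv_split a b c (f : R -> \bar R) :
  a <= b -> b <= c -> measurable_fun setT f -> (forall x, 0 <= f x)%E ->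
  (\int[mu]_(x in `[a, c[) f x =
   \int[mu]_(x in `[a, b[) f x + \int[mu]_(x in `[b, c[) f x)%E.
Proof.
move=> ab bc mf f0.
rewrite (@itv_bndbnd_setU _ _ _ (BLeft b))//.
rewrite ge0_integral_setU//=; first exact: measurable_funS mf.
apply/disj_setPS => x /=; rewrite !in_itv/= => -[/andP[_ xb] /andP[bx _]].
by move: (lt_le_trans xb bx); rewrite ltxx.
Qed.

(** Cut at [a + T]: the piece beyond it is the translate by [T] of the dropped piece [[a, a + d[].
    The condition [d <= T] keeps the cut inside the window. *)
Let ge0_period_step T (f : R -> \bar R) a d : 0 < T -> 0 <= d <= T ->
  measurable_fun setT f -> (forall x, 0 <= f x)%E -> (forall x, f (x + T)%R = f x) ->
  (\int[mu]_(x in `[(a + d)%R, (a + d + T)%R[) f x =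
   \int[mu]_(x in `[a, (a + T)%R[) f x)%E.
Proof.
move=> T0 /andP[d0 dT] mf f0 fT.
rewrite (@ge0_integral_itv_split a (a + d) (a + T))// ?lerDl ?lerD2l//.
rewrite (@ge0_integral_itv_split (a + d) (a + T) (a + d + T))//; last 2 first.
- by rewrite lerD2l.
- by rewrite -addrA lerD2l lerDr.
rewrite addeC; congr (_ + _)%E.
rewrite (@ge0_integral_shift T)//.
under eq_integral do rewrite fT.
congr (integral _ _ _); apply/seteqP; split=> x /=;
  by rewrite !in_itv/= lerD2r ltrD2r.
Qed.

Lemma ge0_integral_periodic T (f : R -> \bar R) a b : 0 < T ->
  measurable_fun setT f -> (forall x, 0 <= f x)%E -> (forall x, f (x + T)%R = f x) ->
  (\int[mu]_(x in `[a, (a + T)%R]) f x = \int[mu]_(x in `[b, (b + T)%R]) f x)%E.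
Proof.
move=> T0 mf f0 fT.
have co c : (\int[mu]_(x in `[c, (c + T)%R]) f x =
             \int[mu]_(x in `[c, (c + T)%R[) f x)%E.
  by rewrite integral_itv_bndo_bndc//; exact: measurable_funS mf.
rewrite !co; wlog ab : a b / a <= b.
  move=> H; have [/H //|/ltW/H ->//] := leP a b.
(* A long move is made of [m] equal steps, with [m] large enough that none exceeds a period. *)
pose m := (Num.truncn ((b - a) / T)).+1.
pose d := (b - a) / m%:R.
have d0 : 0 <= d by rewrite divr_ge0// subr_ge0.
have dT : d <= T.
  by rewrite ler_pdivrMr// mulrC -ler_pdivrMr// ltW// truncnS_gt.
have -> : b = a + d *+ m.
  by rewrite -mulr_natr divfK ?pnatr_eq0// addrC subrK.
move: (m) => k; elim: k => [|k ->]; first by rewrite mulr0n addr0.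
by rewrite mulrSr addrA (@ge0_period_step T f (a + d *+ k) d)// d0 dT.
Qed.

End PeriodicIntegrals.

Section BoundedMeasurable.
Context {R : realType}.
Local Notation mu := (@lebesgue_measure R).
Implicit Types (f g h : R -> R) (a b c q : R).

(** Every kernel met below is bounded and measurable, a class closed under the algebraic operations
    and translation, so that integrability on bounded intervals is automatic. *)
Record bmf f : Prop := Bmf {
  bmf_measurable : measurable_fun setT f;
  bmf_bounded : exists M, forall x, `|f x| <= M }.

Lemma bmf_cst c : bmf (fun=> c).
Proof. by split=> //; exists `|c|. Qed.

Lemma bmfD f g : bmf f -> bmf g -> bmf (fun x => f x + g x).
Proof.
move=> [mf [M fM]] [mg [K gK]]; split; first exact: measurable_funD.
by exists (M + K) => x; rewrite (le_trans (ler_normD _ _))// lerD.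
Qed.

Lemma bmfM f g : bmf f -> bmf g -> bmf (fun x => f x * g x).
Proof.
move=> [mf [M fM]] [mg [K gK]]; split; first exact: measurable_funM.
by exists (M * K) => x; rewrite normrM ler_pM.
Qed.

Lemma bmfZ c f : bmf f -> bmf (fun x => c * f x).
Proof. exact/bmfM/bmf_cst. Qed.

Lemma bmfN f : bmf f -> bmf (fun x => - f x).
Proof. by move=> /(bmfZ (- 1)); under eq_fun do rewrite mulN1r. Qed.

Lemma bmfB f g : bmf f -> bmf g -> bmf (fun x => f x - g x).
Proof. by move=> bf /bmfN; exact: bmfD. Qed.

Lemma bmf_norm f : bmf f -> bmf (fun x => `|f x|).
Proof.
move=> [mf [M fM]]; split; first exact: measurableT_comp.
by exists M => x; rewrite normr_id.
Qed.

Lemma bmf_powR q f : 0 <= q -> bmf f -> bmf (fun x => `|f x| `^ q).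
Proof.
move=> q0 /bmf_norm[mf [M fM]]; split.
  exact: (measurableT_comp (measurable_powR q)).
exists (M `^ q) => x; rewrite ger0_norm ?powR_ge0// ge0_ler_powR ?nnegrE//.
  by rewrite (le_trans _ (fM x)).
by rewrite (le_trans _ (fM x)) ?normr_id.
Qed.

Lemma bmf_continuous_bounded f M : continuous f -> (forall x, `|f x| <= M) ->
  bmf f.
Proof. by move=> cf fM; split; [exact: continuous_measurable_fun | exists M]. Qed.

Lemma bmf_affine k c f : bmf f -> bmf (fun x => f (k * x + c)).
Proof.
move=> [mf [M fM]]; split; last by exists M.
by apply: (measurableT_comp mf); apply: measurable_funD.
Qed.

Lemma bmf_shift c f : bmf f -> bmf (fun x => f (x + c)).
Proof. by move=> /(bmf_affine 1 c); under eq_fun do rewrite mul1r. Qed.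

Lemma bmf_sum I (r : seq I) (P : pred I) (F : I -> R -> R) :
  (forall i, bmf (F i)) -> bmf (fun x => \sum_(i <- r | P i) F i x).
Proof.
move=> bF; elim: r => [|i r IH].
  by under eq_fun do rewrite big_nil; exact: bmf_cst.
under eq_fun do rewrite big_cons.
by case: (P i) => //; exact: bmfD.
Qed.

Lemma bmf_cos : bmf (@cos R).
Proof. apply: (@bmf_continuous_bounded _ 1); [exact: continuous_cos | exact: cos_max]. Qed.

Lemma bmf_sin : bmf (@sin R).
Proof. apply: (@bmf_continuous_bounded _ 1); [exact: continuous_sin | exact: sin_max]. Qed.

Lemma bmf_integrable f a b : bmf f -> mu.-integrable `[a, b] (EFin \o f).
Proof.
move=> [mf [M fM]]; apply: measurable_bounded_integrable => //.
- by rewrite [ltLHS]lebesgue_measure_itv/=; case: ifPn => //; rewrite -EFinB ltry.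
- exact: measurable_funS mf.
- exists M; split; rewrite ?num_real// => K MK x _.
  exact: le_trans (fM x) (ltW MK).
Qed.

Lemma le_bmf_integral f g a b : bmf f -> bmf g ->
  (forall x, a <= x <= b -> f x <= g x) ->
  \int[mu]_(x in `[a, b]) f x <= \int[mu]_(x in `[a, b]) g x.
Proof.
move=> bf bg fg; exact: (le_Rintegral _ (bmf_integrable a b bf) (bmf_integrable a b bg)).
Qed.

Lemma EFin_bmf_integral f a b : bmf f ->
  ((\int[mu]_(x in `[a, b]) f x)%:E = \int[mu]_(x in `[a, b]) (f x)%:E)%E.
Proof.
by move=> bf; rewrite fineK//; apply: integrable_fin_num => //; exact: bmf_integrable.
Qed.

End BoundedMeasurable.

(** The left end [a] of the period is kept free: duality is done on [[0, 2 * pi]], whereas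
    comparison with an even envelope needs [[- pi, pi]]. *)
HB.lock Definition pnorm {R : realType} (q a : R) (f : R -> R) : R :=
  (\int[lebesgue_measure]_(x in `[a, a + 2 * pi]) (`|f x| `^ q)) `^ q^-1.

Section PeriodNorm.
Context {R : realType}.
Local Notation mu := (@lebesgue_measure R).
Implicit Types (f g h : R -> R) (a b c q : R).

Local Notation per := (2 * pi : R).

Let per_gt0 : 0 < per. Proof. by rewrite mulr_gt0// pi_gt0. Qed.

Definition pmeasure a : {measure set (measurableTypeR R) -> \bar R} :=
  [the {measure set (measurableTypeR R) -> \bar R} of
     mrestr mu (measurable_itv `[a, a + per])].

Lemma ge0_integral_pmeasure a (f : R -> \bar R) :
  measurable_fun setT f -> (forall x, 0 <= f x)%E ->
  (\int[pmeasure a]_x f x = \int[mu]_(x in `[a, (a + per)%R]) f x)%E.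
Proof.
move=> mf f0; set D := `[a, a + per]%classic.
have mD : measurable D by exact: measurable_itv.
have mDC : measurable (~` D) by exact: measurableC.
rewrite -(setUv D) ge0_integral_setU//=; first last.
- exact/disj_setPCl.
- by rewrite setUv.
rewrite [X in (_ + X)%E]null_set_integral//; last 2 first.
- exact: measurable_funS mf.
- by rewrite /= /mrestr setICl measure0.
rewrite adde0; apply: eq_measure_integral => //= A mA AD.
by rewrite /mrestr setIidl.
Qed.

Lemma pmeasure_setT a : pmeasure a setT = per%:E.
Proof.
rewrite /= /mrestr setTI lebesgue_measure_itv/= lte_fin ltrDl per_gt0.
by rewrite -EFinB addrAC subrr add0r.
Qed.

Lemma Lnorm_pmeasure q a f : 0 < q -> bmf f ->
  'N[pmeasure a]_q%:E[EFin \o f]%E = (pnorm q a f)%:E.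
Proof.
move=> q0 bf; rewrite unlock ge0_integral_pmeasure//; last 2 first.
- apply/measurable_EFinP; exact: (bmf_measurable (bmf_powR (ltW q0) bf)).
- by move=> x; rewrite poweR_ge0.
rewrite pnorm.unlock -poweR_EFin EFin_bmf_integral//.
exact: bmf_powR (ltW q0) bf.
Qed.

Lemma pnorm_ge0 q a f : 0 <= pnorm q a f.
Proof. by rewrite pnorm.unlock powR_ge0. Qed.

Lemma pnormX q a f : 0 < q ->
  pnorm q a f `^ q = \int[mu]_(x in `[a, a + per]) (`|f x| `^ q).
Proof.
move=> q0; rewrite pnorm.unlock -powRrM mulVf ?gt_eqF// powRr1//.
by apply: Rintegral_ge0 => x _; exact: powR_ge0.
Qed.

Lemma ler_pnormD q a f g : 1 <= q -> bmf f -> bmf g ->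
  pnorm q a (fun x => f x + g x) <= pnorm q a f + pnorm q a g.
Proof.
move=> q1 bf bg; have q0 : 0 < q by rewrite (lt_le_trans ltr01).
rewrite -lee_fin EFinD -(Lnorm_pmeasure _ q0 bf) -(Lnorm_pmeasure _ q0 bg).
rewrite -(Lnorm_pmeasure _ q0 (bmfD bf bg)).
by apply: minkowski_EFin => //; [exact: bmf_measurable bf|exact: bmf_measurable bg].
Qed.

Lemma ler_pnorm q a f g : 0 < q -> bmf f -> bmf g ->
  (forall x, a <= x <= a + per -> `|f x| <= `|g x|) ->
  pnorm q a f <= pnorm q a g.
Proof.
move=> q0 bf bg fg; rewrite pnorm.unlock ge0_ler_powR ?invr_ge0 ?nnegrE ?(ltW q0)//.
- by apply: Rintegral_ge0 => x _; exact: powR_ge0.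
- by apply: Rintegral_ge0 => x _; exact: powR_ge0.
apply: le_bmf_integral; [exact: bmf_powR (ltW q0) bf|exact: bmf_powR (ltW q0) bg|].
by move=> x /fg fgx; rewrite ge0_ler_powR ?nnegrE ?(ltW q0).
Qed.

Lemma eq_pnorm q a f g : (forall x, `|f x| = `|g x|) ->
  pnorm q a f = pnorm q a g.
Proof.
move=> fg; rewrite pnorm.unlock.
by under eq_Rintegral do rewrite fg.
Qed.

Lemma pnormZ q a c f : 0 < q -> bmf f ->
  pnorm q a (fun x => c * f x) = `|c| * pnorm q a f.
Proof.
move=> q0 bf; rewrite pnorm.unlock.
under eq_Rintegral do rewrite normrM powRM//.
rewrite RintegralZl//; last exact/bmf_integrable/bmf_powR/bf/ltW.
rewrite powRM ?powR_ge0//; last by apply: Rintegral_ge0 => x _; exact: powR_ge0.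
by rewrite -powRrM mulfV ?gt_eqF// powRr1.
Qed.

Lemma pnorm_cst q a c : 0 < q -> pnorm q a (fun=> c) = `|c| * per `^ q^-1.
Proof.
move=> q0; rewrite pnorm.unlock Rintegral_cst//.
rewrite [X in fine X](_ : _ = per%:E)/=; last first.
  by rewrite -(pmeasure_setT a) /= /mrestr setTI.
by rewrite powRM ?powR_ge0 ?(ltW per_gt0)// -powRrM mulfV ?gt_eqF// powRr1.
Qed.

Lemma pnorm_periodic q a b f : 0 <= q -> bmf f -> periodic f per ->
  pnorm q a f = pnorm q b f.
Proof.
move=> q0 bf pf; rewrite pnorm.unlock /Rintegral; congr (fine _ `^ _).
apply: ge0_integral_periodic => //; last by move=> x; rewrite pf.
by apply/measurable_EFinP; exact: (bmf_measurable (bmf_powR q0 bf)).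
Qed.

Lemma pnorm_shift q a b c f : 0 <= q -> bmf f -> periodic f per ->
  pnorm q a (fun x => f (x + c)) = pnorm q b f.
Proof.
move=> q0 bf pf; rewrite -(pnorm_periodic (a + c) b q0 bf pf) pnorm.unlock /Rintegral.
have mf : measurable_fun setT (fun x => (`|f x| `^ q)%:E).
  by apply/measurable_EFinP; exact: (bmf_measurable (bmf_powR q0 bf)).
apply: (congr1 (fun z => fine z `^ q^-1)); apply/esym.
etransitivity.
  apply: (@ge0_integral_shift _ c _ _ (measurable_itv _) mf) => x.
  by rewrite lee_fin powR_ge0.
apply: (congr1 (fun D => integral _ D _)).
by apply/seteqP; split=> x /=; rewrite !in_itv/= lerD2r -addrA [c + _]addrC addrA lerD2r.
Qed.

(** Minkowski in both directions. Each passage from a kernel to a simpler one takes this form: a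
    pointwise error bound becomes a bound between norms. *)
Lemma pnorm_dist q a f g h : 1 <= q -> bmf f -> bmf g -> bmf h ->
  (forall x, a <= x <= a + per -> `|f x - g x| <= `|h x|) ->
  `|pnorm q a f - pnorm q a g| <= pnorm q a h.
Proof.
move=> q1 bf bg bh fgh; have q0 : 0 < q by rewrite (lt_le_trans ltr01).
have H f' g' : bmf f' -> bmf g' ->
    (forall x, a <= x <= a + per -> `|f' x - g' x| <= `|h x|) ->
    pnorm q a f' - pnorm q a g' <= pnorm q a h.
  move=> bf' bg' fg; rewrite lerBlDl.
  have -> : pnorm q a f' = pnorm q a (fun x => g' x + (f' x - g' x)).
    by apply: eq_pnorm => x; rewrite addrC subrK.
  apply: (le_trans (ler_pnormD a q1 bg' (bmfB bf' bg'))).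
  by rewrite lerD2l; apply: (ler_pnorm q0 (bmfB bf' bg') bh).
rewrite ler_norml; apply/andP; split; last exact: H.
rewrite -opprB lerN2; apply: H => // x ax.
by rewrite distrC; exact: fgh.
Qed.

End PeriodNorm.

(** * The generalized Poisson kernel *)

Section SignedPeriodicIntegrals.
Context {R : realType}.
Local Notation mu := (@lebesgue_measure R).
Implicit Types (a b c k d : R) (f g : R -> R).
Local Notation per := (2 * pi : R).

Let per_gt0 : 0 < per. Proof. by rewrite mulr_gt0// pi_gt0. Qed.

Lemma mul_sin_cos (A B : R) : sin A * cos B = 2^-1 * (sin (A + B) + sin (A - B)).
Proof. by rewrite sinD sinB; field. Qed.

Lemma two_sin_cos (A B : R) : 2 * sin A * cos B = sin (B + A) - sin (B - A).
Proof. by rewrite sinD sinB; ring. Qed.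

Lemma two_cos_cos (A B : R) : 2 * cos A * cos B = cos (A + B) + cos (A - B).
Proof. by rewrite cosD cosB; ring. Qed.

Lemma Rintegral_periodic a b f : measurable_fun setT f -> periodic f per ->
  \int[mu]_(x in `[a, a + per]) f x = \int[mu]_(x in `[b, b + per]) f x.
Proof.
move=> mf pf; rewrite /Rintegral; apply: (congr1 fine); rewrite [LHS]integralE [RHS]integralE.
have mF : measurable_fun setT (EFin \o f) by exact/measurable_EFinP.
apply: (f_equal2 (fun x y => x - y)%E); apply: ge0_integral_periodic => //.
- exact: measurable_funepos.
- by move=> x; rewrite !funeposE pf.
- exact: measurable_funeneg.
- by move=> x; rewrite !funenegE pf.
Qed.

Lemma Rintegral_shift a c f : measurable_fun setT f ->
  \int[mu]_(x in `[a, a + per]) f (x + c) =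
  \int[mu]_(x in `[a + c, a + c + per]) f x.
Proof.
move=> mf; rewrite /Rintegral; apply: (congr1 fine).
have mF : measurable_fun setT (EFin \o f) by exact/measurable_EFinP.
have itvE : [set x | `[a + c, a + c + per]%classic (x + c)] = `[a, a + per]%classic.
  by apply/seteqP; split=> x /=; rewrite !in_itv/= lerD2r -addrA [c + _]addrC addrA lerD2r.
rewrite [LHS]integralE [RHS]integralE.
apply: (f_equal2 (fun x y => x - y)%E); apply/esym.
- have := ge0_integral_shift c (measurable_itv `[a + c, a + c + per])
    (measurable_funepos mF) (fun x => funepos_ge0 _ x).
  rewrite itvE => E; etransitivity; first exact: E.
  by apply: eq_integral => x _; rewrite !funeposE.
- have := ge0_integral_shift c (measurable_itv `[a + c, a + c + per])
    (measurable_funeneg mF) (fun x => funeneg_ge0 _ x).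
  rewrite itvE => E; etransitivity; first exact: E.
  by apply: eq_integral => x _; rewrite !funenegE.
Qed.

(** Translation by [pi / k] reverses the sign of the integrand but does not change an integral over
    a period, so the integral equals its opposite. *)
Lemma integral_sin_period (k : nat) d a : (0 < k)%N ->
  \int[mu]_(x in `[a, a + per]) sin (k%:R * x + d) = 0.
Proof.
move=> k0; have kN0 : k%:R != 0 :> R by rewrite pnatr_eq0 -lt0n.
pose f x : R := sin (k%:R * x + d).
have bf : bmf f by exact/bmf_affine/bmf_sin.
have pf : periodic f per.
  move=> x; rewrite /f; have -> : k%:R * (x + per) + d = k%:R * x + d + (pi *+ 2) *+ k.
    by rewrite -mulrnA -[pi *+ _]mulr_natr natrM; ring.
  by rewrite periodicn//; exact: sinD2pi.
have mf := bmf_measurable bf.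
have : \int[mu]_(x in `[a, a + per]) f (x + pi / k%:R) = \int[mu]_(x in `[a, a + per]) f x.
  by rewrite Rintegral_shift//; exact: Rintegral_periodic.
under eq_Rintegral => x _.
  rewrite /f mulrDr mulrCA mulfV// mulr1 addrAC sinDpi -mulN1r; over.
rewrite RintegralZl//; last exact: bmf_integrable.
rewrite mulN1r -/(f _) => /eqP; rewrite eq_sym -subr_eq0 opprK -mulr2n mulrn_eq0/=.
by move/eqP.
Qed.

Lemma integral_sin_cos_period (k j : nat) d e a : (j < k)%N ->
  \int[mu]_(x in `[a, a + per]) (sin (k%:R * x + d) * cos (j%:R * x + e)) = 0.
Proof.
move=> jk.
have bs (i : nat) c : bmf (fun x : R => sin (i%:R * x + c)) by exact/bmf_affine/bmf_sin.
under eq_Rintegral => x _.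
  have -> : sin (k%:R * x + d) * cos (j%:R * x + e) =
    2^-1 * (sin ((k + j)%:R * x + (d + e)) + sin ((k - j)%:R * x + (d - e))).
    have -> : (k + j)%:R * x + (d + e) = (k%:R * x + d) + (j%:R * x + e).
      by rewrite natrD; ring.
    have -> : (k - j)%:R * x + (d - e) = (k%:R * x + d) - (j%:R * x + e).
      by rewrite natrB 1?ltnW//; ring.
    exact: mul_sin_cos.
  over.
rewrite RintegralZl//; last exact/bmf_integrable/bmfD.
rewrite RintegralD//; [|exact: bmf_integrable|exact: bmf_integrable].
by rewrite !integral_sin_period ?addr0 ?mulr0 ?subn_gt0// addn_gt0 (leq_ltn_trans _ jk).
Qed.

End SignedPeriodicIntegrals.

Section UniformSeries.
Context {R : realType}.
Implicit Types (F : nat -> R -> R) (A : nat -> R) (u : nat -> R) (C : R).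

Lemma sum_inv_square_tail (M M' : nat) : (0 < M)%N ->
  \sum_(M <= k < M') (k%:R ^- 2 : R) <= 2 / M%:R.
Proof.
move=> M0; have [MM'|MM'] := leqP M M'; last first.
  by rewrite big_geq ?divr_ge0// ltnW.
(* The induction carries the telescoping form: for [k >= 1], [1 / k ^ 2] is at most
   [2 / k - 2 / (k + 1)]. *)
have H : \sum_(M <= k < M') (k%:R ^- 2 : R) <= 2 / M%:R - 2 / M'%:R.
  elim: M' MM' => [|m IH]; first by rewrite leqNgt M0.
  rewrite leq_eqVlt => /predU1P[<-|]; first by rewrite big_geq// subrr.
  rewrite ltnS => Mm; rewrite big_nat_recr//=.
  apply: (le_trans (lerD (IH Mm) (lexx _))).
  have m1 : (1 <= m%:R :> R) by rewrite ler1n (leq_trans M0).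
  rewrite -[m.+1%:R]natr1; set x : R := m%:R in m1 *.
  have x0 : 0 < x by rewrite (lt_le_trans ltr01).
  rewrite -addrA lerD2l -subr_ge0.
  have -> : - (2 / (x + 1)) - (- (2 / x) + x ^- 2) = (x - 1) / (x ^+ 2 * (x + 1)).
    by field; rewrite !gt_eqF// addr_gt0.
  by rewrite divr_ge0 ?subr_ge0// mulr_ge0 ?exprn_ge0 ?addr_ge0 ?(ltW x0).
by apply: (le_trans H); rewrite gerBl divr_ge0.
Qed.

(* A uniform O(1/M) tail, so that limits commute with integrals over bounded intervals. *)
Lemma uniform_series F C :
  (forall k x, `|F k x| <= C * k%:R ^- 2) ->
  forall x, cvgn (fun m => \sum_(1 <= k < m) F k x) /\
    forall M, (0 < M)%N ->
    `|limn (fun m => \sum_(1 <= k < m) F k x) - \sum_(1 <= k < M) F k x| <= 2 * C / M%:R.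
Proof.
move=> FC x; set S := fun m => \sum_(1 <= k < m) F k x.
have C0 : 0 <= C by have := le_trans (normr_ge0 _) (FC 1%N x); rewrite expr1n invr1 mulr1.
have tail M M' : (0 < M)%N -> (M <= M')%N -> `|S M' - S M| <= 2 * C / M%:R.
  move=> M0 MM'; rewrite /S (big_cat_nat M0 MM')//= addrAC subrr add0r.
  apply: (le_trans (ler_norm_sum _ _ _)).
  apply: (@le_trans _ _ (\sum_(M <= k < M') C * k%:R ^- 2)).
    by apply: ler_sum => k _; exact: FC.
  by rewrite -mulr_sumr -mulrA [leRHS]mulrCA ler_wpM2l// sum_inv_square_tail.
have cS : cvgn S.
  apply/cauchy_cvgP; apply: cauchy_exP => /= e e0.
  pose M := (Num.truncn (2 * C / e)).+1.
  exists (S M); exists M => // m /= Mm.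
  rewrite /ball/= distrC; apply: (le_lt_trans (tail _ _ _ Mm)) => //.
  by rewrite ltr_pdivrMr// -ltr_pdivrMl// mulrC truncnS_gt.
split=> // M M0; apply/ler_addgt0Pr => e e0.
have := (cvgrPdist_le _ _).1 cS e e0 => -[m0 _ /(_ (maxn m0 M))] /=.
rewrite leq_maxl => /(_ isT) le1.
have := tail M (maxn m0 M) M0 (leq_maxr _ _) => le2.
by rewrite -(subrKA (S (maxn m0 M))) addrC (le_trans (ler_normD _ _))// lerD.
Qed.

Lemma uniform_series_bmf F C : (forall k, bmf (F k)) ->
  (forall k x, `|F k x| <= C * k%:R ^- 2) ->
  bmf (fun x => limn (fun m => \sum_(1 <= k < m) F k x)).
Proof.
move=> bF FC; split.
  apply: (measurable_fun_cvg (h := fun m x => \sum_(1 <= k < m) F k x)) => [m|x _].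
    exact: bmf_measurable (bmf_sum _ _ bF).
  exact: (uniform_series FC x).1.
exists (2 * C) => x; have := (uniform_series FC x).2 1%N isT.
by rewrite big_geq// subr0 divr1.
Qed.

End UniformSeries.

Section PoissonKernel.
Context {R : realType}.
Variables alpha r beta : R.
Hypotheses (alpha0 : 0 < alpha) (r0 : 0 < r).
Local Notation per := (2 * pi : R).

Definition pcoef (k : nat) : R := expR (- alpha * k%:R `^ r).
Definition pterm (k : nat) (t : R) : R := pcoef k * cos (k%:R * t - beta * pi / 2).

Lemma pcoef_gt0 k : 0 < pcoef k. Proof. exact: expR_gt0. Qed.

Lemma pcoef_bound : exists C : R, forall k : nat, (0 < k)%N -> pcoef k <= C * k%:R ^- 2.
Proof.
(* With [r * m >= 2], the inequality [exp y >= (y / m) ^ m] at [y = alpha * k ^ r] yields at least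
   the second power of [k]. *)
pose m := (Num.truncn (2 / r)).+1.
have rm : 2 <= r * m%:R by rewrite mulrC -ler_pdivrMr// ltW// truncnS_gt.
have m0 : 0 < m%:R :> R by rewrite ltr0n.
exists ((m%:R / alpha) ^+ m) => k k0.
set x : R := k%:R; have x1 : 1 <= x by rewrite ler1n.
have x0 : 0 < x by rewrite (lt_le_trans ltr01).
have xr0 : 0 < x `^ r by exact: powR_gt0.
rewrite /pcoef mulNr expRN -/x.
set y := alpha * x `^ r; have y0 : 0 < y by exact: mulr_gt0.
have le1 : (y / m%:R) ^+ m <= expR y.
  rewrite -[in leRHS](divfK (lt0r_neq0 m0) y) expRM_natr lerXn2r ?nnegrE ?expR_ge0 ?divr_ge0 ?(ltW y0)//.
  by rewrite (le_trans _ (expR_ge1Dx _))// lerDr.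
apply: (@le_trans _ _ ((y / m%:R) ^+ m)^-1).
  by rewrite lef_pV2 ?posrE ?expR_gt0// exprn_gt0// divr_gt0.
have -> : ((y / m%:R) ^+ m)^-1 = (m%:R / alpha) ^+ m / (x `^ r) ^+ m.
  by rewrite /y -exprVn invf_div invfM mulrA exprMn -exprVn.
rewrite ler_wpM2l ?exprn_ge0 ?divr_ge0 ?(ltW alpha0)//.
rewrite lef_pV2 ?posrE ?exprn_gt0// -!powR_mulrn ?(ltW x0) ?powR_ge0// -powRrM.
exact: ler_powR.
Qed.

Definition pkernel_partial (M : nat) (t : R) : R := \sum_(1 <= k < M) pterm k t.

Lemma bmf_pterm k : bmf (pterm k).
Proof. exact/bmfZ/bmf_affine/bmf_cos. Qed.

Lemma poisson_kernelE t : poisson_kernel alpha r beta t =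
  limn (fun m => \sum_(1 <= k < m) pterm k t).
Proof. by []. Qed.

(** The bound [C * k ^- 2] asked by [uniform_series] is 0 at [k = 0], the inverse of 0 being 0,
    while [pterm 0] need not vanish. The sums start at 1, so that term may be replaced by 0. *)
Let trunc (k : nat) (t : R) : R := if (0 < k)%N then pterm k t else 0.

Let truncE t : (fun m => \sum_(1 <= k < m) pterm k t) =
  (fun m => \sum_(1 <= k < m) trunc k t).
Proof. by apply/funext => m; apply: eq_big_nat => k /andP[k0 _]; rewrite /trunc k0. Qed.

Let trunc_bound : exists C, forall k t, `|trunc k t| <= C * k%:R ^- 2.
Proof.
have [C HC] := pcoef_bound; exists C => -[|k] t; rewrite /trunc/=.
  by rewrite normr0 expr0n/= invr0 mulr0.
rewrite normrM gtr0_norm ?pcoef_gt0//.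
by rewrite -[leRHS]mulr1 ler_pM ?(ltW (pcoef_gt0 _)) ?HC// cos_max.
Qed.

Lemma poisson_kernel_tail : exists C, forall M t, (0 < M)%N ->
  `|poisson_kernel alpha r beta t - pkernel_partial M t| <= C / M%:R.
Proof.
have [C HC] := trunc_bound; exists (2 * C) => M t M0.
have := (uniform_series HC t).2 M M0.
by rewrite poisson_kernelE /pkernel_partial truncE -(congr1 (fun f => f M) (truncE t)).
Qed.

Lemma bmf_poisson_kernel : bmf (poisson_kernel alpha r beta).
Proof.
have [C HC] := trunc_bound.
have -> : poisson_kernel alpha r beta = fun t => limn (fun m => \sum_(1 <= k < m) trunc k t).
  by apply/funext => t; rewrite poisson_kernelE truncE.
apply: uniform_series_bmf HC => -[|k]; first exact: bmf_cst.
exact: bmf_pterm.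
Qed.

Lemma periodic_cos_nat (k : nat) (x d : R) : cos (k%:R * (x + per) + d) = cos (k%:R * x + d).
Proof.
have -> : k%:R * (x + per) + d = k%:R * x + d + (pi *+ 2) *+ k.
  by rewrite -mulrnA -[pi *+ _]mulr_natr natrM; ring.
by rewrite periodicn//; exact: cosD2pi.
Qed.

Lemma periodic_poisson_kernel : periodic (poisson_kernel alpha r beta) per.
Proof.
move=> t; rewrite !poisson_kernelE; apply: (congr1 (fun u : nat -> R => limn u)).
apply/funext => m; apply: eq_bigr => k _.
by rewrite /pterm periodic_cos_nat.
Qed.

End PoissonKernel.

(** * Trigonometric interpolation and its error kernel *)

Section TrigInterpolation.
Context {R : realType}.
Variable m : nat.
Local Notation n := m.+1.
Local Notation N := m.*2.+1.
Implicit Types (f T : R -> R) (c d y : R).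

Definition eqnode (j : nat) : R := j%:R * (2 * pi / N%:R).

(** The Dirichlet kernel of order [m] centred at node [j], divided by [N]: the fundamental
    polynomial of that node. *)
Definition tlagrange (j : nat) (y : R) : R :=
  N%:R^-1 * (1 + \sum_(1 <= i < m.+1) 2 * cos (i%:R * (y - eqnode j))).

Let NN0 : N%:R != 0 :> R. Proof. by rewrite pnatr_eq0. Qed.
Let NE : (N%:R : R) = 2 * m%:R + 1.
Proof. by rewrite -natr1 -muln2 natrM mulrC. Qed.

Lemma interp_nodeE j : interp_node n j = eqnode j :> R.
Proof.
rewrite /interp_node /eqnode; have -> : 2 * n%:R - 1 = N%:R :> R.
  by rewrite NE -natr1; ring.
by field.
Qed.

Lemma sum_cos_telescope (t c : R) (a b : nat) : (a <= b)%N ->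
  2 * sin (t / 2) * (\sum_(a <= j < b) cos (j%:R * t + c)) =
  sin (b%:R * t - t / 2 + c) - sin (a%:R * t - t / 2 + c).
Proof.
move=> ab; rewrite mulr_sumr.
rewrite (telescope_sumr_eq (fun j : nat => sin (j%:R * t - t / 2 + c)))// => j _.
rewrite two_sin_cos; congr (sin _ - sin _); last by ring.
by rewrite -natr1; field.
Qed.

Lemma sin_natpi (k : nat) c : sin (k%:R * pi + c) = (-1) ^+ k * sin c.
Proof.
elim: k => [|k IH]; first by rewrite mul0r add0r expr0 mul1r.
by rewrite -natr1 mulrDl mul1r addrAC sinDpi IH exprS mulN1r mulNr.
Qed.

Lemma cos_nat2pi (k : nat) c : cos (c + 2 * pi * k%:R) = cos c.
Proof.
have -> : 2 * pi * k%:R = (pi *+ 2) *+ k :> R.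
  by rewrite -mulrnA -[pi *+ _]mulr_natr natrM; ring.
by rewrite periodicn//; exact: cosD2pi.
Qed.

Let sin_pi_div_gt0 (k : nat) : (0 < k < N)%N -> 0 < sin (k%:R * (2 * pi / N%:R) / 2) :> R.
Proof.
move=> /andP[k0 kN]; apply: sin_gt0_pi.
have -> : k%:R * (2 * pi / N%:R) / 2 = pi * (k%:R / N%:R) :> R by field.
rewrite mulr_gt0 ?pi_gt0 ?divr_gt0 ?ltr0n//=.
by rewrite gtr_pMr ?pi_gt0// ltr_pdivrMr// mul1r ltr_nat.
Qed.

(** The angles form an arithmetic progression of step [t]. The telescoped sum has equal end values
    because [N * t] is a multiple of [2 * pi], and [sin (t / 2)] can be divided out because
    [0 < k < N]. *)
Lemma node_orthogonal (k : nat) c : (0 < k < N)%N ->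
  \sum_(0 <= j < N) cos (k%:R * eqnode j + c) = 0.
Proof.
move=> kN; have s0 := sin_pi_div_gt0 kN.
set t : R := k%:R * (2 * pi / N%:R) in s0 *.
have -> : \sum_(0 <= j < N) cos (k%:R * eqnode j + c) = \sum_(0 <= j < N) cos (j%:R * t + c).
  by apply: eq_bigr => j _; rewrite /eqnode /t mulrCA.
apply/eqP; rewrite -(mulrI_eq0 _ (mulfI _ : GRing.lreg (2 * sin (t / 2)))); last first.
  by rewrite mulf_neq0// ?gt_eqF.
rewrite sum_cos_telescope// mul0r add0r subr_eq0; apply/eqP.
have -> : N%:R * t - t / 2 + c = (2 * k)%:R * pi + (- (t / 2) + c).
  by rewrite /t natrM; field.
by rewrite sin_natpi mulnC exprM sqrr_sign mul1r.
Qed.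

Lemma node_orthogonal_diff (a b : nat) c : a != b -> (a - b < N)%N -> (b - a < N)%N ->
  \sum_(0 <= j < N) cos ((a%:R - b%:R) * eqnode j + c) = 0.
Proof.
move=> ab aN bN; have [lt_ab|lt_ba|e] := ltngtP a b; last by rewrite e eqxx in ab.
- rewrite -[RHS](@node_orthogonal (b - a) (- c)); last by rewrite subn_gt0 lt_ab.
  by apply: eq_bigr => j _; rewrite -cosN natrB 1?ltnW//; congr cos; ring.
- rewrite -[RHS](@node_orthogonal (a - b) c); last by rewrite subn_gt0 lt_ba.
  by apply: eq_bigr => j _; rewrite natrB 1?ltnW//.
Qed.

(** Product formulas leave the frequencies [l - i] and [l + i]; as [l + i <= 2 * m < N], their node
    sums vanish except where [i = l]. *)
Lemma lagrange_cos (l : nat) d y : (l <= m)%N ->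
  \sum_(0 <= j < N) cos (l%:R * eqnode j + d) * tlagrange j y = cos (l%:R * y + d).
Proof.
move=> lm; rewrite /tlagrange.
under eq_bigr do rewrite mulrCA mulrDr mulr1 mulr_sumr.
rewrite -mulr_sumr big_split/= exchange_big/=.
have lt_mN (i : nat) : (i <= m)%N -> (i < N)%N.
  by move=> im; rewrite ltnS (leq_trans im)// -addnn leq_addr.
have H i : (1 <= i < m.+1)%N ->
  \sum_(0 <= j < N) cos (l%:R * eqnode j + d) * (2 * cos (i%:R * (y - eqnode j))) =
  if i == l then N%:R * cos (l%:R * y + d) else 0.
  move=> /andP[i0]; rewrite ltnS => im.
  have -> : \sum_(0 <= j < N) cos (l%:R * eqnode j + d) * (2 * cos (i%:R * (y - eqnode j))) =
    \sum_(0 <= j < N) cos ((l%:R - i%:R) * eqnode j + (d + i%:R * y)) +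
    \sum_(0 <= j < N) cos ((l + i)%:R * eqnode j + (d - i%:R * y)).
    rewrite -big_split/=; apply: eq_bigr => j _.
    by rewrite mulrA [cos _ * 2]mulrC two_cos_cos; congr (cos _ + cos _);
      rewrite ?natrD; ring.
  rewrite [X in _ + X]node_orthogonal; last first.
    by rewrite addn_gt0 i0 orbT/= ltnS -addnn leq_add.
  rewrite addr0; case: eqVneq => [->|il].
    rewrite subrr; under eq_bigr do rewrite mul0r add0r addrC.
    by rewrite sumr_const_nat subn0 [RHS]mulr_natl.
  apply: node_orthogonal_diff; first by rewrite eq_sym.
  - exact: leq_ltn_trans (leq_subr _ _) (lt_mN _ lm).
  - exact: leq_ltn_trans (leq_subr _ _) (lt_mN _ im).
rewrite (eq_big_nat _ _ H) -big_mkcond/= big_nat1_eq ltnS lm andbT.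
(* For [l = 0] the surviving contribution is that of the constant 1 in the Dirichlet kernel,
   otherwise that of [i = l]. *)
case: l lm {H} => [|l] lm /=.
  under eq_bigr do rewrite mul0r add0r.
  by rewrite sumr_const_nat subn0 addr0 mul0r add0r -[cos d *+ _]mulr_natl mulKf.
by rewrite node_orthogonal ?lt_mN// add0r mulKf.
Qed.

(** The frequency left by aliasing is a remainder modulo [N] shifted by [m], possibly negative;
    hence the real difference [a - m]. *)
Lemma lagrange_cos_signed (a : nat) d y : (a <= m.*2)%N ->
  \sum_(0 <= j < N) cos ((a%:R - m%:R) * eqnode j + d) * tlagrange j y =
  cos ((a%:R - m%:R) * y + d).
Proof.
move=> am; have [ma|/ltnW ma] := leqP m a.
  by rewrite -natrB// lagrange_cos// leq_subLR addnn.
have E z : cos ((a%:R - m%:R) * z + d) = cos ((m - a)%:R * z - d).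
  by rewrite -cosN natrB//; congr cos; ring.
under eq_bigr do rewrite E.
by rewrite E lagrange_cos// leq_subr.
Qed.

Lemma lagrange_trig_poly T y : trig_poly n T ->
  \sum_(0 <= j < N) T (eqnode j) * tlagrange j y = T y.
Proof.
move=> [a [b TE]]; under eq_bigr do rewrite TE mulr_suml.
rewrite exchange_big/= TE; apply: eq_bigr => i _.
have im : (i <= m)%N by rewrite -ltnS.
have sinE z : sin (i%:R * z) = cos (i%:R * z + - (pi / 2)) :> R by rewrite cosBpihalf.
under eq_bigr do rewrite mulrDl -!mulrA sinE -[X in cos X * _]addr0.
rewrite big_split/= -!mulr_sumr; rewrite lagrange_cos//.
by rewrite lagrange_cos// sinE addr0.
Qed.

Lemma sum_lagrange y : \sum_(0 <= j < N) tlagrange j y = 1.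
Proof.
rewrite -[RHS](cos0) -[X in cos X](mul0r y) -[X in cos X]addr0 -(lagrange_cos 0 y (leq0n m)).
by apply: eq_bigr => j _; rewrite mul0r addr0 cos0 mul1r.
Qed.

(** Times [sin (t / 2)], the Dirichlet kernel is the sine of [N * t / 2], and at a difference of two
    nodes this is the sine of a multiple of [pi]. *)
Lemma lagrange_node (i j : nat) : (i < N)%N -> (j < N)%N ->
  tlagrange j (eqnode i) = (i == j)%:R.
Proof.
move=> iN jN; rewrite /tlagrange; case: eqVneq => [->|ij].
  under eq_bigr do rewrite subrr mulr0 cos0 mulr1.
  rewrite sumr_const_nat subn1/= -[2 *+ _]mulr_natr.
  by rewrite addrC -NE mulVf.
wlog ij2 : i j iN jN ij / (j < i)%N.
  move=> H; case: (ltngtP i j) => [lij|lij|e]; last by rewrite e eqxx in ij.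
  - rewrite -(H _ _ jN iN)// 1?eq_sym//; congr (_ * (_ + _)).
    by apply: eq_bigr => k _; rewrite -[in LHS]cosN -mulrN opprB.
  - exact: H.
pose t : R := (i - j)%:R * (2 * pi / N%:R).
have tE : eqnode i - eqnode j = t by rewrite /t natrB 1?ltnW// mulrBl.
rewrite tE; have s0 : 0 < sin (t / 2).
  apply: sin_pi_div_gt0; rewrite subn_gt0 ij2/=.
  exact: leq_ltn_trans (leq_subr _ _) iN.
have S0 : 1 + \sum_(1 <= k < m.+1) 2 * cos (k%:R * t) = 0.
  apply: (mulfI (lt0r_neq0 s0)); rewrite mulr0 mulrDr mulr1 -mulr_sumr mulrA [_ * 2]mulrC.
  under eq_bigr do rewrite -[X in cos X]addr0.
  rewrite sum_cos_telescope// !addr0.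
  have -> : 1%:R * t - t / 2 = t / 2 by field.
  rewrite addrC subrK; have -> : m.+1%:R * t - t / 2 = (i - j)%:R * pi + 0.
    by rewrite /t -natr1 NE; field; rewrite -NE.
  by rewrite sin_natpi sin0 mulr0.
by rewrite S0 mulr0.
Qed.

Lemma trig_poly_lagrange_sum (v : nat -> R) :
  trig_poly n (fun y => \sum_(0 <= j < N) v j * tlagrange j y).
Proof.
exists (fun k => \sum_(0 <= j < N) v j * N%:R^-1 * (if k == 0%N then 1 else 2 * cos (k%:R * eqnode j))).
exists (fun k => \sum_(0 <= j < N) v j * N%:R^-1 * (if k == 0%N then 0 else 2 * sin (k%:R * eqnode j))).
move=> t.
under [RHS]eq_bigr do rewrite !mulr_suml -big_split/=.
rewrite exchange_big/=; apply: eq_bigr => j _.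
rewrite /tlagrange big_ord_recl/= mul0r cos0 mulrA mulrDr !mulr1 mulr0 mul0r addr0.
congr (_ + _); rewrite big_add1/= big_mkord mulr_sumr; apply: eq_bigr => i _.
by rewrite /bump/= add1n mulrBr cosB; ring.
Qed.

(** Uniqueness comes with the reproducing property: whichever interpolant the choice operator
    returns equals its own Lagrange sum, and that sum involves only the node values of [f]. *)
Lemma interpolantE f y : interpolant n f y = \sum_(0 <= j < N) f (eqnode j) * tlagrange j y.
Proof.
have : is_interpolant n f (interpolant n f).
  apply: xgetPex; exists (fun y => \sum_(0 <= j < N) f (eqnode j) * tlagrange j y).
  split; first exact: (trig_poly_lagrange_sum (fun j => f (eqnode j))).
  move=> k kn; have kN : (k < N)%N.
    by rewrite ltnS (leq_trans kn)// -mul2n mulnS addnC addnK.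
  rewrite interp_nodeE (bigD1_seq k) ?mem_index_iota ?iota_uniq//=.
  rewrite lagrange_node// eqxx mulr1 big_nat_cond big1 ?addr0// => j /andP[/andP[_ jN] jk].
  by rewrite lagrange_node// eq_sym (negbTE jk) mulr0.
move=> [tp /(_ _ _) H]; rewrite -(lagrange_trig_poly y tp).
apply: eq_big_nat => j /andP[_ jN]; rewrite -interp_nodeE H//.
by rewrite mul2n doubleS subn2/= -ltnS.
Qed.

End TrigInterpolation.

Section RintegralSums.
Context {R : realType}.
Local Notation mu := (@lebesgue_measure R).
Implicit Types (a b : R) (f g phi : R -> R).

Lemma Rintegral_bmf_sum (I : Type) (s : seq I) (F : I -> R -> R) a b :
  (forall i, bmf (F i)) ->
  \int[mu]_(t in `[a, b]) (\sum_(i <- s) F i t) =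
  \sum_(i <- s) \int[mu]_(t in `[a, b]) F i t.
Proof.
move=> bF; elim: s => [|i s IH].
  under eq_Rintegral do rewrite big_nil.
  by rewrite big_nil Rintegral_cst ?mul0r.
under eq_Rintegral do rewrite big_cons.
rewrite big_cons RintegralD ?IH//; first exact: bmf_integrable.
exact/bmf_integrable/bmf_sum.
Qed.

Lemma integrable_bmfM f phi a b : bmf f -> mu.-integrable `[a, b] (EFin \o phi) ->
  mu.-integrable `[a, b] (EFin \o (fun t => f t * phi t)).
Proof.
move=> [mf [M fM]] iphi.
have -> : EFin \o (fun t => f t * phi t) = ((EFin \o f) \* (EFin \o phi))%E.
  by apply/funext => t /=; rewrite EFinM.
apply: integrableMr => //; first exact: measurable_funS mf.
exists M; split; rewrite ?num_real// => K MK x _.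
exact: le_trans (fM x) (ltW MK).
Qed.

Lemma integrable_scale c phi a b : mu.-integrable `[a, b] (EFin \o phi) ->
  mu.-integrable `[a, b] (EFin \o (fun t => c * phi t)).
Proof. exact/integrable_bmfM/bmf_cst. Qed.

Lemma Rintegral_mul_sum (I : Type) (s : seq I) (c : I -> R) (F : I -> R -> R) phi a b :
  (forall i, bmf (F i)) -> mu.-integrable `[a, b] (EFin \o phi) ->
  \int[mu]_(t in `[a, b]) ((\sum_(i <- s) c i * F i t) * phi t) =
  \sum_(i <- s) c i * \int[mu]_(t in `[a, b]) (F i t * phi t).
Proof.
move=> bF iphi; elim: s => [|i s IH].
  under eq_Rintegral do rewrite big_nil mul0r.
  by rewrite big_nil Rintegral_cst ?mul0r.
under eq_Rintegral do rewrite big_cons mulrDl -mulrA.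
have iF := integrable_bmfM (bF i) iphi.
rewrite big_cons RintegralD//; last 2 first.
- exact: integrable_scale.
- by apply: integrable_bmfM => //; apply: bmf_sum => j; exact: bmfZ.
by rewrite IH RintegralZl.
Qed.

End RintegralSums.

Section ErrorKernel.
Context {R : realType}.
Local Notation mu := (@lebesgue_measure R).
Variables (alpha r beta : R) (m : nat).
Hypotheses (alpha0 : 0 < alpha) (r0 : 0 < r).
Local Notation n := m.+1.
Local Notation N := m.*2.+1.
Local Notation P := (poisson_kernel alpha r beta).
Local Notation coef := (pcoef alpha r).
Local Notation term := (pterm alpha r beta).
Local Notation node := (@eqnode R m).
Local Notation lag := (@tlagrange R m).
Local Notation per := (2 * pi : R).
Implicit Types (x t u : R).

Let NN0 : N%:R != 0 :> R. Proof. by rewrite pnatr_eq0. Qed.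

(** The error at [x] of interpolating [P (y - t)] as a function of [y], for fixed [t]. *)
Definition ekernel x t : R := P (x - t) - \sum_(0 <= j < N) lag j x * P (node j - t).

Definition eterm k x t : R :=
  term k (x - t) - \sum_(0 <= j < N) lag j x * term k (node j - t).

Let bmf_P y : bmf (fun t => P (y - t)).
Proof.
have := bmf_affine (- 1) y (bmf_poisson_kernel beta alpha0 r0).
by under eq_fun do rewrite mulN1r addrC.
Qed.

Let bmf_term k y : bmf (fun t => term k (y - t)).
Proof.
have := bmf_affine (- 1) y (bmf_pterm alpha r beta k).
by under eq_fun do rewrite mulN1r addrC.
Qed.

Lemma bmf_ekernel x : bmf (ekernel x).
Proof. by apply: bmfB => //; apply: bmf_sum => j; exact: bmfZ. Qed.

Lemma bmf_eterm k x : bmf (eterm k x).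
Proof. by apply: bmfB => //; apply: bmf_sum => j; exact: bmfZ. Qed.

Lemma periodic_ekernel x : periodic (ekernel x) per.
Proof.
have H y t : P (y - (t + per)) = P (y - t).
  have -> : y - t = (y - (t + per)) + per by ring.
  by rewrite (periodic_poisson_kernel alpha r beta).
move=> t; rewrite /ekernel H; congr (_ - _).
by apply: eq_bigr => j _; rewrite H.
Qed.

Lemma ekernel_tail x : exists C, forall M t, (0 < M)%N ->
  `|ekernel x t - \sum_(1 <= k < M) eterm k x t| <= C / M%:R.
Proof.
have [C HC] := poisson_kernel_tail beta alpha0 r0.
exists ((1 + \sum_(0 <= j < N) `|lag j x|) * C) => M t M0.
have -> : ekernel x t - \sum_(1 <= k < M) eterm k x t =
  (P (x - t) - pkernel_partial alpha r beta M (x - t)) -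
  \sum_(0 <= j < N) lag j x * (P (node j - t) - pkernel_partial alpha r beta M (node j - t)).
  rewrite /ekernel /eterm sumrB exchange_big/=.
  under [X in _ = _ - X]eq_bigr do rewrite mulrBr /pkernel_partial mulr_sumr.
  by rewrite sumrB /pkernel_partial; ring.
apply: (le_trans (ler_normB _ _)).
rewrite !mulrDl mul1r lerD ?HC//.
apply: (le_trans (ler_norm_sum _ _ _)).
rewrite !mulr_suml ler_sum// => j _.
by rewrite normrM -mulrA ler_wpM2l// HC.
Qed.

(** Dividing [k + m] rather than [k] by [N] puts the residual frequency [i - m] between [-m] and
    [m], where Lagrange sums are exact. The error is then a difference of two cosines at [x] whose
    arguments differ by [2 * q * (N * x / 2)]. *)
Lemma eterm_alias k q i x t : (k + m = q * N + i)%N -> (i < N)%N ->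
  eterm k x t = coef k * (2 * sin (q%:R * (N%:R * x / 2)) *
    sin (k%:R * (t - x) + q%:R * (N%:R * x / 2) + beta * pi / 2)).
Proof.
move=> kE iN.
have kR : (k%:R : R) = q%:R * N%:R + (i%:R - m%:R).
  by rewrite -(addrK m%:R k%:R) -natrD kE natrD natrM addrA.
pose d : R := - (k%:R * t) - beta * pi / 2.
have tE y : term k (y - t) = coef k * cos (k%:R * y + d).
  by rewrite /pterm /d; congr (_ * cos _); ring.
have nodeE j : cos (k%:R * node j + d) = cos ((i%:R - m%:R) * node j + d).
  rewrite -[RHS](cos_nat2pi (q * j)); congr cos.
  by rewrite kR /eqnode natrM; field.
rewrite /eterm tE; under eq_bigr do rewrite tE mulrCA nodeE [lag _ _ * _]mulrC.
rewrite -mulr_sumr lagrange_cos_signed//.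
rewrite -mulrBr; congr (_ * _).
set y : R := q%:R * (N%:R * x / 2).
have -> : k%:R * x + d = (k%:R * x + d - y) + y by ring.
have -> : (i%:R - m%:R) * x + d = (k%:R * x + d - y) - y by rewrite kR /y; field.
have -> : k%:R * (t - x) + y + beta * pi / 2 = - (k%:R * x + d - y) by rewrite /d; ring.
move: (k%:R * x + d - y) => z; rewrite (cosD z y) (cosB z y) (sinN z); ring.
Qed.

Lemma eterm_low k x t : (k <= m)%N -> eterm k x t = 0.
Proof.
move=> km; rewrite (@eterm_alias k 0 (k + m)) ?mul0n//; last by rewrite ltnS -addnn leq_add2r.
by rewrite mul0r sin0 mulr0 mul0r mulr0.
Qed.

(* Aliasing: on the nodes the frequency [q * N + l] with [|l| <= m] is indistinguishable
   from [l], so only the phase [q * (N * x / 2)] survives, and grouping the series in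
   blocks of length [N] makes that phase constant on each block. *)
Lemma eterm_block (M : nat) x u :
  \sum_(1 <= k < n + M * N) eterm k x (x + u) =
  \sum_(0 <= q < M) 2 * sin (q.+1%:R * (N%:R * x / 2)) *
    \sum_(0 <= i < N) coef (n + q * N + i) *
      sin ((n + q * N + i)%:R * u + q.+1%:R * (N%:R * x / 2) + beta * pi / 2).
Proof.
elim: M => [|M IH].
  rewrite mul0n addn0 [RHS]big_geq// big_nat_cond big1// => k /andP[/andP[_ km] _].
  by rewrite eterm_low// -ltnS.
rewrite (@big_cat_nat _ _ _ (n + M * N))//=; last by rewrite leq_add2l leq_mul2r leqnSn orbT.
rewrite IH [in RHS]big_nat_recr//=; congr (_ + _).
rewrite mulSnr addnA -{1}[(n + M * N)%N]add0n big_addn addnC addnK mulr_sumr.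
apply: eq_big_nat => i /andP[_ iN].
(* As [n + m = N], the block numbered [M] from 0 has quotient [M + 1]. *)
rewrite (@eterm_alias _ M.+1 i)//; last by rewrite mulSn -addnn; ring.
by rewrite [x + u - x]addrAC subrr add0r mulrCA [(i + _)%N]addnC.
Qed.

(** These [x] are the nodes up to periods. The factor [gamma] will be found by dividing by this
    sine, so they are treated apart. *)
Lemma ekernel_node x t : sin (N%:R * x / 2) = 0 -> ekernel x t = 0.
Proof.
move=> s0; have [C HC] := ekernel_tail x.
have sq (q : nat) : sin (q%:R * (N%:R * x / 2)) = 0.
  elim: q => [|q IH]; first by rewrite mul0r sin0.
  by rewrite -natr1 mulrDl mul1r sinD IH s0 mul0r mulr0 addr0.
have part M : \sum_(1 <= k < M) eterm k x t = 0.
  rewrite big1_seq// => k _; rewrite (@eterm_alias k ((k + m) %/ N) ((k + m) %% N)) -?divn_eq ?ltn_pmod//.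
  by rewrite sq mulr0 mul0r mulr0.
apply/eqP; rewrite -normr_le0; apply/ler_addgt0Pr => e e0; rewrite add0r.
pose M := (Num.truncn (C / e)).+1.
have := HC M t isT; rewrite part subr0 => /le_trans; apply.
by rewrite ler_pdivrMr// mulrC -ler_pdivrMr// ltW// truncnS_gt.
Qed.

(** As a function of [t] a term is a single sine of frequency [k]: it is zero for [k <= m], and for
    [k >= n] it is orthogonal to all lower frequencies. *)
Lemma eterm_cos_orthogonal k (j : nat) x e a : (0 < k)%N -> (j < n)%N ->
  \int[mu]_(t in `[a, a + per]) (eterm k x t * cos (j%:R * t + e)) = 0.
Proof.
move=> k0 jn; have [km|mk] := leqP k m.
  under eq_Rintegral do rewrite eterm_low// mul0r.
  by rewrite Rintegral_cst ?mul0r.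
pose q := ((k + m) %/ N)%N; pose i := ((k + m) %% N)%N.
pose y : R := q%:R * (N%:R * x / 2).
under eq_Rintegral => t _.
  rewrite (@eterm_alias k q i) -?divn_eq ?ltn_pmod// -/y !mulrA -mulrA.
  have -> : k%:R * (t - x) + y + beta * pi / 2 = k%:R * t + (- (k%:R * x) + y + beta * pi / 2).
    by ring.
  over.
rewrite RintegralZl//; last first.
  apply/bmf_integrable/bmfM; first exact/bmf_affine/bmf_sin.
  exact/bmf_affine/bmf_cos.
by rewrite integral_sin_cos_period ?mulr0// (leq_trans jn).
Qed.

Lemma ekernel_cos_orthogonal (j : nat) x e a : (j < n)%N ->
  \int[mu]_(t in `[a, a + per]) (ekernel x t * cos (j%:R * t + e)) = 0.
Proof.
move=> jn; have [C HC] := ekernel_tail x.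
have bc : bmf (fun t : R => cos (j%:R * t + e)) by exact/bmf_affine/bmf_cos.
have per0 : 0 < per by rewrite mulr_gt0// pi_gt0.
have C0 : 0 <= C by have := le_trans (normr_ge0 _) (HC 1%N 0 isT); rewrite divr1.
have part M : \int[mu]_(t in `[a, a + per])
    ((\sum_(1 <= k < M) eterm k x t) * cos (j%:R * t + e)) = 0.
  under eq_Rintegral do rewrite mulr_suml.
  rewrite Rintegral_bmf_sum => [|k]; last exact/bmfM/bc/bmf_eterm.
  rewrite big_nat_cond big1// => k /andP[/andP[k0 _] _].
  exact: eterm_cos_orthogonal.
apply/eqP; rewrite -normr_le0; apply/ler_addgt0Pr => eps eps0; rewrite add0r.
pose M := (Num.truncn (C * per / eps)).+1.
have bpart : bmf (fun t => \sum_(1 <= k < M) eterm k x t).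
  by apply: bmf_sum => k; exact: bmf_eterm.
rewrite -[X in `|X|]subr0 -(part M) -RintegralB//; last 2 first.
- exact/bmf_integrable/bmfM/bc/bmf_ekernel.
- exact/bmf_integrable/bmfM.
under eq_Rintegral do rewrite -mulrBl.
have bd : bmf (fun t => ekernel x t - \sum_(1 <= k < M) eterm k x t).
  exact/bmfB/bpart/bmf_ekernel.
apply: (le_trans (le_normr_Rintegral _ _)) => //; first exact/bmf_integrable/bmfM.
apply: (@le_trans _ _ (\int[mu]_(t in `[a, a + per]) (C / M%:R))).
  apply: le_bmf_integral; [exact/bmf_norm/bmfM|exact: bmf_cst|move=> t _].
  by rewrite normrM -[leRHS]mulr1 ler_pM// ?cos_max// HC.
rewrite Rintegral_cst//= lebesgue_measure_itv/= lte_fin ltrDl per0 -EFinB addrAC subrr add0r/=.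
by rewrite mulrAC ler_pdivrMr// [leRHS]mulrC -ler_pdivrMr// ltW// truncnS_gt.
Qed.

Lemma bmf_trig_poly (T : R -> R) : trig_poly n T -> bmf T.
Proof.
move=> [a [b TE]]; have -> : T = fun t => \sum_(k < n) (a k * cos (k%:R * t) + b k * sin (k%:R * t)).
  exact/funext.
apply: bmf_sum => k; apply: bmfD; apply: bmfZ.
- by have := bmf_affine k%:R 0 (@bmf_cos R); under eq_fun do rewrite addr0.
- by have := bmf_affine k%:R 0 (@bmf_sin R); under eq_fun do rewrite addr0.
Qed.

Lemma ekernel_orthogonal x a T : trig_poly n T ->
  \int[mu]_(t in `[a, a + per]) (ekernel x t * T t) = 0.
Proof.
move=> [c [b TE]]; have bK := bmf_ekernel x.
have bc (k : nat) e : bmf (fun t : R => cos (k%:R * t + e)) by exact/bmf_affine/bmf_cos.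
have E t : ekernel x t * T t = \sum_(k < n)
    (c k * (ekernel x t * cos (k%:R * t + 0)) + b k * (ekernel x t * cos (k%:R * t + - (pi / 2)))).
  by rewrite TE mulr_sumr; apply: eq_bigr => k _; rewrite addr0 cosBpihalf; ring.
under eq_Rintegral do rewrite E.
rewrite Rintegral_bmf_sum; last first.
  by move=> k; apply: bmfD; apply: bmfZ; exact: bmfM.
rewrite big1// => k _.
rewrite RintegralD//; last 2 first.
- exact/bmf_integrable/bmfZ/bmfM.
- exact/bmf_integrable/bmfZ/bmfM.
rewrite !RintegralZl//; [|exact/bmf_integrable/bmfM|exact/bmf_integrable/bmfM].
by rewrite !ekernel_cos_orthogonal// !mulr0 addr0.
Qed.

(** The constant [a0 / 2] cancels because the Lagrange functions sum to 1. *)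
Lemma interp_errorE f phi (L : set (R -> R)) x :
  mu.-integrable `[- pi, pi] (EFin \o phi) ->
  is_gen_derivative alpha r beta L f phi ->
  interp_error n f x = pi^-1 * \int[mu]_(t in `[- pi, pi]) (ekernel x t * phi t).
Proof.
move=> iphi [_ _ [a0 fE]].
rewrite /interp_error interpolantE.
pose I y := \int[mu]_(t in `[- pi, pi]) (P (y - t) * phi t).
have -> : \int[mu]_(t in `[- pi, pi]) (ekernel x t * phi t) =
    I x - \sum_(0 <= j < N) lag j x * I (node j).
  under eq_Rintegral do rewrite /ekernel mulrBl.
  rewrite RintegralB//; last 2 first.
  - exact: integrable_bmfM.
  - by apply: integrable_bmfM => //; apply: bmf_sum => j; exact: bmfZ.
  by rewrite Rintegral_mul_sum.
have fE' y : f y = a0 / 2 + pi^-1 * I y by exact: fE.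
rewrite fE'; under eq_bigr do rewrite fE' mulrDl mulrC.
rewrite big_split/= -mulr_suml sum_lagrange mul1r.
rewrite mulrBr mulr_sumr opprD addrACA subrr add0r; congr (_ - _).
by apply: eq_bigr => j _; ring.
Qed.

End ErrorKernel.

(** * Duality with the best approximation *)

Section Duality.
Context {R : realType}.
Local Notation mu := (@lebesgue_measure R).
Local Notation per := (2 * pi : R).
Variables (alpha r beta p q : R) (m : nat) (x : R).
Hypotheses (alpha0 : 0 < alpha) (r0 : 0 < r) (p1 : 1 < p) (pq : p^-1 + q^-1 = 1).
Local Notation n := m.+1.
Local Notation K := (ekernel alpha r beta m x).
Local Notation kappa := (pnorm q 0 K).
Implicit Types (f g phi T : R -> R).

Let per0 : 0 < per. Proof. by rewrite mulr_gt0// pi_gt0. Qed.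
Let p0 : 0 < p. Proof. exact: lt_trans p1. Qed.
Let pN0 : p != 0. Proof. by rewrite gt_eqF. Qed.
Let qV : q^-1 = 1 - p^-1. Proof. by rewrite -pq addrC addKr. Qed.
Let q0 : 0 < q. Proof. by rewrite -invr_gt0 qV subr_gt0 invf_lt1. Qed.
Let qN0 : q != 0. Proof. by rewrite gt_eqF. Qed.
Let q1 : 1 < q.
Proof. by rewrite -(invf_lt1 q0) qV gtrBl invr_gt0. Qed.
Let qE : (q - 1) * p = q.
Proof.
have h : p = (1 - p^-1) * (q * p) by rewrite -qV mulrA mulVf ?mul1r.
have h2 : (1 - p^-1) * (q * p) = q * p - q by field.
by rewrite mulrBl mul1r [X in _ - X]h h2; ring.
Qed.
Let bK : bmf K. Proof. exact: bmf_ekernel. Qed.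
Let pK : periodic K per. Proof. exact: periodic_ekernel. Qed.
Let kappa_ge0 : 0 <= kappa. Proof. exact: pnorm_ge0. Qed.
Let itvpi : `[- pi, - pi + per]%classic = `[- pi, pi]%classic :> set R.
Proof. by have -> : - pi + per = pi by ring. Qed.

Lemma Lnorm_period s (f : R -> \bar R) :
  ('N[period_measure]_s%:E[f] = 'N[pmeasure 0]_s%:E[f])%E.
Proof.
rewrite unlock; congr (_ `^ _)%E; apply: eq_measure_integral => A mA _ /=.
by rewrite /mrestr add0r.
Qed.

Lemma Lp_integrable phi a : Lp p%:E phi -> mu.-integrable `[a, a + per] (EFin \o phi).
Proof.
move=> [pphi Lphi].
have p1' : (1 <= p%:E)%E by rewrite lee_fin ltW.
have fin : period_measure [set: R] \is a fin_num.
  by rewrite /= /mrestr setTI lebesgue_measure_itv/= lte_fin per0 -EFinB.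
have /integrableP[mphi iphi] := (Lfun1_integrable _ _).1
  (Lfun_subset (lexx _) p1' fin p1' Lphi).
apply/integrableP; split; first exact: measurable_funS mphi.
have mn : measurable_fun setT (fun t => `|phi t|%:E).
  by apply/measurable_EFinP; apply: measurableT_comp => //; exact/measurable_EFinP.
have e := @ge0_integral_periodic _ per (fun t => `|phi t|%:E)%E a 0 per0.
rewrite [X in (X < _)%E]e//; last by move=> t; rewrite pphi.
apply: le_lt_trans iphi; rewrite le_eqVlt; apply/orP; left; apply/eqP.
rewrite -(@ge0_integral_pmeasure _ 0)//.
by apply: eq_measure_integral => A mA _ /=; rewrite /mrestr add0r.
Qed.

Lemma Lp_measurable phi : Lp p%:E phi -> measurable_fun setT phi.
Proof. by move=> [_]; rewrite inE => /andP[+ _]; rewrite inE. Qed.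

Lemma bmf_Lp phi : bmf phi -> periodic phi per -> Lp p%:E phi.
Proof.
move=> bphi pphi; split=> //; rewrite inE; apply/andP; split.
  by rewrite inE/=; exact: bmf_measurable bphi.
by rewrite inE/= /finite_norm Lnorm_period Lnorm_pmeasure// ltry.
Qed.

(** Orthogonality lets [T] be subtracted from [phi] before Hoelder's inequality is applied. *)
Lemma ekernel_pairing_le phi T : Lp p%:E phi -> trig_poly n T ->
  (`|\int[mu]_(t in `[- pi, pi]) (K t * phi t)|%:E <=
   kappa%:E * 'N[period_measure]_p%:E[EFin \o (phi \- T)%R])%E.
Proof.
move=> Lphi tT; have mphi := Lp_measurable Lphi.
have iphi := Lp_integrable 0 Lphi.
have bT := bmf_trig_poly tT.
have -> : \int[mu]_(t in `[- pi, pi]) (K t * phi t) =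
    \int[mu]_(t in `[0, 0 + per]) (K t * (phi t - T t)).
  rewrite -itvpi (@Rintegral_periodic _ (- pi) 0); last 2 first.
  - by apply: measurable_funM => //; exact: bmf_measurable bK.
  - by move=> t; rewrite pK Lphi.1.
  under [RHS]eq_Rintegral do rewrite mulrBr.
  rewrite RintegralB//; first by rewrite [X in _ - X]ekernel_orthogonal ?subr0.
  - exact: integrable_bmfM.
  - exact/bmf_integrable/bmfM.
have iKT : mu.-integrable `[0, 0 + per] (EFin \o (fun t => K t * (phi t - T t))).
  apply: integrable_bmfM => //.
  have -> : EFin \o (fun t => phi t - T t) = ((EFin \o phi) \- (EFin \o T))%E.
    by apply/funext => t /=; rewrite EFinB.
  by apply: integrableB => //; exact: bmf_integrable.
rewrite -(Lnorm_pmeasure 0 q0 bK) Lnorm_period.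
have mg : measurable_fun setT (phi \- T).
  by apply: measurable_funB => //; exact: bmf_measurable bT.
apply: le_trans (hoelder (pmeasure 0) (bmf_measurable bK) mg q0 p0 _); last by rewrite addrC.
rewrite Lnorm1 ge0_integral_pmeasure//; last first.
  by apply/measurableT_comp => //; apply/measurable_EFinP/measurable_funM => //; exact: bmf_measurable bK.
by rewrite EFin_normr_Rintegral//; apply: le_abse_integral => //; exact: measurable_int iKT.
Qed.

Lemma best_approx_fin phi : Lp p%:E phi ->
  (best_approx n p%:E phi)%:E =
    ereal_inf [set 'N[period_measure]_p%:E[EFin \o (phi \- T)%R]%E | T in trig_poly n].
Proof.
move=> Lphi; rewrite /best_approx fineK//.
rewrite ge0_fin_numE; last by apply: le_ereal_inf_tmp => _ [T _ <-]; exact: Lnorm_ge0.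
have fin : ('N[period_measure]_p%:E[EFin \o phi] < +oo)%E.
  by move: Lphi.2; rewrite inE => /andP[_]; rewrite inE.
apply: le_lt_trans fin; apply: ereal_inf_lbound; exists (cst 0).
  by exists (cst 0), (cst 0) => t; rewrite big1// => k _; rewrite !mul0r addr0.
by congr Lnorm; apply/funext => t /=; rewrite subr0.
Qed.

Lemma best_approx_ge0 phi : Lp p%:E phi -> 0 <= best_approx n p%:E phi.
Proof.
move=> Lphi; rewrite -lee_fin best_approx_fin//.
by apply: le_ereal_inf_tmp => _ [T _ <-]; exact: Lnorm_ge0.
Qed.

Lemma ekernel_pairing_best phi : Lp p%:E phi ->
  `|\int[mu]_(t in `[- pi, pi]) (K t * phi t)| <= kappa * best_approx n p%:E phi.
Proof.
move=> Lphi; set I := \int[mu]_(t in _) _.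
have tp0 : trig_poly n (cst 0 : R -> R).
  by exists (cst 0), (cst 0) => t; rewrite big1// => k _; rewrite !mul0r addr0.
have [k0|kN0] := eqVneq kappa 0.
  rewrite k0 mul0r -lee_fin; have := ekernel_pairing_le Lphi tp0.
  by rewrite k0 mul0e.
have k0 : 0 < kappa by rewrite lt_neqAle eq_sym kN0 kappa_ge0.
rewrite mulrC -ler_pdivrMr// -lee_fin best_approx_fin//.
apply: le_ereal_inf_tmp => _ [T tT <-].
have := ekernel_pairing_le Lphi tT; rewrite -/I.
case: ('N[_]_ _ [_])%E (Lnorm_ge0 period_measure p%:E (EFin \o (phi \- T)%R)) => [s| |]//=.
- by move=> _; rewrite -EFinM !lee_fin => ?; rewrite ler_pdivrMr// mulrC.
- by move=> _ _; rewrite leey.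
Qed.

Lemma interp_error_le f phi : is_gen_derivative alpha r beta (Lp p%:E) f phi ->
  `|interp_error n f x| <= pi^-1 * kappa * best_approx n p%:E phi.
Proof.
move=> fphi; have [Lphi _ _] := fphi.
have iphi := Lp_integrable (- pi) Lphi; rewrite itvpi in iphi.
rewrite (interp_errorE _ alpha0 r0 _ iphi fphi).
rewrite normrM ger0_norm ?invr_ge0 ?pi_ge0// -mulrA ler_wpM2l ?invr_ge0 ?pi_ge0//.
exact: ekernel_pairing_best.
Qed.

(** The extremal function of Hoelder's inequality, the sign of [K] times [|K| ^ (q - 1)]. The
    separate factor [K] gives 0 at the zeros of [K] also when [q < 2]. *)
Let phi0 t : R := K t * `|K t| `^ (q - 2).

Let norm_phi0 t : `|phi0 t| = `|K t| `^ (q - 1).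
Proof.
rewrite normrM [X in _ * X]ger0_norm ?powR_ge0//.
have -> : q - 2 = (q - 1) - 1 by ring.
by rewrite mulr_powRB1// subr_gt0.
Qed.

Let K_phi0 t : K t * phi0 t = `|K t| `^ q.
Proof.
have -> : K t * phi0 t = `|K t| * `|phi0 t|.
  rewrite -normrM ger0_norm// /phi0 mulrA mulr_ge0 ?powR_ge0//.
  by rewrite -expr2 sqr_ge0.
by rewrite norm_phi0 mulr_powRB1.
Qed.

Let bphi0 : bmf phi0.
Proof.
split.
  apply: measurable_funM; first exact: bmf_measurable bK.
  apply: (measurableT_comp (measurable_powR (q - 2))).
  exact: bmf_measurable (bmf_norm bK).
have [M KM] := bmf_bounded bK; exists (M `^ (q - 1)) => t.
rewrite norm_phi0 ge0_ler_powR ?subr_ge0 ?nnegrE ?(ltW q1)//.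
exact: le_trans (KM t).
Qed.

Let pphi0 : periodic phi0 per.
Proof. by move=> t; rewrite /phi0 pK. Qed.

Let pnorm_phi0 : pnorm p 0 phi0 = kappa `^ (q - 1).
Proof.
have -> : kappa `^ (q - 1) = (kappa `^ q) `^ p^-1.
  rewrite -powRrM; have -> : q / p = q - 1 by rewrite -[in LHS]qE mulfK.
  by [].
rewrite pnormX// pnorm.unlock; apply: (congr1 (fun z => z `^ p^-1)).
by apply: eq_Rintegral => t _; rewrite norm_phi0 -powRrM qE.
Qed.

Let pairing_phi0 : \int[mu]_(t in `[- pi, pi]) (K t * phi0 t) = kappa `^ q.
Proof.
rewrite pnormX// -itvpi (@Rintegral_periodic _ (- pi) 0).
- by apply: eq_Rintegral => t _; exact: K_phi0.
- exact: bmf_measurable (bmfM bK bphi0).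
- by move=> t; rewrite pK pphi0.
Qed.

Let trig_cst c : trig_poly n (cst c : R -> R).
Proof.
exists (fun k => if k == 0%N then c else 0), (cst 0) => t.
rewrite big_ord_recl/= mul0r cos0 mulr1 mul0r addr0 big1 ?addr0// => k _.
by rewrite !mul0r addr0.
Qed.

(** [Phi] is [phi0] scaled to norm [E], minus its mean so as to be a generalized derivative.
    Constants are trigonometric polynomials, so removing the mean alters neither the pairing with
    [K] nor the best approximation. The polynomial [- mean] shows that the latter is at most [E];
    the pairing value [kappa * E] and [ekernel_pairing_le] show that it is at least [E]. *)
Lemma interp_error_attained f phi :
  poisson_class alpha r beta (Lp p%:E) f ->
  is_gen_derivative alpha r beta (Lp p%:E) f phi ->
  exists F Phi, [/\ poisson_class alpha r beta (Lp p%:E) F,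
    is_gen_derivative alpha r beta (Lp p%:E) F Phi,
    best_approx n p%:E Phi = best_approx n p%:E phi &
    `|interp_error n F x| = pi^-1 * kappa * best_approx n p%:E phi].
Proof.
move=> Cf fphi; have [Lphi _ _] := fphi.
have [k0|kN0] := eqVneq kappa 0.
  (* When the kernel norm is zero, both sides vanish and [f] itself serves. *)
  exists f, phi; split=> //; apply/eqP; rewrite k0 mulr0 mul0r -normr_le0 normr_id.
  by have := interp_error_le fphi; rewrite k0 mulr0 mul0r.
have k0 : 0 < kappa by rewrite lt_neqAle eq_sym kN0 kappa_ge0.
set E := best_approx n p%:E phi; have E0 : 0 <= E by exact: best_approx_ge0.
pose c := E / kappa `^ (q - 1).
have kq0 : 0 < kappa `^ (q - 1) by exact: powR_gt0.
have cE : c * kappa `^ (q - 1) = E by rewrite /c divfK// gt_eqF.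
have c0 : 0 <= c by rewrite divr_ge0// ltW.
pose mean := (per)^-1 * \int[mu]_(t in `[- pi, pi]) (c * phi0 t).
pose Phi t := c * phi0 t - mean.
have bPhi : bmf Phi by exact/bmfB/bmf_cst/bmfZ.
have pPhi : periodic Phi per by move=> t; rewrite /Phi pphi0.
have LPhi : Lp p%:E Phi by exact: bmf_Lp.
have iPhi a b : mu.-integrable `[a, b] (EFin \o Phi) by exact: bmf_integrable.
have pairing T : trig_poly n T ->
    \int[mu]_(t in `[- pi, pi]) (K t * Phi t) = c * kappa `^ q.
  move=> tT; under eq_Rintegral do rewrite /Phi mulrBr mulrCA.
  rewrite RintegralB//; last 2 first.
  - exact/bmf_integrable/bmfZ/bmfM.
  - exact/bmf_integrable/bmfM/bmf_cst.
  rewrite RintegralZl ?pairing_phi0//; last exact/bmf_integrable/bmfM.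
  by rewrite -itvpi (ekernel_orthogonal _ alpha0 r0 _ _ (trig_cst mean)) subr0.
pose F y := pi^-1 * \int[mu]_(t in `[- pi, pi]) (poisson_kernel alpha r beta (y - t) * Phi t).
have pF : periodic F per.
  move=> y; rewrite /F; congr (_ * _); apply: eq_Rintegral => t _.
  have -> : y + per - t = y - t + per by ring.
  by rewrite (periodic_poisson_kernel alpha r beta).
have dF : is_gen_derivative alpha r beta (Lp p%:E) F Phi.
  split=> //; last by exists 0 => y; rewrite mul0r add0r.
  rewrite RintegralB//; [|exact/bmf_integrable/bmfZ|exact/bmf_integrable/bmf_cst].
  rewrite Rintegral_cst//= lebesgue_measure_itv/= lte_fin.
  have pi0 := pi_gt0 R; rewrite ifT; last by rewrite (lt_trans _ pi0)// oppr_lt0.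
  have -> : fine (pi%:E + (- - pi)%:E) = per by rewrite opprK /=; ring.
  rewrite /mean mulrAC mulVf ?mul1r ?subrr//.
  by rewrite gt_eqF.
exists F, Phi; split=> //; first by split=> //; exists Phi.
  apply: EFin_inj; rewrite best_approx_fin//; apply/eqP; rewrite eq_le; apply/andP; split.
    apply: ereal_inf_lbound; exists (cst (- mean)) => //.
    have -> : EFin \o (Phi \- cst (- mean)) = EFin \o (fun t => c * phi0 t).
      by apply/funext => t /=; rewrite /Phi opprK subrK.
    rewrite Lnorm_period Lnorm_pmeasure//; last exact: bmfZ.
    by rewrite pnormZ// pnorm_phi0 ger0_norm// cE.
  apply: le_ereal_inf_tmp => _ [T tT <-].
  have := ekernel_pairing_le LPhi tT; rewrite (pairing _ tT).
  have -> : c * kappa `^ q = kappa * E.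
    by rewrite -cE mulrCA mulr_powRB1.
  rewrite ger0_norm ?mulr_ge0//.
  case: ('N[_]_ _ [_])%E (Lnorm_ge0 period_measure p%:E (EFin \o (Phi \- T)%R)) => [s| |]//=.
  - by move=> _; rewrite -EFinM !lee_fin ler_pM2l.
  - by move=> _ _; rewrite leey.
rewrite (interp_errorE _ alpha0 r0 _ (iPhi _ _) dF) (pairing _ (trig_cst 0)).
have -> : c * kappa `^ q = kappa * E by rewrite -cE mulrCA mulr_powRB1.
by rewrite ger0_norm mulrA// mulr_ge0 ?mulr_ge0 ?invr_ge0 ?pi_ge0.
Qed.

End Duality.

(** * Calculus *)

Section Calculus.
Context {R : realType}.
Local Notation mu := (@lebesgue_measure R).
Implicit Types (f g df : R -> R) (a b c x : R).

Lemma powRD_pos x (s t : R) : 0 < x -> x `^ (s + t) = x `^ s * x `^ t.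
Proof. by move=> x0; rewrite powRD// (gt_eqF x0) implybT. Qed.

Lemma deriveD_fun f g x a b : is_derive x 1 f a -> is_derive x 1 g b ->
  is_derive x 1 (fun y => f y + g y) (a + b).
Proof. by move=> ? ?; exact: is_deriveD. Qed.

Lemma derive_cst_fun c x : is_derive x 1 (fun _ : R => c) 0.
Proof. exact: is_derive_cst. Qed.

Lemma derive_id_fun x : is_derive x 1 (fun y : R => y) 1.
Proof. exact: is_derive_id. Qed.

Lemma deriveM_fun f g x a b : is_derive x 1 f a -> is_derive x 1 g b ->
  is_derive x 1 (fun y => f y * g y) (f x * b + g x * a).
Proof. by move=> ? ?; exact: is_deriveM. Qed.

Lemma deriveZ_fun c f x a : is_derive x 1 f a -> is_derive x 1 (fun y => c * f y) (c * a).
Proof.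
move=> fa; apply: is_derive_eq (deriveM_fun (derive_cst_fun c x) fa) _.
by rewrite mulr0 addr0.
Qed.

Lemma deriveB_fun f g x a b : is_derive x 1 f a -> is_derive x 1 g b ->
  is_derive x 1 (fun y => f y - g y) (a - b).
Proof. by move=> ? ?; exact: is_deriveB. Qed.

Lemma derive_comp_fun f g x a b : is_derive (g x) 1 f a -> is_derive x 1 g b ->
  is_derive x 1 (fun y => f (g y)) (a * b).
Proof. by move=> ? ?; exact: is_derive1_comp. Qed.

Lemma deriveX_fun f n x a : is_derive x 1 f a ->
  is_derive x 1 (fun y => f y ^+ n) (n%:R * f x ^+ n.-1 * a).
Proof.
move=> fa; have -> : (fun y => f y ^+ n) = (f ^+ n : R -> R).
  by apply/funext => y; rewrite fctE.
exact: is_deriveX.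
Qed.

Lemma derive_powR_fun f (s : R) x a : 0 < f x -> is_derive x 1 f a ->
  is_derive x 1 (fun y => f y `^ s) (s * f x `^ (s - 1) * a).
Proof.
move=> f0 fa; apply: (@derive_comp_fun (fun y => y `^ s)) => //.
exact: is_derive1_powR.
Qed.

Lemma derive_sum_fun n (F : nat -> R -> R) (dF : nat -> R) x :
  (forall k, (k < n)%N -> is_derive x 1 (F k) (dF k)) ->
  is_derive x 1 (fun y => \sum_(0 <= k < n) F k y) (\sum_(0 <= k < n) dF k).
Proof.
elim: n => [|n IH] H.
  under eq_fun do rewrite big_geq//.
  by rewrite big_geq//; exact: derive_cst_fun.
under eq_fun do rewrite big_nat_recr//=.
rewrite big_nat_recr//=; apply: deriveD_fun; last exact: H.
by apply: IH => k kn; apply: H; exact: ltnW.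
Qed.

Lemma is_derive_continuous f x a : is_derive x 1 f a -> {for x, continuous f}.
Proof.
move=> [df _]; apply: differentiable_continuous.
exact/derivable1_diffP.
Qed.

Lemma within_continuous_derive f df a b :
  (forall x, a <= x <= b -> is_derive x 1 f (df x)) -> {within `[a, b], continuous f}.
Proof.
move=> H; apply: derivable_within_continuous => x; rewrite in_itv/= => /H[].
by [].
Qed.

Lemma derive_mvt f df a b : a <= b ->
  (forall x, a <= x <= b -> is_derive x 1 f (df x)) ->
  exists2 c, a <= c <= b & f b - f a = df c * (b - a).
Proof.
move=> ab H; have cf := within_continuous_derive H.
have H' x : x \in `]a, b[ -> is_derive x 1 f (df x).
  by rewrite in_itv/= => /andP[ax xb]; apply: H; rewrite !ltW.
have [c] := MVT_segment ab H' cf.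
by rewrite in_itv/= => cab fE; exists c.
Qed.

Lemma derive_ge0_le f df a b : a <= b ->
  (forall x, a <= x <= b -> is_derive x 1 f (df x)) ->
  (forall x, a <= x <= b -> 0 <= df x) -> f a <= f b.
Proof.
move=> ab H df0; have [c cab e] := derive_mvt ab H.
by rewrite -subr_ge0 e mulr_ge0 ?df0 ?subr_ge0.
Qed.

Lemma FTC2_derive f F a b : a <= b ->
  (forall x, a <= x <= b -> is_derive x 1 F (f x)) ->
  (forall x, a <= x <= b -> {for x, continuous f}) ->
  \int[mu]_(x in `[a, b]) f x = F b - F a.
Proof.
rewrite le_eqVlt => /predU1P[-> _ _|ab dF cf].
  by rewrite subrr set_itv1 Rintegral_set1.
have cF x : a <= x <= b -> {for x, continuous F}.
  by move=> /dF; exact: is_derive_continuous.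
rewrite /Rintegral (@continuous_FTC2 _ f F a b)//.
- apply: continuous_in_subspaceT => x; rewrite inE/= in_itv/=; exact: cf.
- split.
  + by move=> x; rewrite in_itv/= => /andP[ax xb]; have [] := dF x _; rewrite ?ltW.
  + by apply: cvg_at_right_filter; apply: cF; rewrite lexx ltW.
  + by apply: cvg_at_left_filter; apply: cF; rewrite lexx ltW.
- move=> x; rewrite in_itv/= => /andP[ax xb].
  have axb : a <= x <= b by rewrite !ltW.
  by have [dFx e] := dF x axb; rewrite derive1E.
Qed.

(** Start of a chain of Taylor inequalities up to degree 4: the derivative of each difference is the
    preceding difference, already known to be nonnegative. *)
Lemma sin_le_id x : 0 <= x -> sin x <= x.
Proof.
move=> x0; rewrite -subr_ge0.
have := @derive_ge0_le (fun y => y - sin y) (fun y => 1 - cos y) 0 x x0.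
rewrite sin0 subrr; apply => y _.
by rewrite subr_ge0 cos_le1.
Qed.

Lemma cos_ge_quad x : 0 <= x -> 1 - x ^+ 2 / 2 <= cos x.
Proof.
move=> x0; rewrite -subr_ge0.
have := @derive_ge0_le (fun y => cos y - (1 - y ^+ 2 / 2)) (fun y => y - sin y) 0 x x0.
rewrite cos0 expr0n/= mul0r subr0 subrr; apply; [move=> y _|move=> y /andP[y0 _]].
- by apply: is_derive_eq; rewrite /GRing.scale/=; field.
- by rewrite subr_ge0 sin_le_id.
Qed.

Lemma sin_ge_cubic x : 0 <= x -> x - x ^+ 3 / 6 <= sin x.
Proof.
move=> x0; rewrite -subr_ge0.
have := @derive_ge0_le (fun y => sin y - (y - y ^+ 3 / 6)) (fun y => cos y - (1 - y ^+ 2 / 2)) 0 x x0.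
rewrite sin0 expr0n/= mul0r !subr0; apply; [move=> y _|move=> y /andP[y0 _]].
- by apply: is_derive_eq; rewrite /GRing.scale/=; field.
- by rewrite subr_ge0 cos_ge_quad.
Qed.

Lemma cos_le_quartic x : 0 <= x -> cos x <= 1 - x ^+ 2 / 2 + x ^+ 4 / 24.
Proof.
move=> x0; rewrite -subr_ge0.
have := @derive_ge0_le (fun y => 1 - y ^+ 2 / 2 + y ^+ 4 / 24 - cos y)
  (fun y => sin y - (y - y ^+ 3 / 6)) 0 x x0.
rewrite cos0 !expr0n/= !mul0r subr0 addr0 subrr; apply; [move=> y _|move=> y /andP[y0 _]].
- by apply: is_derive_eq; rewrite /GRing.scale/=; field.
- by rewrite subr_ge0 sin_ge_cubic.
Qed.

Lemma pi_lt4 : pi < 4 :> R.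
Proof. by have := pihalf_lt2 R; rewrite ltr_pdivrMr// -natrM. Qed.

(** With [v = u / 2 <= 2], a consequence of [pi < 4], the cubic [v - v ^ 3 / 6] is at least
    [v / 3]. *)
Lemma sin_half_ge (u : R) : 0 <= u <= pi -> u / 6 <= sin (u / 2).
Proof.
move=> /andP[u0 up]; set v := u / 2.
have v0 : 0 <= v by rewrite divr_ge0.
have v2 : v <= 2 by rewrite ler_pdivrMr// -natrM (le_trans up)// ltW// pi_lt4.
apply: le_trans (sin_ge_cubic v0).
have -> : u / 6 = v / 3 by rewrite /v; field.
nra.
Qed.

Lemma one_sub_cos_ge (u : R) : - pi <= u <= pi -> u ^+ 2 / 18 <= 1 - cos u.
Proof.
move=> /andP[u1 u2].
have H (v : R) : 0 <= v <= pi -> v ^+ 2 / 18 <= 1 - cos v.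
  move=> v0p; have s := sin_half_ge v0p; have /andP[v0 _] := v0p.
  have -> : 1 - cos v = 2 * sin (v / 2) ^+ 2.
    have {1}-> : v = (v / 2) *+ 2 by rewrite -mulr_natr; field.
    by rewrite cos_mulr2n cos2sin2; ring.
  have : (v / 6) ^+ 2 <= sin (v / 2) ^+ 2.
    by rewrite lerXn2r ?nnegrE ?divr_ge0//; apply: le_trans s; rewrite divr_ge0.
  nra.
have [u0|/ltW u0] := leP 0 u; first by apply: H; rewrite u0.
by rewrite -sqrrN -cosN; apply: H; rewrite oppr_ge0 u0 lerNl.
Qed.

Lemma one_sub_cos_le (u : R) : 1 - cos u <= u ^+ 2 / 2.
Proof.
have H (v : R) : 0 <= v -> 1 - cos v <= v ^+ 2 / 2 by move=> /cos_ge_quad; lra.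
have [u0|/ltW u0] := leP 0 u; first exact: H.
by rewrite -sqrrN -cosN; apply: H; rewrite oppr_ge0.
Qed.

Lemma one_sub_cos_ge_quartic (u : R) : u ^+ 2 / 2 - u ^+ 4 / 24 <= 1 - cos u.
Proof.
have H (v : R) : 0 <= v -> v ^+ 2 / 2 - v ^+ 4 / 24 <= 1 - cos v by move=> /cos_le_quartic; lra.
have [u0|/ltW u0] := leP 0 u; first exact: H.
have -> : u ^+ 4 = (- u) ^+ 4 by ring.
by rewrite -sqrrN -cosN; apply: H; rewrite oppr_ge0.
Qed.

(** Were [pi <= 3], the angle [3 / 2] would have reached a quarter turn and its cosine would be
    nonpositive; the triple angle formula with [cos (1 / 2) >= 7 / 8] makes it positive. *)
Lemma pi_gt3 : 3 < pi :> R.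
Proof.
have c1 : 7 / 8 <= cos (2^-1) :> R.
  by have := @cos_ge_quad (2^-1) ltac:(by rewrite invr_ge0); lra.
rewrite ltNge; apply/negP => p3.
have : cos (3 / 2) <= 0 :> R.
  have -> : 3 / 2 = (3 / 2 - pi / 2) + pi / 2 :> R by rewrite subrK.
  rewrite cosDpihalf oppr_le0 sin_ge0_pi//; apply/andP; split; first by lra.
  by have := pi_ge2 R; lra.
have -> : cos (3 / 2) = 4 * cos 2^-1 ^+ 3 - 3 * cos (2^-1) :> R.
  have -> : 3 / 2 = 2^-1 *+ 2 + 2^-1 :> R by rewrite -mulr_natr; field.
  rewrite cosD cos_mulr2n mulr2n sinD.
  have -> : (sin 2^-1 * cos 2^-1 + cos 2^-1 * sin 2^-1) * sin 2^-1 =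
    2 * cos 2^-1 * sin 2^-1 ^+ 2 :> R by ring.
  by rewrite sin2cos2; ring.
nra.
Qed.

Lemma ln2_ge_half : 1 / 2 <= ln 2 :> R.
Proof.
have h2 : expR (1 / 2) <= 2 :> R.
  have := expR_ge1Dx (- (1 / 2) : R); rewrite expRN.
  have := expR_gt0 (1 / 2 : R); set e := expR _ => e0 h.
  have : e * e^-1 = 1 by rewrite mulfV// gt_eqF.
  nra.
by rewrite -[leLHS]expRK ler_ln ?posrE ?expR_gt0.
Qed.

End Calculus.

(** * A Gauss hypergeometric value as an integral *)

Section BinomialSeries.
Context {R : realType}.
Variable b : R.
Hypothesis b1 : b < 1.
Implicit Types (y Y : R) (k m : nat).

(** The coefficient of [y ^ k] in the expansion of [(1 - y) ^ (- b)]. *)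
Definition binc k : R := pochhammer b k / k`!%:R.

Lemma pochhammerS (y : R) k : pochhammer y k.+1 = pochhammer y k * (y + k%:R).
Proof. by rewrite /pochhammer big_ord_recr. Qed.

Lemma binc0 : binc 0 = 1.
Proof. by rewrite /binc /pochhammer big_ord0 divr1. Qed.

Lemma bincS k : k.+1%:R * binc k.+1 = (b + k%:R) * binc k.
Proof.
rewrite /binc pochhammerS factS natrM; field.
by rewrite addrC natr1 !pnatr_eq0 -!lt0n fact_gt0.
Qed.

(** An index past [|b|]: for [q > 3] the parameter [b = (3 - q) / 2] is negative and the first
    coefficients may change sign. *)
Definition k0 : nat := (Num.truncn `|b|).+1.

Lemma k0_pos k : (k0 <= k)%N -> 0 < b + k%:R <= k.+1%:R.
Proof.
move=> kk; apply/andP; split; last by rewrite -natr1 addrC lerD2l ltW.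
rewrite addrC -[b]opprK subr_gt0; apply: (@lt_le_trans _ _ k0%:R); last by rewrite ler_nat.
apply: (le_lt_trans (ler_norm _)); rewrite normrN; exact: truncnS_gt.
Qed.

(* Past [k0] the coefficients keep the sign [eps]; all tails below are monotone because of this. *)
Definition eps : R := if 0 <= binc k0 then 1 else -1.

Lemma norm_eps x : `|eps * x| = `|x|.
Proof. by rewrite normrM /eps; case: ifP; rewrite ?normrN normr1 mul1r. Qed.

Lemma eps_sq x : eps * (eps * x) = x.
Proof. by rewrite /eps; case: ifP; rewrite ?mul1r ?mulN1r ?opprK. Qed.

(** Past [k0] the ratio [(b + k) / (k + 1)] of consecutive coefficients lies between 0 and 1, thanks
    to [b < 1]. *)
Lemma eps_binc k : (k0 <= k)%N -> 0 <= eps * binc k <= `|binc k0|.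
Proof.
elim: k => [//|k IH]; rewrite leq_eqVlt => /predU1P[<-|].
  apply/andP; split; last by rewrite -[leRHS](norm_eps (binc k0)) ler_norm.
  rewrite /eps; case: ifPn; first by rewrite mul1r.
  by rewrite -ltNge mulN1r oppr_ge0 => /ltW.
rewrite ltnS => kk; have /andP[e0 e1] := IH kk; have /andP[p0 p1] := k0_pos kk.
have k1 : 0 < k.+1%:R :> R by rewrite ltr0n.
have -> : eps * binc k.+1 = (b + k%:R) / k.+1%:R * (eps * binc k).
  apply: (mulfI (lt0r_neq0 k1)); rewrite mulrCA bincS; field.
  by rewrite gt_eqF.
rewrite mulr_ge0 ?divr_ge0 ?(ltW p0)//=.
by rewrite (le_trans _ e1)// ler_piMl// ler_pdivrMr// mul1r.
Qed.

Lemma norm_binc k : (k0 <= k)%N -> `|binc k| <= `|binc k0|.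
Proof. by move=> /eps_binc/andP[e0 e1]; rewrite -norm_eps ger0_norm. Qed.

Definition bpoly m y : R := \sum_(0 <= k < m) binc k * y ^+ k.
Definition dbpoly m y : R := \sum_(0 <= k < m) binc k * (k%:R * y ^+ k.-1 * 1).

(** The function [(1 - y) ^ (- b)] solves [(1 - y) f' = b f]; a truncated series violates this
    equation by one monomial only. *)
Lemma bpoly_ode m y : b * bpoly m y - (1 - y) * dbpoly m y = m%:R * binc m * y ^+ m.-1.
Proof.
elim: m => [|m IH]; first by rewrite /bpoly /dbpoly !big_geq// !mulr0 subr0 !mul0r.
rewrite /bpoly /dbpoly !big_nat_recr//= -/(bpoly m y) -/(dbpoly m y).
have -> : b * (bpoly m y + binc m * y ^+ m) -
    (1 - y) * (dbpoly m y + binc m * (m%:R * y ^+ m.-1 * 1)) =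
  (b * bpoly m y - (1 - y) * dbpoly m y) + b * binc m * y ^+ m -
    (1 - y) * (binc m * (m%:R * y ^+ m.-1)) by ring.
rewrite IH bincS; case: m {IH} => [|m] /=; last by rewrite exprS; ring.
by rewrite expr0; ring.
Qed.

(* [(1 - y) ^ b] times the remainder of the binomial series of [(1 - y) ^ (- b)]. *)
Definition brem m y : R := 1 - (1 - y) `^ b * bpoly m y.

(** Since the defect is one monomial, this derivative keeps one sign on [[0, 1[]; both the sign and
    the size of the remainder are read off from it. *)
Lemma brem_derive m y : y < 1 ->
  is_derive y 1 (brem m) (m%:R * binc m * y ^+ m.-1 * (1 - y) `^ (b - 1)).
Proof.
move=> y1; have y0 : 0 < 1 - y by rewrite subr_gt0.
have d1 : is_derive y 1 (fun z => (1 - z) `^ b) (b * (1 - y) `^ (b - 1) * (0 - 1)).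
  by apply: (@derive_powR_fun _ (fun z => 1 - z)) => //.
have d2 : is_derive y 1 (bpoly m) (dbpoly m y).
  have dk k : is_derive y 1 (fun z : R => binc k * z ^+ k) (binc k * (k%:R * y ^+ k.-1 * 1)).
    by have := deriveZ_fun (binc k) (deriveX_fun k (derive_id_fun y)).
  exact: (derive_sum_fun (fun k _ => dk k)).
apply: is_derive_eq (deriveB_fun (derive_cst_fun 1 y) (deriveM_fun d1 d2)) _.
rewrite -bpoly_ode; have -> : (1 - y) `^ b = (1 - y) * (1 - y) `^ (b - 1).
  have e : 1 + (b - 1) = b by ring.
  by rewrite -[in LHS]e (powRD_pos 1 (b - 1) y0) powRr1// ltW.
ring.
Qed.

Lemma brem0 m : (0 < m)%N -> brem m 0 = 0.
Proof.
case: m => // m _; rewrite /brem subr0 powR1 mul1r /bpoly big_nat_recl// binc0 expr0 mulr1.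
rewrite big1 ?addr0 ?subrr// => k _.
by rewrite expr0n mulr0.
Qed.

Lemma eps_brem_ge0 m y : (k0 <= m)%N -> 0 <= y < 1 -> 0 <= eps * brem m y.
Proof.
move=> km /andP[y0 y1].
rewrite -[leLHS](mulr0 eps) -(@brem0 m); last exact: leq_trans km.
apply: (@derive_ge0_le _ (fun z => eps * brem m z)
  (fun z => eps * (m%:R * binc m * z ^+ m.-1 * (1 - z) `^ (b - 1))) 0 y) => // z /andP[z0 zy].
  by apply: deriveZ_fun; apply: brem_derive; exact: le_lt_trans y1.
have /andP[e0 _] := eps_binc km.
have -> : eps * (m%:R * binc m * z ^+ m.-1 * (1 - z) `^ (b - 1)) =
  (eps * binc m) * (m%:R * z ^+ m.-1 * (1 - z) `^ (b - 1)) by ring.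
by rewrite mulr_ge0// !mulr_ge0// ?exprn_ge0 ?powR_ge0.
Qed.

Lemma brem_bound m y Y : (k0 <= m)%N -> 0 <= y <= Y -> Y < 1 ->
  `|brem m y| <= (1 - Y) `^ (b - 1) * `|binc k0| * (m%:R * Y ^+ m.-1).
Proof.
move=> km /andP[y0 yY] Y1.
have dz z : 0 <= z <= y -> is_derive z 1 (brem m) (m%:R * binc m * z ^+ m.-1 * (1 - z) `^ (b - 1)).
  by move=> /andP[_ zy]; apply: brem_derive; exact: le_lt_trans (le_trans zy yY) Y1.
have [c /andP[c0 cy]] := derive_mvt y0 dz.
rewrite brem0 ?subr0; last exact: leq_trans km.
move=> ->; have cY := le_trans cy yY.
have Y0 : 0 <= Y := le_trans y0 yY.
rewrite 4!normrM [`|_%:R|]ger0_norm// [`|c ^+ _|]ger0_norm ?exprn_ge0//.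
rewrite [`|_ `^ _|]ger0_norm ?powR_ge0// [`|y|]ger0_norm//.
have p1 : (1 - c) `^ (b - 1) <= (1 - Y) `^ (b - 1).
  have -> : b - 1 = - (1 - b) by ring.
  rewrite !powRN lef_pV2 ?posrE ?powR_gt0 ?subr_gt0 ?(le_lt_trans cY)//.
  rewrite ge0_ler_powR ?nnegrE ?subr_ge0 ?(ltW b1) ?(ltW Y1)//.
    by rewrite (le_trans cY) ?ltW.
  by rewrite lerD2l lerN2.
have -> : (1 - Y) `^ (b - 1) * `|binc k0| * (m%:R * Y ^+ m.-1) =
  m%:R * `|binc k0| * Y ^+ m.-1 * (1 - Y) `^ (b - 1) * 1 by ring.
rewrite ler_pM// ?mulr_ge0 ?powR_ge0 ?exprn_ge0//; last exact: le_trans yY (ltW Y1).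
rewrite ler_pM// ?mulr_ge0 ?powR_ge0 ?exprn_ge0//.
rewrite ler_pM// ?mulr_ge0 ?exprn_ge0//; last by rewrite lerXn2r ?nnegrE.
by rewrite ler_wpM2l// norm_binc.
Qed.

End BinomialSeries.

(** Write [Y = Z ^ 2]: one factor [Z ^ (m - 1)] absorbs the multiplier [m], because
    [m * (1 - Z) * Z ^ (m - 1) <= 1 - Z ^ m], and the other tends to 0. *)
Lemma natmul_exp_small {R : realType} (Y B e : R) : 0 <= Y < 1 -> 0 <= B -> 0 < e ->
  exists M, forall m, (M <= m)%N -> B * (m%:R * Y ^+ m.-1) <= e.
Proof.
move=> /andP[Y0 Y1] B0 e0.
pose Z := Num.sqrt Y; have Z0 : 0 <= Z by exact: sqrtr_ge0.
have YZ : Y = Z ^+ 2 by rewrite sqr_sqrtr.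
have Z1 : Z < 1 by rewrite -(@ltr_pXn2r _ 2) ?nnegrE// expr1n -YZ.
have ZS m : m%:R * (1 - Z) * Z ^+ m.-1 <= 1 - Z ^+ m.
  elim: m => [|m IH]; first by rewrite !mul0r expr0 subrr.
  have Zm1 : Z ^+ m <= 1 by rewrite exprn_ile1// ltW.
  have -> : m.+1%:R * (1 - Z) * Z ^+ m.+1.-1 =
      Z * (m%:R * (1 - Z) * Z ^+ m.-1) + (1 - Z) * Z ^+ m.
    by case: m {IH Zm1} => [|m] /=; rewrite ?exprS -?natr1; ring.
  have := ler_wpM2l Z0 IH; rewrite exprS; nra.
have cZ : (GRing.exp Z : R ^nat) x @[x --> \oo] --> (0 : R).
  by apply: cvg_expr; rewrite ger0_norm.
have e1 : 0 < e * (1 - Z) / (B + 1) by rewrite divr_gt0 ?mulr_gt0 ?subr_gt0// ltr_wpDl.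
have := (cvgrPdist_le _ _).1 cZ _ e1 => -[M _ HM].
exists M.+1 => -[//|m]; rewrite ltnS => Mm /=.
have := HM m Mm; rewrite /= sub0r normrN ger0_norm ?exprn_ge0// => Zm.
have Z1' : 0 < 1 - Z by rewrite subr_gt0.
have -> : Y ^+ m = Z ^+ m * Z ^+ m by rewrite YZ -exprM mulnC exprM expr2.
have H1 : m.+1%:R * Z ^+ m <= (1 - Z)^-1.
  rewrite -[leRHS]mul1r ler_pdivlMr// mulrAC.
  by apply: le_trans (ZS m.+1) _; rewrite gerBl exprn_ge0.
have H2 : m.+1%:R * (Z ^+ m * Z ^+ m) <= (1 - Z)^-1 * (e * (1 - Z) / (B + 1)).
  by rewrite mulrA ler_pM// ?mulr_ge0 ?exprn_ge0.
apply: (le_trans (ler_wpM2l B0 H2)).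
have -> : B * ((1 - Z)^-1 * (e * (1 - Z) / (B + 1))) = e * (B / (B + 1)).
  by field; rewrite !gt_eqF// ltr_wpDl.
by rewrite ler_piMr ?(ltW e0)// ler_pdivrMr ?ltr_wpDl// mul1r lerDl.
Qed.

(** * The integral of [(l ^ 2 + t ^ 2) ^ (- q / 2)] over the half-line *)

Section HypergeometricIntegral.
Context {R : realType}.
Local Notation mu := (@lebesgue_measure R).
Variables q l : R.
Hypotheses (q1 : 1 < q) (l0 : 0 < l).
Local Notation b := ((3 - q) / 2).
Implicit Types (T x y e : R) (m k : nat).

Let b1 : b < 1. Proof.
rewrite -subr_gt0; have -> : 1 - b = (q - 1) / 2 by field.
by rewrite divr_gt0// subr_gt0.
Qed.
Let q0 : 0 < q. Proof. exact: lt_trans q1. Qed.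
Let q10 : 0 < q - 1. Proof. by rewrite subr_gt0. Qed.

Definition sq T : R := l ^+ 2 + T ^+ 2.
Lemma sq_gt0 T : 0 < sq T.
Proof. by rewrite ltr_wpDr ?sqr_ge0 ?exprn_gt0. Qed.
Let sq0 T : sq T != 0. Proof. by rewrite gt_eqF ?sq_gt0. Qed.

(** The sine of the angle whose tangent is [T / l]; it maps the half-line [T >= 0] onto [[0, 1[]. *)
Definition sphi T : R := T * sq T `^ (- 2^-1).
Definition gker T : R := sq T `^ (- (q / 2)).

Let dsq T : is_derive T 1 sq (0 + 2 * T).
Proof.
apply: is_derive_eq (deriveD_fun (derive_cst_fun (l ^+ 2) T) (deriveX_fun 2 (derive_id_fun T))) _.
by rewrite expr1 mulr1.
Qed.

Let powRDs (T s t : R) : sq T `^ (s + t) = sq T `^ s * sq T `^ t.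
Proof. exact: powRD_pos (sq_gt0 T). Qed.

Lemma sphi_sq T : sphi T ^+ 2 = T ^+ 2 / sq T.
Proof.
have -> : sphi T ^+ 2 = T ^+ 2 * (sq T `^ (- 2^-1) * sq T `^ (- 2^-1)) by rewrite /sphi; ring.
rewrite -powRDs (_ : - 2^-1 + - 2^-1 = -1 :> R); last by field.
by rewrite powR_inv1// ltW ?sq_gt0.
Qed.

Lemma one_sub_sphi_sq T : 1 - sphi T ^+ 2 = l ^+ 2 / sq T.
Proof. by rewrite sphi_sq; apply: (mulIf (sq0 T)); rewrite mulrBl !divfK// mul1r /sq addrK. Qed.

Lemma sphi_ge0 T : 0 <= T -> 0 <= sphi T.
Proof. by move=> T0; rewrite mulr_ge0 ?powR_ge0. Qed.

Lemma sphi_sq_lt1 T : sphi T ^+ 2 < 1.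
Proof. by rewrite -subr_gt0 one_sub_sphi_sq divr_gt0 ?exprn_gt0 ?sq_gt0. Qed.

Lemma sphi_lt1 T : 0 <= T -> sphi T < 1.
Proof.
move=> T0; rewrite -(@ltr_pXn2r _ 2) ?nnegrE ?sphi_ge0// expr1n.
exact: sphi_sq_lt1.
Qed.

Let dsphi T : is_derive T 1 sphi (l ^+ 2 * sq T `^ (- (3 / 2))).
Proof.
have d := deriveM_fun (derive_id_fun T) (derive_powR_fun (- 2^-1) (sq_gt0 T) (dsq T)).
apply: is_derive_eq d _.
have -> : - 2^-1 = - (3 / 2) + 1 :> R by field.
rewrite addrK powRDs powRr1 ?(ltW (sq_gt0 T))//.
by rewrite /sq; field.
Qed.

Definition hterm k : R := binc b k / (k.*2.+1)%:R.
Definition hpart m : R := \sum_(0 <= k < m) hterm k.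
(* Partial sums of an antiderivative of [gker]: in the variable [s = sphi T] the integrand
   is [l ^ (1 - q) * (1 - s ^ 2) ^ (- b)], which is expanded in powers of [s]. *)
Definition vpart m T : R := l `^ (1 - q) * \sum_(0 <= k < m) hterm k * sphi T ^+ k.*2.+1.

Let l1q0 : 0 < l `^ (1 - q). Proof. exact: powR_gt0. Qed.

Let dvpart m T : is_derive T 1 (vpart m) (gker T * (1 - brem b m (sphi T ^+ 2))).
Proof.
have dk k : is_derive T 1 (fun z => hterm k * sphi z ^+ k.*2.+1)
  (hterm k * ((k.*2.+1)%:R * sphi T ^+ k.*2 * (l ^+ 2 * sq T `^ (- (3 / 2))))).
  exact: (deriveZ_fun (hterm k) (deriveX_fun k.*2.+1 (dsphi T))).
apply: is_derive_eq (deriveZ_fun (l `^ (1 - q)) (derive_sum_fun (fun k (_ : (k < m)%N) => dk k))) _.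
have -> : \sum_(0 <= k < m) hterm k * ((k.*2.+1)%:R * sphi T ^+ k.*2 * (l ^+ 2 * sq T `^ (- (3 / 2)))) =
    l ^+ 2 * sq T `^ (- (3 / 2)) * bpoly b m (sphi T ^+ 2).
  rewrite /bpoly mulr_sumr; apply: eq_bigr => k _.
  rewrite /hterm -exprM mul2n; field.
  by rewrite addrC natr1 pnatr_eq0.
rewrite /brem subKr one_sub_sphi_sq mulrA [RHS]mulrA; congr (_ * _).
rewrite powRM ?exprn_ge0 ?invr_ge0 ?(ltW l0) ?(ltW (sq_gt0 T))//.
rewrite -powR_mulrn ?(ltW l0)// -powRrM.
have -> : (sq T)^-1 `^ b = sq T `^ (- b).
  by rewrite -powR_inv1 ?(ltW (sq_gt0 T))// -powRrM mulN1r.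
have e1 : l `^ (1 - q) * l `^ 2 = l `^ (2 * b).
  by rewrite -powRD ?(gt_eqF l0) ?implybT//; congr (_ `^ _); field.
have e2 : gker T * sq T `^ (- b) = sq T `^ (- (3 / 2)).
  by rewrite /gker -powRDs; congr (_ `^ _); field.
by rewrite mulrA e1 [RHS]mulrCA e2.
Qed.

Lemma gker_gt0 T : 0 < gker T. Proof. by rewrite powR_gt0 ?sq_gt0. Qed.

Lemma gker_le T : gker T <= l `^ (- q).
Proof.
rewrite /gker !powRN lef_pV2 ?posrE ?powR_gt0 ?sq_gt0//.
have -> : l `^ q = (l ^+ 2) `^ (q / 2).
  by rewrite -powR_mulrn ?(ltW l0)// -powRrM; congr (_ `^ _); field.
rewrite ge0_ler_powR ?divr_ge0 ?nnegrE ?exprn_ge0 ?(ltW l0) ?(ltW q0) ?(ltW (sq_gt0 T))//.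
by rewrite lerDl sqr_ge0.
Qed.

Lemma gker_le_pow T : 0 < T -> gker T <= T `^ (- q).
Proof.
move=> T0; rewrite /gker !powRN lef_pV2 ?posrE ?powR_gt0 ?sq_gt0//.
have -> : T `^ q = (T ^+ 2) `^ (q / 2).
  by rewrite -powR_mulrn ?(ltW T0)// -powRrM; congr (_ `^ _); field.
rewrite ge0_ler_powR ?divr_ge0 ?nnegrE ?exprn_ge0 ?(ltW T0) ?(ltW q0) ?(ltW (sq_gt0 T))//.
by rewrite lerDr sqr_ge0.
Qed.

Let dgker T : is_derive T 1 gker (- (q / 2) * sq T `^ (- (q / 2) - 1) * (0 + 2 * T)).
Proof. exact: derive_powR_fun (sq_gt0 T) (dsq T). Qed.

Lemma continuous_gker : continuous gker. Proof. by move=> T; exact: is_derive_continuous (dgker T). Qed.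

Lemma bmf_gker : bmf gker.
Proof.
apply: (@bmf_continuous_bounded _ _ (l `^ (- q))) continuous_gker _ => T.
by rewrite gtr0_norm ?gker_gt0// gker_le.
Qed.

Let antiderivative : exists G : R -> R, G 0 = 0 /\ forall T, 0 <= T -> is_derive T 1 G (gker T).
Proof.
(* Integrating from [-1] makes 0 an interior point, so that the derivative there is two-sided. *)
pose H x : R := \int[mu]_(t in `[-1, x]) gker t.
exists (fun x => H x - H 0); split; first by rewrite subrr.
move=> T T0; suff dH : is_derive T 1 H (gker T).
  by apply: is_derive_eq (deriveB_fun dH (derive_cst_fun (H 0) T)) _; rewrite subr0.
have T1 : T < T + 1 by rewrite ltrDl.
have [|//|//|dH eH] := @continuous_FTC1 _ gker (BLeft (-1)) T (T + 1) T1.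
- exact: bmf_integrable bmf_gker.
- by rewrite lte_fin; lra.
- exact: continuous_gker.
exact: (DeriveDef dH (etrans (esym (derive1E _ _)) eH)).
Qed.

Let G := projT1 (cid antiderivative).
Let G0 : G 0 = 0. Proof. exact: (projT2 (cid antiderivative)).1. Qed.
Let dG T : 0 <= T -> is_derive T 1 G (gker T).
Proof. exact: (projT2 (cid antiderivative)).2. Qed.

Let GE T : 0 <= T -> \int[mu]_(t in `[0, T]) gker t = G T.
Proof.
move=> T0; have d x : 0 <= x <= T -> is_derive x 1 G (gker x) by move=> /andP[x0 _]; exact: dG.
have cg x : 0 <= x <= T -> {for x, continuous gker} by move=> _; exact: continuous_gker.
by rewrite (FTC2_derive T0 d cg) G0 subr0.
Qed.

Let G_ndecr T T' : 0 <= T -> T <= T' -> G T <= G T'.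
Proof.
move=> T0 TT; apply: (derive_ge0_le (df := gker)) => // x /andP[Tx _].
- by apply: dG; exact: le_trans Tx.
- exact/ltW/gker_gt0.
Qed.

Let G_tail T T' : 0 < T -> T <= T' -> G T' <= G T + T `^ (1 - q) / (q - 1).
Proof.
move=> T0 TT.
have d x : T <= x <= T' -> is_derive x 1 (fun z => - (q - 1)^-1 * z `^ (1 - q) - G z) (x `^ (- q) - gker x).
  move=> /andP[Tx _]; have x0 := lt_le_trans T0 Tx.
  apply: is_derive_eq (deriveB_fun (deriveZ_fun (- (q - 1)^-1) (is_derive1_powR (1 - q) x0)) (dG (ltW x0))) _.
  congr (_ - _); have -> : 1 - q - 1 = - q by ring.
  by rewrite mulrA -[RHS]mul1r; congr (_ * _); field; rewrite gt_eqF.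
have := derive_ge0_le TT d.
have H x : T <= x <= T' -> 0 <= x `^ (- q) - gker x.
  by move=> /andP[Tx _]; rewrite subr_ge0 gker_le_pow// (lt_le_trans T0).
move=> /(_ H) le; have T'0 : 0 <= T' `^ (1 - q) / (q - 1) by rewrite divr_ge0 ?powR_ge0 ?ltW.
move: le T'0; rewrite [T `^ (1 - q) / _]mulrC [T' `^ (1 - q) / _]mulrC; lra.
Qed.

(** On [[0, l]] the integrand is at most [l ^ (- q)], beyond [l] at most [t ^ (- q)]; the
    contributions 1 and [1 / (q - 1)] add up to [q / (q - 1)]. *)
Let G_le T : 0 <= T -> G T <= l `^ (1 - q) * (q / (q - 1)).
Proof.
move=> T0.
have Gl : G l <= l `^ (1 - q).
  have [c _] := derive_mvt (ltW l0) (fun x (h : 0 <= x <= l) => dG (proj1 (andP h))).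
  rewrite G0 !subr0 => ->; have -> : 1 - q = - q + 1 by ring.
  by rewrite (powRD_pos (- q) 1 l0) powRr1 ?(ltW l0)// ler_wpM2r ?gker_le// ltW.
have -> : q / (q - 1) = 1 + (q - 1)^-1 by field; rewrite gt_eqF.
rewrite mulrDr mulr1; have [Tl|/ltW lT] := leP T l.
  rewrite (le_trans (G_ndecr T0 Tl))// (le_trans Gl)// lerDl.
  by rewrite mulr_ge0 ?invr_ge0 ?ltW.
by rewrite (le_trans (G_tail l0 lT))// lerD2r.
Qed.

Let G_lower : l `^ (1 - q) * 2 `^ (- (q / 2)) <= G l.
Proof.
have [c /andP[c0 cl]] := derive_mvt (ltW l0) (fun x (h : 0 <= x <= l) => dG (proj1 (andP h))).
rewrite G0 !subr0 => ->; have -> : 1 - q = - q + 1 by ring.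
rewrite (powRD_pos (- q) 1 l0) powRr1 ?(ltW l0)// mulrAC ler_wpM2r ?(ltW l0)//.
have -> : l `^ (- q) * 2 `^ (- (q / 2)) = (2 * l ^+ 2) `^ (- (q / 2)).
  rewrite powRM ?exprn_ge0 ?(ltW l0)// mulrC -powR_mulrn ?(ltW l0)// -powRrM.
  by congr (_ * _ `^ _); field.
have s0 := sq_gt0 c.
rewrite /gker !powRN lef_pV2 ?posrE ?powR_gt0 ?mulr_gt0 ?exprn_gt0//.
rewrite ge0_ler_powR ?divr_ge0 ?nnegrE ?(ltW q0) ?mulr_ge0 ?exprn_ge0 ?(ltW l0) ?(ltW s0)//.
rewrite /sq mulr_natl mulr2n lerD2l lerXn2r ?nnegrE// ltW//.
Qed.

Local Notation ep := (eps b).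
Local Notation K0 := (k0 b).

Let G_vpart_sign m T : (K0 <= m)%N -> 0 <= T -> 0 <= ep * (G T - vpart m T).
Proof.
move=> km T0.
have v0 : vpart m 0 = 0.
  by rewrite /vpart big1 ?mulr0// => k _; rewrite /sphi mul0r expr0n mulr0.
have -> : 0 = ep * (G 0 - vpart m 0) by rewrite G0 v0 subrr mulr0.
apply: (derive_ge0_le (f := fun z => ep * (G z - vpart m z))
  (df := fun z => ep * (gker z - gker z * (1 - brem b m (sphi z ^+ 2))))) => // x /andP[x0 _].
  exact: (deriveZ_fun ep (deriveB_fun (dG x0) (dvpart m x))).
have -> : ep * (gker x - gker x * (1 - brem b m (sphi x ^+ 2))) =
  gker x * (ep * brem b m (sphi x ^+ 2)) by ring.
by rewrite mulr_ge0 ?(ltW (gker_gt0 _))// eps_brem_ge0// sqr_ge0 sphi_sq_lt1.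
Qed.

Let G_vpart_lim T e : 0 <= T -> 0 < e ->
  exists M, forall m, (M <= m)%N -> `|G T - vpart m T| <= e.
Proof.
move=> T0 e0; pose Y := sphi T ^+ 2.
have Y0 : 0 <= Y by exact: sqr_ge0.
have Y1 : Y < 1 by exact: sphi_sq_lt1.
pose B := l `^ (- q) * ((1 - Y) `^ (b - 1) * `|binc b K0|) * T.
have B0 : 0 <= B by rewrite !mulr_ge0 ?powR_ge0.
have [M HM] := natmul_exp_small (introT andP (conj Y0 Y1)) B0 e0.
exists (maxn M K0) => m; rewrite geq_max => /andP[Mm km].
have v0 : vpart m 0 = 0.
  by rewrite /vpart big1 ?mulr0// => k _; rewrite /sphi mul0r expr0n mulr0.
have d x : 0 <= x <= T -> is_derive x 1 (fun z => G z - vpart m z)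
    (gker x - gker x * (1 - brem b m (sphi x ^+ 2))).
  by move=> /andP[x0 _]; exact: (deriveB_fun (dG x0) (dvpart m x)).
have [c /andP[c0 cT]] := derive_mvt T0 d.
rewrite G0 v0 !subr0 => ->; apply: le_trans (HM m Mm).
have -> : gker c - gker c * (1 - brem b m (sphi c ^+ 2)) = gker c * brem b m (sphi c ^+ 2) by ring.
have cY : sphi c ^+ 2 <= Y.
  rewrite /Y -lerN2 -(lerD2l 1) !one_sub_sphi_sq ler_wpM2l ?exprn_ge0 ?(ltW l0)//.
  by rewrite lef_pV2 ?posrE ?sq_gt0// lerD2l lerXn2r ?nnegrE.
rewrite !normrM [`|gker _|]gtr0_norm ?gker_gt0// [`|T|]ger0_norm//.
have -> : B * (m%:R * Y ^+ m.-1) =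
  l `^ (- q) * ((1 - Y) `^ (b - 1) * `|binc b K0| * (m%:R * Y ^+ m.-1)) * T by rewrite /B; ring.
rewrite ler_wpM2r// ler_pM ?(ltW (gker_gt0 _)) ?gker_le//.
by apply: brem_bound => //; rewrite sqr_ge0.
Qed.

Let Ccoef m : R := \sum_(0 <= k < m) `|binc b k|.

(** The factor in [1 - s ^ j <= j * (1 - s)], with [j = 2 * k + 1], cancels the denominator of
    [hterm], and [1 - s <= 1 - s ^ 2 <= l ^ 2 / T ^ 2]. This settles large [T] for a fixed number of
    terms. *)
Let vpart_hpart m T : 0 < T ->
  `|l `^ (1 - q) * hpart m - vpart m T| <= l `^ (1 - q) * Ccoef m * (l ^+ 2 / T ^+ 2).
Proof.
move=> T0; have s0 := sphi_ge0 (ltW T0); have s1 := sphi_lt1 (ltW T0).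
rewrite /vpart -mulrBr normrM gtr0_norm// -mulrA ler_wpM2l ?(ltW l1q0)//.
rewrite /hpart -sumrB /Ccoef mulr_suml (le_trans (ler_norm_sum _ _ _))// ler_sum// => k _.
have -> : hterm k - hterm k * sphi T ^+ k.*2.+1 = binc b k * ((1 - sphi T ^+ k.*2.+1) / k.*2.+1%:R).
  by rewrite /hterm; ring.
rewrite normrM ler_wpM2l//.
have sk : sphi T ^+ k.*2.+1 <= 1 by rewrite exprn_ile1// ltW.
rewrite ger0_norm ?divr_ge0 ?subr_ge0//.
apply: (@le_trans _ _ (1 - sphi T)).
  rewrite ler_pdivrMr ?ltr0n// mulrC.
  elim: (k.*2.+1) => [|j IH]; first by rewrite expr0 subrr mul0r.
  have -> : 1 - sphi T ^+ j.+1 = (1 - sphi T ^+ j) + sphi T ^+ j * (1 - sphi T).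
    by rewrite exprS; ring.
  rewrite -natr1 mulrDl mul1r lerD// ler_piMl ?subr_ge0 ?(ltW s1)//.
  by rewrite exprn_ile1// ltW.
apply: (@le_trans _ _ (1 - sphi T ^+ 2)).
  by rewrite lerD2l lerN2 expr2 ler_piMr// ltW.
rewrite one_sub_sphi_sq ler_wpM2l ?exprn_ge0 ?(ltW l0)//.
by rewrite lef_pV2 ?posrE ?sq_gt0 ?exprn_gt0// lerDr sqr_ge0.
Qed.

Let hterm_sign k : (K0 <= k)%N -> 0 <= ep * hterm k.
Proof.
by move=> kk; have /andP[e0 _] := eps_binc b1 kk; rewrite /hterm mulrA divr_ge0.
Qed.

(** Past [K0] all terms have one sign and the powers of [sphi T] are at most 1, so the tails of the
    series at 1 dominate those at every [T], uniformly. *)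
Let vpart_mono m m' T : (K0 <= m)%N -> (m <= m')%N -> 0 <= T ->
  `|vpart m' T - vpart m T| <= l `^ (1 - q) * `|hpart m' - hpart m|.
Proof.
move=> km mm T0; rewrite /vpart -mulrBr normrM gtr0_norm// ler_wpM2l ?(ltW l1q0)//.
rewrite /hpart !(big_cat_nat (leq0n m) mm)/= ![_ + _ - _]addrAC !subrr !add0r.
rewrite -(norm_eps b) -[leRHS](norm_eps b) !mulr_sumr.
have n0 : 0 <= \sum_(m <= i < m') ep * (hterm i * sphi T ^+ i.*2.+1).
  rewrite big_nat_cond sumr_ge0// => k /andP[/andP[mk _] _].
  by rewrite mulrA mulr_ge0 ?hterm_sign ?exprn_ge0 ?sphi_ge0// (leq_trans km).
rewrite ger0_norm// ger0_norm; last first.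
  by rewrite big_nat_cond sumr_ge0// => k /andP[/andP[mk _] _]; rewrite hterm_sign// (leq_trans km).
rewrite big_nat_cond [leRHS]big_nat_cond ler_sum// => k /andP[/andP[mk _] _].
rewrite mulrA ler_piMr ?hterm_sign ?(leq_trans km)//.
by rewrite exprn_ile1 ?sphi_ge0// ltW// sphi_lt1.
Qed.

Let big_T (B e : R) : 0 <= B -> 0 < e -> exists2 T0, 0 < T0 & forall T, T0 <= T ->
  B * (l ^+ 2 / T ^+ 2) <= e.
Proof.
move=> B0 e0; pose T0 := 1 + B * l ^+ 2 / e.
have T1 : 1 <= T0 by rewrite lerDl divr_ge0 ?mulr_ge0 ?exprn_ge0 ?(ltW l0) ?(ltW e0).
have T00 : 0 < T0 by exact: lt_le_trans T1.
exists T0 => // T TT; have T0' : 0 < T := lt_le_trans T00 TT.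
rewrite mulrA ler_pdivrMr ?exprn_gt0// [leRHS]mulrC -ler_pdivrMr//.
apply: (@le_trans _ _ T0); first by rewrite /T0 lerDr.
apply: (le_trans TT); rewrite expr2 ler_peMl ?(ltW T0')//.
exact: le_trans TT.
Qed.

(** Convergence at the boundary point 1 rests on monotonicity and this bound: for each [m] some [T]
    brings [vpart] close to [l ^ (1 - q) * hpart], and there [G_vpart_sign] compares it with the
    bounded function [G]. *)
Let hpart_bounded : exists B, forall m, ep * (hpart (m + K0) - hpart K0) <= B.
Proof.
exists ((q / (q - 1)) + Ccoef K0 + 1 + 1 + 1) => m.
rewrite -(ler_pM2l l1q0); set a := l `^ (1 - q).
have a0 : 0 < a := l1q0.
have C0 j : 0 <= Ccoef j by exact: sumr_ge0.
have [T1 T10 H1] := big_T (mulr_ge0 (ltW a0) (C0 (m + K0)%N)) a0.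
have [T2 T20 H2] := big_T (mulr_ge0 (ltW a0) (C0 K0)) a0.
pose T := Num.max T1 T2.
have T0 : 0 < T by rewrite lt_max T10.
have h1 := le_trans (vpart_hpart (m + K0) T0) (H1 T _).
have h2 := le_trans (vpart_hpart K0 T0) (H2 T _).
have {}h1 : `|a * hpart (m + K0) - vpart (m + K0) T| <= a by apply: h1; rewrite le_max lexx.
have {}h2 : `|a * hpart K0 - vpart K0 T| <= a by apply: h2; rewrite le_max lexx orbT.
have s1 := G_vpart_sign (leq_addl m K0) (ltW T0).
have Gb := G_le (ltW T0).
have Gn : 0 <= G T by rewrite -G0 G_ndecr// ltW.
have vb : `|vpart K0 T| <= a * Ccoef K0.
  rewrite /vpart normrM gtr0_norm// ler_wpM2l ?(ltW a0)//.
  rewrite (le_trans (ler_norm_sum _ _ _))// ler_sum// => k _.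
  rewrite normrM /hterm normrM -mulrA ler_piMr// mulr_ile1//.
    by rewrite normfV ger0_norm// invf_le1 ?ltr0n// ler1n.
  have s0 := sphi_ge0 (ltW T0).
  by rewrite ger0_norm ?exprn_ge0// exprn_ile1// ltW// sphi_lt1 ?ltW.
have vb2 : ep * - vpart K0 T <= a * Ccoef K0.
  by rewrite (le_trans (ler_norm _))// norm_eps normrN.
have Gb2 : ep * G T <= a * (q / (q - 1)).
  by rewrite (le_trans (ler_norm _))// norm_eps ger0_norm.
have h1' : ep * (a * hpart (m + K0) - vpart (m + K0) T) <= a.
  by rewrite (le_trans (ler_norm _))// norm_eps.
have h2' : ep * (vpart K0 T - a * hpart K0) <= a.
  by rewrite (le_trans (ler_norm _))// norm_eps distrC.
have -> : a * (ep * (hpart (m + K0) - hpart K0)) =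
  ep * (a * hpart (m + K0) - vpart (m + K0) T) + ep * (vpart K0 T - a * hpart K0) +
  ep * - vpart K0 T + ep * G T - ep * (G T - vpart (m + K0) T) by ring.
rewrite !mulrDr !mulr1; move: s1 vb2 Gb2 h1' h2'; lra.
Qed.

Let F := limn hpart.

Let hpart_cvg : hpart m @[m --> \oo] --> F.
Proof.
suff : cvgn (fun m => ep * (hpart (m + K0) - hpart K0)).
  move=> c.
  have c2 : cvgn (fun m => hpart (m + K0)%N).
    have -> : (fun m => hpart (m + K0)%N) = (fun m => ep * (ep * (hpart (m + K0) - hpart K0)) + hpart K0).
      by apply/funext => m; rewrite eps_sq subrK.
    by apply: is_cvgD; [apply: is_cvgMr|exact: is_cvg_cst].
  by move/cvg_ex: c2 => [L]; rewrite (cvg_shiftn K0) => HL; rewrite /F (cvg_lim _ HL).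
have [B HB] := hpart_bounded.
apply: nondecreasing_is_cvgn; last by exists B => _ [m _ <-].
move=> m m' mm; have mm' : (m + K0 <= m' + K0)%N by rewrite leq_add2r.
rewrite -subr_ge0 -mulrBr opprB addrA subrK.
have e : hpart (m' + K0) = \sum_(m + K0 <= k < m' + K0) hterm k + hpart (m + K0).
  by rewrite [LHS](big_cat_nat (leq0n _) mm')/= [LHS]addrC.
rewrite e addrK mulr_sumr.
rewrite big_nat_cond sumr_ge0// => k /andP[/andP[mk _] _].
by rewrite hterm_sign// (leq_trans _ mk)// leq_addl.
Qed.

(** The limits in [T] and in the number of terms are exchanged by choosing, in this order, [M] for
    the tail of the series, [T] for [vpart M], and [m] depending on [T]. The fifths pay for four
    comparisons, the uniform tail counting twice. *)
Let G_lim e : 0 < e -> exists2 T0, 0 < T0 & forall T, T0 <= T -> `|G T - l `^ (1 - q) * F| <= e.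
Proof.
move=> e0; set a := l `^ (1 - q); have a0 : 0 < a := l1q0.
have e5 : 0 < e / 5 by rewrite divr_gt0.
have ea : 0 < e / 5 / a by rewrite divr_gt0.
have [M1 _ HM] := (cvgrPdist_le _ _).1 hpart_cvg _ ea.
pose M := maxn M1 K0.
have aF m : (M1 <= m)%N -> `|a * F - a * hpart m| <= e / 5.
  move=> /HM /= h; rewrite -mulrBr normrM gtr0_norm// mulrC.
  by rewrite -ler_pdivlMr.
have C0 j : 0 <= Ccoef j by exact: sumr_ge0.
have [T0 T00 HT] := big_T (mulr_ge0 (ltW a0) (C0 M)) e5.
exists T0 => // T TT; have Tp : 0 < T := lt_le_trans T00 TT.
have [M2 HM2] := G_vpart_lim (ltW Tp) e5.
pose m := maxn M M2.
have h1 := HM2 m (leq_maxr _ _).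
have h2 := vpart_mono (leq_maxr M1 K0) (leq_maxl M M2) (ltW Tp).
have h3 := le_trans (vpart_hpart M Tp) (HT T TT).
have h4 := aF M (leq_maxl _ _).
have h5 := aF m (leq_trans (leq_maxl M1 K0) (leq_maxl M M2)).
have {}h2 : `|vpart m T - vpart M T| <= 2 * (e / 5).
  apply: (le_trans h2); rewrite -/a -[a in a * _](gtr0_norm a0) -normrM mulrBr.
  have -> : a * hpart m - a * hpart M = (a * F - a * hpart M) - (a * F - a * hpart m) by ring.
  by rewrite (le_trans (ler_normB _ _))// mulr_natl mulr2n lerD.
move: h1 h2 h3 h4; rewrite -/a !ler_norml => /andP[? ?] /andP[? ?] /andP[? ?] /andP[? ?].
by apply/andP; split; lra.
Qed.

(** The Pochhammer symbols of [1 / 2] and [3 / 2] have quotient [1 / (2 * k + 1)]. *)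
Lemma hypergeometricE : hypergeometric (1 / 2) b (3 / 2) 1 = F.
Proof.
rewrite /hypergeometric /F.
have pos k : 0 < pochhammer (3 / 2 : R) k.
  elim: k => [|k IH]; first by rewrite /pochhammer big_ord0.
  by rewrite pochhammerS mulr_gt0// ltr_wpDr.
have ratio k : pochhammer (1 / 2 : R) k * (k.*2.+1)%:R = pochhammer (3 / 2) k.
  elim: k => [|k IH]; first by rewrite /pochhammer !big_ord0 mulr1.
  by rewrite !pochhammerS -IH doubleS -!natr1 -mul2n natrM; field.
have termE k : pochhammer (1 / 2) k * pochhammer b k / pochhammer (3 / 2) k * (1 ^+ k / k`!%:R) = hterm k.
  rewrite -ratio /hterm /binc expr1n; field.
  have := pos k; rewrite -ratio => /lt0r_neq0; rewrite mulf_eq0 negb_or => /andP[-> h].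
  by rewrite addrC natr1 h pnatr_eq0 -lt0n fact_gt0.
apply/cvg_lim => //; rewrite -(cvg_shiftS _) /=.
have := hpart_cvg; rewrite -(cvg_shiftS hpart); apply: cvg_trans; apply: near_eq_cvg.
near=> m; rewrite /= [LHS]big_nat_recl//; congr (_ + _).
  by rewrite /hterm binc0 divr1.
by rewrite big_add1/=; apply: eq_bigr => k _; rewrite termE.
Unshelve. all: by end_near.
Qed.

Local Notation J := (hypergeometric (1 / 2) b (3 / 2) 1).

Lemma gker_integral_le T : 0 <= T -> \int[mu]_(t in `[0, T]) gker t <= l `^ (1 - q) * J.
Proof.
move=> T0; rewrite GE// hypergeometricE; apply/ler_addgt0Pr => e e0.
have [T1 T10 H] := G_lim e0.
have := H (Num.max T1 T) ltac:(by rewrite le_max lexx).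
rewrite ler_norml => /andP[_]; rewrite lerBlDl; apply: le_trans.
by rewrite G_ndecr// le_max lexx orbT.
Qed.

Lemma le_gker_integral T : 0 < T ->
  l `^ (1 - q) * J <= \int[mu]_(t in `[0, T]) gker t + T `^ (1 - q) / (q - 1).
Proof.
move=> T0; rewrite GE ?(ltW T0)// hypergeometricE; apply/ler_addgt0Pr => e e0.
have [T1 T10 H] := G_lim e0.
have := H (Num.max T1 T) ltac:(by rewrite le_max lexx).
rewrite ler_norml => /andP[h _].
have := @G_tail T (Num.max T1 T) T0 ltac:(by rewrite le_max lexx orbT).
by move: h; lra.
Qed.

Lemma hypergeometric_le_l : J <= q / (q - 1).
Proof.
rewrite -(ler_pM2l l1q0) hypergeometricE; apply/ler_addgt0Pr => e e0.
have [T1 T10 H] := G_lim e0.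
have := H T1 (lexx _); rewrite ler_norml => /andP[h _].
by have := G_le (ltW T10); move: h; lra.
Qed.

Lemma hypergeometric_ge_l : 2 `^ (- (q / 2)) <= J.
Proof.
rewrite -(ler_pM2l l1q0); apply: (le_trans G_lower).
by rewrite -GE ?(ltW l0)// gker_integral_le// ltW.
Qed.

End HypergeometricIntegral.

Section HypergeometricBounds.
Context {R : realType}.
Variable q : R.
Hypothesis q1 : 1 < q.
Local Notation J := (hypergeometric (1 / 2) ((3 - q) / 2) (3 / 2) 1 : R).

(** The value does not involve the scale [l] of the integral, so [l = 1] is taken. *)
Lemma hypergeometric_le : J <= q / (q - 1).
Proof. exact: (hypergeometric_le_l q1 ltr01). Qed.

Lemma hypergeometric_ge : 2 `^ (- (q / 2)) <= J.
Proof. exact: (hypergeometric_ge_l q1 ltr01). Qed.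

End HypergeometricBounds.

(** * Pointwise and integral size of the error kernel *)

Section CoefficientDecay.
Context {R : realType}.
Variables (alpha r : R) (m : nat).
Hypotheses (alpha0 : 0 < alpha) (r0 : 0 < r) (r1 : r < 1).
Local Notation n := m.+1.
Local Notation coef := (pcoef alpha r).

(** The derivative of [alpha * t ^ r] at [t = n], that is the logarithmic decay rate of the
    coefficients there. [rho] is the corresponding geometric ratio and [wid] is [n * lam]. *)
Definition lam : R := alpha * r * n%:R `^ (r - 1).
Definition wid : R := alpha * r * n%:R `^ r.
Definition rho : R := expR (- lam).

Let n0 : 0 < n%:R :> R. Proof. by rewrite ltr0n. Qed.

Lemma lam_gt0 : 0 < lam. Proof. by rewrite !mulr_gt0// powR_gt0. Qed.

Lemma lam_n : lam * n%:R = wid.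
Proof.
rewrite /lam /wid -mulrA; congr (_ * _).
by rewrite -{2}[n%:R](@powRr1 R) ?(ltW n0)// -powRD_pos// subrK.
Qed.

Lemma rho_gt0 : 0 < rho. Proof. exact: expR_gt0. Qed.
Lemma rho_lt1 : rho < 1. Proof. by rewrite /rho -expR0 ltr_expR oppr_lt0 lam_gt0. Qed.
Lemma one_sub_rho_le : 1 - rho <= lam.
Proof. by have := expR_ge1Dx (- lam); rewrite -/rho; lra. Qed.

Lemma one_sub_rho_ge : lam <= 1 -> lam / 2 <= 1 - rho.
Proof.
move=> l1; have l0 := lam_gt0; have := expR_ge1Dx lam.
have : rho * expR lam = 1 by rewrite /rho expRN mulVf// gt_eqF ?expR_gt0.
have := rho_gt0; nra.
Qed.

(** Young's inequality with exponents [1 / r] and [1 / (1 - r)], applied to [(1 + z) ^ r] and 1. *)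
Lemma powR_bernoulli (z : R) : 0 <= z -> (1 + z) `^ r <= 1 + r * z.
Proof.
move=> z0; have z1 : 0 < 1 + z by rewrite ltr_wpDr.
have r1' : 0 < 1 - r by rewrite subr_gt0.
have := @conjugate_powR R ((1 + z) `^ r) 1 r^-1 (1 - r)^-1 (powR_ge0 _ _) ler01.
rewrite !invr_gt0 !invrK => /(_ r0 r1'); rewrite addrC subrK => /(_ erefl).
rewrite mulr1 powR1 mul1r -powRrM mulfV ?gt_eqF// powRr1 ?(ltW z1)//.
by move=> /le_trans; apply; rewrite le_eqVlt; apply/orP; left; apply/eqP; ring.
Qed.

Lemma pcoef_decr k k' : (k <= k')%N -> coef k' <= coef k.
Proof.
move=> kk; rewrite /pcoef ler_expR !mulNr lerN2 ler_pM2l//.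
by rewrite ge0_ler_powR ?nnegrE ?ler_nat ?(ltW r0).
Qed.

(** By concavity of [t ^ r] the exponent grows in one step by at most its derivative at [k], which
    is at most its derivative [lam] at [n]. *)
Lemma pcoef_ratio k : (n <= k)%N -> rho * coef k <= coef k.+1.
Proof.
move=> nk; rewrite /rho /pcoef -expRD ler_expR.
have k0 : 0 < k%:R :> R by rewrite ltr0n (leq_trans _ nk).
have -> : k.+1%:R = k%:R * (1 + k%:R^-1) :> R by rewrite -natr1; field; rewrite gt_eqF.
rewrite powRM ?(ltW k0) ?addr_ge0 ?invr_ge0//.
have := @powR_bernoulli k%:R^-1; rewrite invr_ge0 ler0n => /(_ isT) hb.
have kr : 0 < k%:R `^ r :> R by rewrite powR_gt0.
have kl : alpha * (k%:R `^ r * (r * k%:R^-1)) <= lam.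
  have -> : k%:R `^ r * (r * k%:R^-1) = r * k%:R `^ (r - 1) :> R.
    by rewrite mulrCA powRD_pos// powR_inv1// ltW.
  rewrite /lam mulrA ler_wpM2l ?mulr_ge0 ?(ltW alpha0) ?(ltW r0)//.
  have -> : r - 1 = - (1 - r) by ring.
  rewrite !powRN lef_pV2 ?posrE ?powR_gt0//.
  by rewrite ge0_ler_powR ?nnegrE ?ler_nat ?subr_ge0 ?(ltW r1).
have : alpha * (k%:R `^ r * (1 + k%:R^-1) `^ r) <= alpha * (k%:R `^ r * (1 + r * k%:R^-1)).
  by rewrite ler_pM2l// ler_pM2l.
move: kl; rewrite !mulrDr !mulr1 !mulNr; lra.
Qed.

(** The inequality [(1 + y) ^ r >= 1 + r * ln (1 + y)] relaxes the decay to a power law of exponent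
    [wid], which can be summed by telescoping. *)
Lemma pcoef_le j : coef (n + j) <= coef n * (1 + j%:R / n%:R) `^ (- wid).
Proof.
set y := j%:R / n%:R; have y0 : 0 <= y by rewrite divr_ge0.
have y1 : 0 < 1 + y by rewrite ltr_wpDr.
have nj : (n + j)%:R = n%:R * (1 + y) :> R.
  by rewrite natrD /y mulrDr mulr1 mulrCA mulfV ?mulr1// gt_eqF.
have yN0 : (1 + y == 0) = false by rewrite gt_eqF.
have powE s : (1 + y) `^ s = expR (s * ln (1 + y)) by rewrite /powR yN0.
rewrite /pcoef powE -expRD ler_expR nj powRM ?(ltW n0) ?(ltW y1)//.
have h : 1 + r * ln (1 + y) <= (1 + y) `^ r by rewrite powE expR_ge1Dx.
have nr : 0 < alpha * n%:R `^ r by rewrite mulr_gt0// powR_gt0.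
have := ler_wpM2l (ltW nr) h; rewrite /wid; lra.
Qed.

Lemma powR_neg_telescope (z w : R) : 0 <= z < 1 -> 0 <= w -> 1 + w * z <= (1 - z) `^ (- w).
Proof.
move=> /andP[z0 z1] w0; have z1' : 0 < 1 - z by rewrite subr_gt0.
rewrite /powR (gt_eqF z1'); apply: le_trans (expR_ge1Dx _).
rewrite lerD2l mulNr -mulrN ler_wpM2l// lerNr.
by have := @le_ln1Dx R (- z); apply; rewrite ltrN2.
Qed.

(** Discrete counterpart of integrating [(1 + t / n) ^ (- w)] over the half-line: each term is below
    a difference of values of the antiderivative. *)
Lemma sum_power_decay (w : R) M : 1 < w ->
  \sum_(0 <= j < M) (1 + j%:R / n%:R) `^ (- w) <= 1 + n%:R / (w - 1).
Proof.
move=> w1; have w10 : 0 < w - 1 by rewrite subr_gt0.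
pose y (j : nat) : R := 1 + j%:R / n%:R.
have y1 j : 1 <= y j by rewrite lerDl divr_ge0.
have y0 j : 0 < y j by exact: lt_le_trans (y1 j).
have step j : y j.+1 `^ (- w) <= n%:R / (w - 1) * (y j `^ (- (w - 1)) - y j.+1 `^ (- (w - 1))).
  pose z := (n%:R * y j.+1)^-1.
  have ny : 0 < n%:R * y j.+1 by rewrite mulr_gt0.
  have z01 : 0 <= z < 1.
    rewrite invr_ge0 (ltW ny)/= invf_lt1//.
    rewrite /y mulrDr mulr1 mulrCA mulfV ?mulr1 ?gt_eqF//.
    by rewrite -natrD ltr1n addSn addnS.
  have e : y j = y j.+1 * (1 - z).
    rewrite mulrBr mulr1 /z invfM mulrCA mulfV ?gt_eqF// mulr1 /y -natr1.
    by field; rewrite gt_eqF.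
  have := powR_neg_telescope z01 (ltW w10).
  have z1' : 0 <= 1 - z by rewrite subr_ge0 ltW//; case/andP: z01.
  rewrite e powRM ?(ltW (y0 _))// => h.
  have yw : 0 < y j.+1 `^ (- (w - 1)) by rewrite powR_gt0.
  have e2 : y j.+1 `^ (- w) = y j.+1 `^ (- (w - 1)) / y j.+1.
    have -> : - w = - (w - 1) + - 1 by ring.
    by rewrite powRD_pos// powR_inv1// ltW.
  rewrite e2 -[X in _ * (_ - X)]mulr1 -mulrBr.
  rewrite -ler_pdivrMl ?divr_gt0//.
  have -> : (n%:R / (w - 1))^-1 * (y j.+1 `^ (- (w - 1)) / y j.+1) =
      y j.+1 `^ (- (w - 1)) * ((w - 1) * z).
    by rewrite /z invf_div invfM; ring.
  by rewrite ler_pM2l// lerBrDl.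
have H K : \sum_(0 <= j < K.+1) y j `^ (- w) <= 1 + n%:R / (w - 1) * (1 - y K `^ (- (w - 1))).
  elim: K => [|K IH].
    by rewrite big_nat1 /y mul0r addr0 !powR1 subrr mulr0 addr0.
  rewrite big_nat_recr//=; apply: (le_trans (lerD IH (step K))).
  by rewrite le_eqVlt; apply/orP; left; apply/eqP; ring.
case: M => [|M]; first by rewrite big_geq// addr_ge0// divr_ge0// ltW.
apply: (le_trans (H M)); rewrite lerD2l ler_piMr ?divr_ge0 ?(ltW w10)//.
by rewrite gerBl powR_ge0.
Qed.

End CoefficientDecay.

(** * Abel summation against a geometric ratio *)

Section AbelSummation.
Context {R : realType}.
Variables (rh u : R).
Hypotheses (rh0 : 0 < rh) (rh1 : rh < 1).

(** [pden] is the squared modulus of [1 - rh e^(iu)], and [pnum t] is the imaginary part of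
    [e^(it) (1 - rh e^(-iu))]. *)
Definition pden : R := 1 - 2 * rh * cos u + rh ^+ 2.
Definition pnum (t : R) : R := sin t - rh * sin (t - u).

Lemma pden_ge : (1 - rh) ^+ 2 <= pden.
Proof.
rewrite -subr_ge0 (_ : _ - _ = 2 * rh * (1 - cos u)); last by rewrite /pden; ring.
by rewrite !mulr_ge0 ?(ltW rh0)// subr_ge0 cos_le1.
Qed.

Lemma pden_gt0 : 0 < pden.
Proof. by apply: lt_le_trans pden_ge; rewrite exprn_gt0// subr_gt0. Qed.

Lemma pnum_rec t : pden * sin t = pnum t - rh * pnum (t + u).
Proof.
rewrite /pnum addrK /pden sinB sinD; ring.
Qed.

Lemma pnum_sq t : pnum t ^+ 2 <= pden.
Proof.
rewrite /pnum /pden sinB; have h1 := cos2Dsin2 t; have h2 := cos2Dsin2 u.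
have -> : 1 - 2 * rh * cos u + rh ^+ 2 =
  (1 - rh * cos u) ^+ 2 + (rh * sin u) ^+ 2.
  by rewrite -[X in _ + X = _]mulr1 -[X in _ + _ * X = _]h2; ring.
rewrite -[leRHS]mulr1 -[X in _ <= _ * X]h1.
have -> : ((1 - rh * cos u) ^+ 2 + (rh * sin u) ^+ 2) * (cos t ^+ 2 + sin t ^+ 2) =
  (sin t - rh * (sin t * cos u - cos t * sin u)) ^+ 2 +
  ((1 - rh * cos u) * cos t - rh * sin u * sin t) ^+ 2 by ring.
by rewrite lerDl sqr_ge0.
Qed.

Lemma norm_pnum t : `|pnum t| <= Num.sqrt pden.
Proof. by rewrite -sqrtr_sqr ler_wsqrtr// pnum_sq. Qed.

Lemma abel_identity (b : nat -> R) phi M :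
  pden * (\sum_(0 <= j < M.+1) b j * sin (j%:R * u + phi)) =
  b 0%N * pnum phi + \sum_(0 <= j < M) (b j.+1 - rh * b j) * pnum (j.+1%:R * u + phi) -
  rh * b M * pnum (M.+1%:R * u + phi).
Proof.
have rec j : pden * sin (j%:R * u + phi) =
    pnum (j%:R * u + phi) - rh * pnum (j.+1%:R * u + phi).
  rewrite pnum_rec; congr (_ - _ * pnum _).
  by rewrite -natr1; ring.
elim: M => [|M IH].
  rewrite big_nat1 (big_geq (leqnn 0)) addr0 mulrCA rec mul0r add0r; ring.
rewrite big_nat_recr//= mulrDr IH mulrCA rec [in RHS]big_nat_recr//=; ring.
Qed.

(** The hypothesis makes every Abel difference nonnegative, so the absolute values telescope without
    loss. The bound is small when the sequence is nearly geometric, for then [1 - rh] times the sum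
    almost equals the first term. *)
Lemma abel_bound (b : nat -> R) phi M :
  (forall j, (j < M)%N -> rh * b j <= b j.+1) -> (forall j, 0 <= b j) ->
  `|(\sum_(0 <= j < M.+1) b j * sin (j%:R * u + phi)) - b 0%N * pnum phi / pden| <=
  ((1 - rh) * (\sum_(0 <= j < M.+1) b j) - b 0%N + 2 * b M) / Num.sqrt pden.
Proof.
move=> hb b0; have d0 := pden_gt0.
have s0 : 0 < Num.sqrt pden by rewrite sqrtr_gt0.
have ss : Num.sqrt pden * Num.sqrt pden = pden by rewrite -expr2 sqr_sqrtr// ltW.
set S := \sum_(0 <= j < M.+1) b j * sin _.
have -> : S - b 0%N * pnum phi / pden = (pden * S - b 0%N * pnum phi) / pden.
  by field; rewrite gt_eqF.
rewrite normrM [`|pden^-1|]gtr0_norm ?invr_gt0//.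
rewrite ler_pdivrMr//.
set Z := (1 - rh) * _ - _ + _.
have -> : Z / Num.sqrt pden * pden = Z * Num.sqrt pden.
  by rewrite -{2}ss mulrA divfK ?gt_eqF.
rewrite /S abel_identity.
set T1 := b 0%N * _; set T2 := \sum_(0 <= j < M) _; set T3 := rh * b M * _.
rewrite (_ : T1 + T2 - T3 - T1 = T2 - T3); last by ring.
rewrite {}/T1 {}/T2 {}/T3.
apply: (le_trans (ler_normB _ _)).
have h1 : `|\sum_(0 <= j < M) (b j.+1 - rh * b j) * pnum (j.+1%:R * u + phi)| <=
    (\sum_(0 <= j < M) (b j.+1 - rh * b j)) * Num.sqrt pden.
  rewrite (le_trans (ler_norm_sum _ _ _))// mulr_suml.
  rewrite big_nat_cond [leRHS]big_nat_cond ler_sum// => j /andP[/andP[_ jM] _].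
  by rewrite normrM ger0_norm ?subr_ge0 ?hb// ler_wpM2l ?subr_ge0 ?hb// norm_pnum.
have h2 : `|rh * b M * pnum (M.+1%:R * u + phi)| <= rh * b M * Num.sqrt pden.
  by rewrite normrM ger0_norm ?mulr_ge0 ?(ltW rh0)// ler_wpM2l ?mulr_ge0 ?(ltW rh0)// norm_pnum.
apply: (le_trans (lerD h1 h2)); rewrite -mulrDl ler_wpM2r ?(ltW s0)//.
have -> : \sum_(0 <= j < M) (b j.+1 - rh * b j) =
    (\sum_(0 <= j < M.+1) b j - b 0%N) - rh * (\sum_(0 <= j < M.+1) b j - b M).
  rewrite sumrB -mulr_sumr [X in X - b 0%N]big_nat_recl// [X in _ - rh * (X - _)]big_nat_recr//=.
  by rewrite [b 0%N + _]addrC !addrK.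
have : rh * b M <= b M by rewrite ler_piMl// ltW.
rewrite /Z mulrBr mulrBl mul1r; lra.
Qed.

End AbelSummation.

Lemma norm_sin_mul (R : realType) (k : nat) (y : R) : `|sin (k%:R * y)| <= k%:R * `|sin y|.
Proof.
elim: k => [|k IH]; first by rewrite !mul0r sin0 normr0.
rewrite -natr1 !mulrDl !mul1r sinD (le_trans (ler_normD _ _))// lerD//.
  by rewrite normrM (le_trans _ IH)// ler_piMr// cos_max.
by rewrite normrM ler_piMl// cos_max.
Qed.

(** Use [2 ^ w >= exp (w / 2) >= (w / 8) ^ 4]. From [w >= 300], [w ^ 2 / 4096] is at least 20, which
    leaves [20 * w ^ 2] against [16 * w ^ 2 + 16 * w]. *)
Lemma two_powR_ge (R : realType) (w : R) : 300 <= w -> (2 * w + 2) * 8 * w <= 2 `^ w.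
Proof.
move=> w300; have l2 := @ln2_ge_half R.
rewrite /powR (_ : (2 == 0 :> R) = false) ?gt_eqF//.
apply: (@le_trans _ _ (expR (w / 8) ^+ 4)); last first.
  rewrite -expRM_natl ler_expR; nra.
apply: (@le_trans _ _ ((1 + w / 8) ^+ 4)); last first.
  by rewrite lerXn2r ?nnegrE ?expR_ge0 ?expR_ge1Dx//; lra.
have h : (w / 8) ^+ 4 <= (1 + w / 8) ^+ 4 by rewrite lerXn2r ?nnegrE//; lra.
apply: le_trans h; have -> : (w / 8) ^+ 4 = w ^+ 2 * (w ^+ 2 / 4096) by field.
have h3 : 2 * 10 <= w ^+ 2 / 4096 by nra.
have w2 : 0 <= w ^+ 2 by exact: sqr_ge0.
have := ler_wpM2l w2 h3; nra.
Qed.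

(** * Pointwise estimate of the error kernel, block by block *)

Section KernelEstimate.
Context {R : realType}.
Variables (alpha r beta : R) (m : nat) (x : R).
Hypotheses (alpha0 : 0 < alpha) (r0 : 0 < r) (r1 : r < 1).
Local Notation n := m.+1.
Local Notation N := m.*2.+1.
Local Notation coef := (pcoef alpha r).
Local Notation lam := (lam alpha r m).
Local Notation w := (wid alpha r m).
Local Notation rho := (rho alpha r m).
Hypotheses (lam1 : lam <= 1) (w300 : 300 <= w).

Definition phase : R := N%:R * x / 2 + beta * pi / 2.

Let n0 : 0 < n%:R :> R. Proof. by rewrite ltr0n. Qed.
Let rh0 : 0 < rho. Proof. exact: rho_gt0. Qed.
Let rh1 : rho < 1. Proof. exact: rho_lt1. Qed.
Let w0 : 0 < w. Proof. by have := w300; lra. Qed.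

Let m1 : (0 < m)%N.
Proof.
have h : 300 <= n%:R :> R.
  by rewrite (le_trans w300)// -lam_n ler_piMl.
by move: h; rewrite ler_nat; case: m.
Qed.

(** From index [2 * n] on the coefficients have lost a factor [2 ^ w]. The last index [n + 2 * m] of
    the first block is in that range because [m >= 1]. *)
Lemma pcoef_decay2 j : (n <= j)%N -> coef (n + j) <= coef n * 2 `^ (- w).
Proof.
move=> nj; rewrite (le_trans (pcoef_le r m alpha0 j))//.
rewrite ler_pM2l ?pcoef_gt0// !powRN lef_pV2 ?posrE ?powR_gt0//.
have h : 1 <= j%:R / n%:R :> R by rewrite ler_pdivlMr// mul1r ler_nat.
have y2 : 2 <= 1 + j%:R / n%:R :> R by rewrite -[2]/(1 + 1) lerD2l.
apply: ge0_ler_powR => //; first exact: ltW.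
  by rewrite nnegrE.
by rewrite nnegrE (le_trans _ y2).
Qed.

(** Abel summation with [1 - rho <= lam] and [lam * n = w]: the power-law sum contributes
    [lam + w / (w - 1)], from which the first coefficient removes 1 and leaves at most
    [lam + 2 / w]; the last coefficient adds another [2 / w]. *)
Lemma first_block_estimate u :
  `|\sum_(0 <= i < N) coef (n + i) * sin ((n + i)%:R * u + phase) -
    coef n * (pnum rho u (n%:R * u + phase) / pden rho u)| <=
  coef n * (lam + 4 / w) / Num.sqrt (pden rho u).
Proof.
have a0 : 0 < coef n by exact: pcoef_gt0.
have s0 : 0 < Num.sqrt (pden rho u) by rewrite sqrtr_gt0 pden_gt0.
have -> : \sum_(0 <= i < N) coef (n + i) * sin ((n + i)%:R * u + phase) =
    \sum_(0 <= i < N) coef (n + i) * sin (i%:R * u + (n%:R * u + phase)).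
  by apply: eq_bigr => i _; congr (_ * sin _); rewrite natrD; ring.
have := @abel_bound R rho u rh0 rh1 (fun j => coef (n + j)) (n%:R * u + phase) m.*2.
rewrite addn0 -[X in _ - X]mulrA => /(_ _ _)/le_trans; apply.
- by move=> j _; rewrite addnS pcoef_ratio// leq_addr.
- by move=> j; exact: ltW (pcoef_gt0 _ _ _).
rewrite ler_pM2r ?invr_gt0//.
have w1 : 1 < w by apply: lt_le_trans w300; rewrite ltr1n.
have S1 : \sum_(0 <= j < N) coef (n + j) <= coef n * (1 + n%:R / (w - 1)).
  rewrite (le_trans (ler_sum _ (fun j _ => pcoef_le r m alpha0 j)))//.
  by rewrite -mulr_sumr ler_pM2l// sum_power_decay.
have S0 : 0 <= \sum_(0 <= j < N) coef (n + j).
  by apply: sumr_ge0 => j _; exact: ltW (pcoef_gt0 _ _ _).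
have S2 : (1 - rho) * \sum_(0 <= j < N) coef (n + j) <= coef n * (lam + w / (w - 1)).
  apply: (le_trans (ler_wpM2r S0 (one_sub_rho_le alpha r m))).
  apply: (le_trans (ler_wpM2l (ltW (lam_gt0 m alpha0 r0)) S1)).
  rewrite -lam_n le_eqVlt; apply/orP; left; apply/eqP; ring.
have S3 : coef (n + m.*2) <= coef n * (1 / w).
  apply: (le_trans (pcoef_decay2 _)).
    by rewrite -addnn -addn1 leq_add2l.
  rewrite ler_pM2l// powRN div1r lef_pV2 ?posrE ?powR_gt0//.
  by have := two_powR_ge w300; have := w300; nra.
have S4 : w / (w - 1) <= 1 + 2 / w.
  rewrite ler_pdivrMr ?subr_gt0//.
  have -> : (1 + 2 / w) * (w - 1) = w + 1 - 2 / w by field; rewrite gt_eqF.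
  have : 2 / w <= 1 by rewrite ler_pdivrMr// mul1r (le_trans _ w300)// ler_nat.
  by move=> h; rewrite -addrA lerDl subr_ge0.
have S5 := ler_wpM2l (ltW a0) S4.
have -> : 4 / w = 2 / w + 2 * (1 / w) by field; rewrite gt_eqF.
move: S2 S3 S5; rewrite !mulrDr; lra.
Qed.

(** Only the size matters here: the main term of Abel summation is bounded as well, and its bound
    cancels [- coef k]. The part [2 * w] bounds [lam] times the block length, which is at most
    [2 * n]. *)
Lemma later_block_estimate u q phi :
  `|\sum_(0 <= i < N) coef (n + q.+1 * N + i) * sin ((n + q.+1 * N + i)%:R * u + phi)| <=
  coef n * q.+2%:R `^ (- w) * (2 * w + 2) / Num.sqrt (pden rho u).
Proof.
set k := (n + q.+1 * N)%N.
have nk : (n <= k)%N by exact: leq_addr.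
have d0 : 0 < pden rho u by exact: pden_gt0.
have s0 : 0 < Num.sqrt (pden rho u) by rewrite sqrtr_gt0.
have ss : Num.sqrt (pden rho u) * Num.sqrt (pden rho u) = pden rho u.
  by rewrite -expr2 sqr_sqrtr// ltW.
have -> : \sum_(0 <= i < N) coef (k + i) * sin ((k + i)%:R * u + phi) =
    \sum_(0 <= i < N) coef (k + i) * sin (i%:R * u + (k%:R * u + phi)).
  by apply: eq_bigr => i _; congr (_ * sin _); rewrite natrD; ring.
set S := \sum_(0 <= i < N) _.
have := @abel_bound R rho u rh0 rh1 (fun j => coef (k + j)) (k%:R * u + phi) m.*2.
rewrite addn0 -/S => /(_ _ _) hS.
have {}hS := hS (fun j _ => _) (fun j => ltW (pcoef_gt0 _ _ _)).
have {}hS : `|S - coef k * pnum rho u (k%:R * u + phi) / pden rho u| <=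
       ((1 - rho) * (\sum_(0 <= j < N) coef (k + j)) - coef k + 2 * coef (k + m.*2)) /
       Num.sqrt (pden rho u).
  apply: hS => j; rewrite addnS pcoef_ratio//.
  by rewrite (leq_trans nk)// leq_addr.
have ak0 : 0 < coef k by exact: pcoef_gt0.
have hT : `|coef k * pnum rho u (k%:R * u + phi) / pden rho u| <= coef k / Num.sqrt (pden rho u).
  rewrite normrM normrM [`|coef k|]gtr0_norm// [`|_^-1|]gtr0_norm ?invr_gt0//.
  rewrite ler_pdivrMr// -{2}ss mulrA divfK ?gt_eqF// ler_pM2l//.
  exact: norm_pnum.
have Sb : \sum_(0 <= j < N) coef (k + j) <= N%:R * coef k.
  rewrite (le_trans (ler_sum _ (fun j _ => pcoef_decr alpha0 r0 (leq_addr j k))))//.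
  by rewrite sumr_const_nat subn0 mulr_natl.
have S0 : 0 <= \sum_(0 <= j < N) coef (k + j).
  by apply: sumr_ge0 => j _; exact: ltW (pcoef_gt0 _ _ _).
have Nn : N%:R <= 2 * n%:R :> R by rewrite -natrM ler_nat mul2n doubleS ltnS leqnSn.
have Sc : (1 - rho) * (\sum_(0 <= j < N) coef (k + j)) <= 2 * w * coef k.
  apply: (le_trans (ler_wpM2r S0 (one_sub_rho_le alpha r m))).
  apply: (le_trans (ler_wpM2l (ltW (lam_gt0 m alpha0 r0)) Sb)).
  have -> : 2 * w * coef k = lam * (2 * n%:R * coef k) by rewrite -lam_n; ring.
  by rewrite ler_pM2l ?lam_gt0// ler_pM2r.
have hk : coef k <= coef n * q.+2%:R `^ (- w).
  apply: (le_trans (pcoef_le r m alpha0 _)).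
  rewrite ler_pM2l ?pcoef_gt0// !powRN lef_pV2 ?posrE ?powR_gt0//.
  have h : q.+1%:R <= (q.+1 * N)%:R / n%:R :> R.
    by rewrite ler_pdivlMr// -natrM ler_nat leq_mul2l ltnS -addnn leq_addr orbT.
  rewrite ge0_ler_powR ?nnegrE ?(ltW w0)//; last by rewrite -natr1 addrC lerD2l.
have hM : coef (k + m.*2) <= coef k by rewrite pcoef_decr// leq_addr.
rewrite -[S](subrK (coef k * pnum rho u (k%:R * u + phi) / pden rho u)).
apply: (le_trans (ler_normD _ _)); apply: (le_trans (lerD hS hT)).
rewrite -mulrDl ler_pM2r ?invr_gt0//.
apply: (@le_trans _ _ (coef k * (2 * w + 2))); last first.
  by rewrite ler_pM2r// addr_gt0// mulr_gt0.
rewrite addrAC subrK mulrDr [coef k * (2 * w)]mulrC [coef k * 2]mulrC.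
by apply: (lerD Sc); rewrite ler_pM2l.
Qed.

(** The leading factor [q + 2] is the one that [norm_sin_mul] produces for the phase of a later
    block. Taking out [2 ^ (3 - w)] leaves the sum of the inverse squares of [q + 2], at most 1. *)
Lemma sum_power_tail M :
  \sum_(0 <= q < M) q.+2%:R * q.+2%:R `^ (- w) * (2 * w + 2) <= 1 / w.
Proof.
have h q : q.+2%:R * q.+2%:R `^ (- w) <= 2 `^ (3 - w) * q.+2%:R ^- 2 :> R.
  have q0 : 0 < q.+2%:R :> R by rewrite ltr0n.
  have -> : q.+2%:R * q.+2%:R `^ (- w) = q.+2%:R `^ (3 - w) * q.+2%:R ^- 2 :> R.
    rewrite -{1}[q.+2%:R](@powRr1 R) ?ler0n// -powRD_pos//.
    have -> : q.+2%:R ^- 2 = q.+2%:R `^ (- 2) :> R by rewrite powRN powR_mulrn ?ler0n.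
    by rewrite -powRD_pos//; congr (_ `^ _); ring.
  rewrite ler_pM2r ?invr_gt0 ?exprn_gt0//.
  have -> : 3 - w = - (w - 3) by ring.
  rewrite !powRN lef_pV2 ?posrE ?powR_gt0// ge0_ler_powR ?nnegrE ?ler_nat//.
  by have := w300; lra.
have w2 : 0 <= 2 * w + 2 by have := w0; lra.
apply: (@le_trans _ _ (\sum_(0 <= q < M) 2 `^ (3 - w) * (2 * w + 2) * q.+2%:R ^- 2)).
  apply: ler_sum => q _; rewrite [leRHS]mulrAC; exact: ler_wpM2r.
rewrite -mulr_sumr.
have hs : \sum_(0 <= q < M) (q.+2%:R ^- 2 : R) <= 1.
  have := @sum_inv_square_tail R 2 (M + 2)%N isT; rewrite divff ?gt_eqF//.
  by rewrite -{1}[2%N]add0n big_addn addnK; under eq_bigr do rewrite addn2.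
have p0 : 0 <= 2 `^ (3 - w) * (2 * w + 2) by rewrite mulr_ge0// powR_ge0.
apply: (le_trans (ler_wpM2l p0 hs)); rewrite mulr1.
rewrite ler_pdivlMr//.
have -> : 2 `^ (3 - w) = 8 / 2 `^ w :> R.
  rewrite powRD_pos// powRN (_ : 3 = 3%N%:R :> R)// powR_mulrn ?ler0n//.
  by congr (_ / _); rewrite -natrX.
have := two_powR_ge w300; have p2 : 0 < 2 `^ w :> R by rewrite powR_gt0.
rewrite -[X in _ <= X -> _]mul1r -ler_pdivrMr//.
by rewrite (_ : 8 / _ * _ * _ = (2 * w + 2) * 8 * w / 2 `^ w)//; ring.
Qed.

(** Every block carries the sine of a multiple of [N * x / 2], hence is bounded by a multiple of the
    sine itself; the error thus stays relative to the factor of the main term, also near the nodes.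
    [5 / w] is [4 / w] from the first block plus [1 / w] from the others. *)
Lemma ekernel_estimate u :
  `|ekernel alpha r beta m x (x + u) -
    2 * sin (N%:R * x / 2) * coef n * (pnum rho u (n%:R * u + phase) / pden rho u)| <=
  2 * `|sin (N%:R * x / 2)| * coef n * (lam + 5 / w) / Num.sqrt (pden rho u).
Proof.
set xi := N%:R * x / 2; set H := 2 * sin xi * _ * _; set B := 2 * _ * _ * _ / _.
have s0 : 0 < Num.sqrt (pden rho u) by rewrite sqrtr_gt0 pden_gt0.
have a0 : 0 < coef n by exact: pcoef_gt0.
have part M : `|\sum_(1 <= k < n + M.+1 * N) eterm alpha r beta m k x (x + u) - H| <= B.
  rewrite eterm_block big_nat_recl//= mul0n addn0 mul1r.
  rewrite -/xi addrAC (le_trans (ler_normD _ _))//.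
  have -> : B = 2 * `|sin xi| * (coef n * (lam + 4 / w) / Num.sqrt (pden rho u)) +
      2 * `|sin xi| * coef n / Num.sqrt (pden rho u) * (1 / w).
    rewrite /B; field; rewrite !gt_eqF//.
  apply: lerD.
    have -> : H = 2 * sin xi * (coef n * (pnum rho u (n%:R * u + phase) / pden rho u)).
      by rewrite /H; ring.
    rewrite -mulrBr normrM normrM [`|2|]ger0_norm// ler_wpM2l ?mulr_ge0//.
    have := first_block_estimate u; rewrite /phase -/xi.
    by under [in X in X -> _]eq_bigr do rewrite addrA.
  apply: (le_trans (ler_norm_sum _ _ _)).
  apply: (le_trans _ (ler_wpM2l _ (sum_power_tail M))); last first.
    by rewrite !mulr_ge0 ?invr_ge0 ?(ltW s0) ?(ltW a0).
  rewrite mulr_sumr; apply: ler_sum => q _.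
  rewrite normrM normrM [`|2|]ger0_norm//.
  have hl := later_block_estimate u q (q.+2%:R * xi + beta * pi / 2).
  have hs := norm_sin_mul q.+2 xi.
  apply: (@le_trans _ _ (2 * (q.+2%:R * `|sin xi|) *
    (coef n * q.+2%:R `^ (- w) * (2 * w + 2) / Num.sqrt (pden rho u)))).
    rewrite ler_pM ?mulr_ge0//; first by rewrite ler_pM2l.
    by move: hl; under [in X in X -> _]eq_bigr do rewrite addrA.
  rewrite le_eqVlt; apply/orP; left; apply/eqP; ring.
have [C hC] := ekernel_tail beta m alpha0 r0 x.
apply/ler_addgt0Pr => e e0.
pose M := (Num.truncn (`|C| / e)).
have := hC (n + M.+1 * N)%N (x + u) isT.
set S := \sum_(1 <= k < _) _ => h1; have h2 : `|S - H| <= B by exact: part.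
have h3 : C / (n + M.+1 * N)%:R <= e.
  rewrite ler_pdivrMr ?ltr0n//; apply: (le_trans (ler_norm _)).
  rewrite -ler_pdivrMl// mulrC; apply: (le_trans (ltW (truncnS_gt _))).
  by rewrite -/M ler_nat -[leqLHS]muln1 (leq_trans _ (leq_addl _ _))// leq_mul.
have -> : ekernel alpha r beta m x (x + u) - H = (S - H) + (ekernel alpha r beta m x (x + u) - S) by ring.
apply: (le_trans (ler_normD _ _)); apply: lerD => //; exact: le_trans h3.
Qed.

End KernelEstimate.

Section Fubini.
Context {R : realType}.
Local Notation mu := (@lebesgue_measure R).

Lemma ge0_fubini_itv (a b c d : R) (F : R * R -> R) :
  measurable_fun setT F -> (forall z, 0 <= F z) ->
  (\int[mu]_(x in `[a, b]) \int[mu]_(y in `[c, d]) (F (x, y))%:E =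
   \int[mu]_(y in `[c, d]) \int[mu]_(x in `[a, b]) (F (x, y))%:E)%E.
Proof.
move=> mF F0; set A := `[a, b]%classic; set B := `[c, d]%classic.
pose G (z : R * R) := (F z * (\1_A z.1 * \1_B z.2))%:E.
have mG : measurable_fun setT G.
  apply/measurable_EFinP; apply: measurable_funM => //.
  have mI (D : set R) : measurable D -> measurable_fun setT (\1_D : R -> R).
    by move=> mD; exact: measurable_indic.
  apply: measurable_funM.
    exact: (measurableT_comp (mI A (measurable_itv _)) measurable_fst).
  exact: (measurableT_comp (mI B (measurable_itv _)) measurable_snd).
have G0 z : (0 <= G z)%E by rewrite lee_fin !mulr_ge0.
transitivity (\int[mu]_x \int[mu]_y G (x, y))%E.
  rewrite integral_mkcond; apply: eq_integral => x _; rewrite patchE.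
  case: ifPn => xA.
    rewrite integral_mkcond; apply: eq_integral => y _; rewrite patchE /G/=.
    by rewrite !indicE xA mul1r; case: ifPn => _; rewrite ?mulr1 ?mulr0.
  rewrite integral0_eq// => y _.
  by rewrite /G/= !indicE (negbTE xA) mul0r mulr0.
rewrite [LHS](@fubini_tonelli _ _ (measurableTypeR R) (measurableTypeR R) R mu mu G mG G0).
symmetry.
rewrite integral_mkcond; apply: eq_integral => y _; rewrite patchE.
case: ifPn => yB.
  rewrite integral_mkcond; apply: eq_integral => x _; rewrite patchE /G/=.
  by rewrite !indicE yB mulr1; case: ifPn => _; rewrite ?mulr1 ?mulr0.
rewrite integral0_eq// => x _.
by rewrite /G/= !indicE (negbTE yB) mulr0 mulr0.
Qed.

Lemma Rintegral_even (f : R -> R) (a : R) : 0 <= a -> continuous f -> bmf f ->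
  (forall u, f (- u) = f u) ->
  \int[mu]_(u in `[- a, a]) f u = 2 * \int[mu]_(u in `[0, a]) f u.
Proof.
move=> a0 cf bf ef.
have fi := bmf_integrable (- a) a bf.
have := @Rintegral_itvB R f (BLeft (- a)) (BRight a) 0 fi.
rewrite !bnd_simp => /(_ _ _) h.
have {}h := h (ltac:(by rewrite oppr_le0)) a0.
rewrite Rintegral_itv_obnd_cbnd in h; last first.
  apply: integrableS (bmf_integrable 0 a bf) => //.
  by move=> u /=; rewrite !in_itv/= => /andP[/ltW -> ->].
have e : \int[mu]_(u in `[- a, 0]) f u = \int[mu]_(u in `[0, a]) f u.
  have := @integration_by_substitution_oppr R f 0 a a0.
  rewrite oppr0 => /(_ _) h2; rewrite /Rintegral h2.
    by congr fine; apply: eq_integral => u _ /=; rewrite ef.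
  exact: continuous_subspaceT.
move/eqP: h; rewrite subr_eq e => /eqP ->; ring.
Qed.

End Fubini.

(** * Averaging the norm over the phase *)

Section AveragedNorm.
Context {R : realType}.
Local Notation mu := (@lebesgue_measure R).
Local Notation per := (2 * pi : R).
Variables (rh q : R) (m : nat).
Hypotheses (rh0 : 0 < rh) (rh1 : rh < 1) (q1 : 1 < q).
Local Notation n := m.+1.

(* [hker th] is the sum over [j] of [rh ^ j * sin ((n + j) * u + th)]. *)
Definition hker (th u : R) : R := pnum rh u (n%:R * u + th) / pden rh u.
Definition rker (u : R) : R := (Num.sqrt (pden rh u))^-1.

Let q0 : 0 < q. Proof. by have := q1; lra. Qed.
Let d0 u : 0 < pden rh u. Proof. exact: pden_gt0. Qed.
Let s0 u : 0 < Num.sqrt (pden rh u). Proof. by rewrite sqrtr_gt0 d0. Qed.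
Let ss u : Num.sqrt (pden rh u) * Num.sqrt (pden rh u) = pden rh u.
Proof. by rewrite -expr2 sqr_sqrtr// ltW. Qed.

Lemma rker_gt0 u : 0 < rker u. Proof. by rewrite invr_gt0. Qed.

Lemma bmf_pden_inv : bmf (fun u => (pden rh u)^-1).
Proof.
have d1 : 0 < (1 - rh) ^+ 2 by rewrite exprn_gt0// subr_gt0.
apply: (@bmf_continuous_bounded _ _ ((1 - rh) ^+ 2)^-1) => u; last first.
  by rewrite gtr0_norm ?invr_gt0// lef_pV2 ?posrE// pden_ge.
apply: cvgV; first by rewrite gt_eqF.
apply: cvgD; last exact: cvg_cst.
apply: cvgB; first exact: cvg_cst.
by apply: cvgM; [exact: cvg_cst | exact: continuous_cos].
Qed.

Lemma rkerE u : rker u = `|(pden rh u)^-1| `^ 2^-1.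
Proof. by rewrite gtr0_norm ?invr_gt0// powR12_sqrt ?invr_ge0 ?(ltW (d0 u))// sqrtrV// ltW. Qed.

Lemma bmf_rker : bmf rker.
Proof.
have -> : rker = fun u => `|(pden rh u)^-1| `^ 2^-1 by apply/funext => u; rewrite rkerE.
by apply: bmf_powR bmf_pden_inv; rewrite invr_ge0.
Qed.

Lemma hkerE th u : hker th u =
  (sin (n%:R * u + th) - rh * sin (m%:R * u + th)) / pden rh u.
Proof. by rewrite /hker /pnum; congr ((_ - _ * sin _) / _); rewrite -natr1; ring. Qed.

Lemma bmf_hker th : bmf (hker th).
Proof.
have -> : hker th = fun u => (sin (n%:R * u + th) - rh * sin (m%:R * u + th)) * (pden rh u)^-1.
  by apply/funext => u; exact: hkerE.
apply: bmfM bmf_pden_inv; apply: bmfB; first exact: bmf_affine bmf_sin.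
exact: bmfZ (bmf_affine _ _ bmf_sin).
Qed.

Lemma periodic_sin_nat (k : nat) (x d : R) : sin (k%:R * (x + per) + d) = sin (k%:R * x + d).
Proof.
have -> : k%:R * (x + per) + d = k%:R * x + d + (pi *+ 2) *+ k.
  by rewrite -mulrnA -[pi *+ _]mulr_natr natrM; ring.
by rewrite periodicn//; exact: sinD2pi.
Qed.

Lemma periodic_hker th : periodic (hker th) per.
Proof.
move=> u; rewrite !hkerE !periodic_sin_nat /pden.
by have := periodic_cos_nat 1 u 0; rewrite !mul1r !addr0 => ->.
Qed.

Lemma norm_hker th u : `|hker th u| <= rker u.
Proof.
rewrite /hker /rker normrM [`|_^-1|]gtr0_norm ?invr_gt0//.
rewrite ler_pdivrMr// -{2}ss mulKf ?gt_eqF//; exact: norm_pnum.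
Qed.

(* [pnum rh u t / pden rh u] is the imaginary part of [exp (i t) / (1 - rh exp (i u))]. *)
Lemma pnum_shift u v t :
  `|pnum rh v t / pden rh v - pnum rh u t / pden rh u| <= `|v - u| / (1 - rh) * rker u.
Proof.
have r1 : 0 < 1 - rh by rewrite subr_gt0.
set Du := pden rh u; set Dv := pden rh v.
have Du0 : 0 < Du by exact: d0.
have Dv0 : 0 < Dv by exact: d0.
(* Real and imaginary parts of [1 / (1 - rh e^(iw))]; [key] below is the squared distance between
   two such values. *)
pose a w := (1 - rh * cos w) / pden rh w; pose b w := rh * sin w / pden rh w.
have ab w : pnum rh w t / pden rh w = a w * sin t + b w * cos t.
  by rewrite /pnum /a /b sinB; field; rewrite gt_eqF.
rewrite !ab.
have cs w : (1 - rh * cos w) ^+ 2 + (rh * sin w) ^+ 2 = pden rh w.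
  rewrite /pden; have e : rh ^+ 2 = rh ^+ 2 * (cos w ^+ 2 + sin w ^+ 2).
    by rewrite cos2Dsin2 mulr1.
  by rewrite [in RHS]e; ring.
have key : (a v - a u) ^+ 2 + (b v - b u) ^+ 2 = 2 * rh ^+ 2 * (1 - cos (v - u)) / (Dv * Du).
  have -> : (a v - a u) ^+ 2 + (b v - b u) ^+ 2 =
     ((1 - rh * cos v) ^+ 2 + (rh * sin v) ^+ 2) / Dv ^+ 2 +
     ((1 - rh * cos u) ^+ 2 + (rh * sin u) ^+ 2) / Du ^+ 2 -
     2 * ((1 - rh * cos v) * (1 - rh * cos u) + rh * sin v * (rh * sin u)) / (Dv * Du).
    rewrite /a /b -/Dv -/Du; field; rewrite !gt_eqF//.
  rewrite !cs -/Dv -/Du cosB.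
  have -> : 2 * rh ^+ 2 * (1 - (cos v * cos u + sin v * sin u)) =
    Dv + Du - 2 * ((1 - rh * cos v) * (1 - rh * cos u) + rh * sin v * (rh * sin u)).
    by rewrite /Dv /Du /pden; ring.
  by field; rewrite !gt_eqF.
have cauchy : (a v * sin t + b v * cos t - (a u * sin t + b u * cos t)) ^+ 2 <=
    (a v - a u) ^+ 2 + (b v - b u) ^+ 2.
  rewrite -[leRHS]mulr1 -(cos2Dsin2 t) -subr_ge0.
  set X := a v - a u; set Y := b v - b u.
  have -> : a v * sin t + b v * cos t - (a u * sin t + b u * cos t) = X * sin t + Y * cos t.
    by rewrite /X /Y; ring.
  have -> : (X ^+ 2 + Y ^+ 2) * (cos t ^+ 2 + sin t ^+ 2) - (X * sin t + Y * cos t) ^+ 2 =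
    (X * cos t - Y * sin t) ^+ 2 by ring.
  exact: sqr_ge0.
have bnd : (a v - a u) ^+ 2 + (b v - b u) ^+ 2 <= (`|v - u| / (1 - rh) * rker u) ^+ 2.
  have -> : (`|v - u| / (1 - rh) * rker u) ^+ 2 = (v - u) ^+ 2 / (1 - rh) ^+ 2 / Du.
    by rewrite 2!exprMn real_normK ?num_real// /rker !exprVn (sqr_sqrtr (ltW Du0)).
  rewrite key invfM mulrA ler_pM2r ?invr_gt0//.
  apply: ler_pM; rewrite ?invr_ge0 ?(ltW Dv0)//.
  - have h0 : 0 <= 1 - cos (v - u) by rewrite subr_ge0 cos_le1.
    by rewrite mulr_ge0// mulr_ge0// sqr_ge0.
  - have h := one_sub_cos_le (v - u).
    have h0 : 0 <= 1 - cos (v - u) by rewrite subr_ge0 cos_le1.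
    have h1 : rh ^+ 2 <= 1 by rewrite expr_le1 ?ltW.
    have := ler_wpM2r h0 h1; lra.
  - by rewrite lef_pV2 ?posrE ?exprn_gt0// pden_ge.
rewrite -[leRHS]ger0_norm; last first.
  by rewrite mulr_ge0 ?(ltW (rker_gt0 u))// divr_ge0// ltW.
by rewrite -ler_sqr ?nnegrE// !real_normK ?num_real// (le_trans cauchy).
Qed.

(** For fixed [u], [pnum] is a sinusoid in [t]. An arccosine gives the right phase because the
    coefficient [1 - rh * cos u] of [sin t] is positive. *)
Lemma pnum_amplitude u : exists c, forall t, pnum rh u t = Num.sqrt (pden rh u) * cos (t + c).
Proof.
set s := Num.sqrt (pden rh u); have s0' : 0 < s by exact: s0.
have cs : (1 - rh * cos u) ^+ 2 + (rh * sin u) ^+ 2 = s ^+ 2.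
  rewrite [RHS]expr2 /s ss /pden; have e : rh ^+ 2 = rh ^+ 2 * (cos u ^+ 2 + sin u ^+ 2).
    by rewrite cos2Dsin2 mulr1.
  by rewrite [in RHS]e; ring.
have c1 : 0 < 1 - rh * cos u.
  by rewrite subr_gt0 (le_lt_trans _ rh1)// ler_piMr ?(ltW rh0)// cos_le1.
pose y := rh * sin u / s.
have y2 : y ^+ 2 + ((1 - rh * cos u) / s) ^+ 2 = 1.
  by rewrite /y !expr_div_n -mulrDl addrC cs divff// gt_eqF// exprn_gt0.
have y1 : -1 <= y <= 1.
  rewrite -ler_norml -[leRHS]ger0_norm// -ler_sqr ?nnegrE// !real_normK ?num_real//.
  by rewrite expr1n -y2 lerDl sqr_ge0.
exists (- acos y) => t; rewrite cosB acosK ?in_itv// sin_acos//.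
have -> : 1 - y ^+ 2 = ((1 - rh * cos u) / s) ^+ 2 by rewrite -[X in X - _]y2; ring.
rewrite sqrtr_sqr ger0_norm ?divr_ge0 ?(ltW c1) ?(ltW s0')//.
by rewrite /pnum sinB /y; field; rewrite gt_eqF.
Qed.

(** After the exchange of integrals, the phase integral at fixed [u] runs over a full period of a
    cosine of amplitude [rker u], so the shift of that cosine is immaterial. *)
Lemma hker_average a th :
  \int[mu]_(s in `[0, 0 + per]) (pnorm q a (hker (th + s)) `^ q) =
  (pnorm q 0 cos * pnorm q a rker) `^ q.
Proof.
pose F (z : R * R) := `|hker (th + z.1) z.2| `^ q.
have mF : measurable_fun setT F.
  have mp : measurable_fun setT (fun x : R => `|x| `^ q).
    exact: (measurableT_comp (measurable_powR q) (@normr_measurable R setT)).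
  apply: (measurableT_comp mp).
  have -> : (fun z => hker (th + z.1) z.2) = (fun z : R * R =>
     (sin (n%:R * z.2 + (th + z.1)) - rh * sin (m%:R * z.2 + (th + z.1))) * (pden rh z.2)^-1).
    by apply/funext => z; rewrite hkerE.
  have mt (k : nat) : measurable_fun setT (fun z : R * R => sin (k%:R * z.2 + (th + z.1)) : R).
    apply: (measurableT_comp (bmf_measurable (@bmf_sin R))).
    apply: measurable_funD; first by apply: measurable_funM => //; exact: measurable_snd.
    by apply: measurable_funD => //; exact: measurable_fst.
  apply: measurable_funM; last first.
    exact: (measurableT_comp (bmf_measurable bmf_pden_inv) measurable_snd).
  by apply: measurable_funB => //; apply: measurable_funM.
have F0 z : 0 <= F z by exact: powR_ge0.
have := @ge0_fubini_itv R 0 (0 + per) a (a + per) F mF F0.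
have inner u : (\int[mu]_(s in `[0%R, (0 + per)%R]) (F (s, u))%:E =
    (pnorm q 0 cos `^ q * (`|rker u| `^ q))%:E)%E.
  have [c hc] := pnum_amplitude u.
  have hE s : hker (th + s) u = rker u * cos (s + (n%:R * u + th + c)).
    rewrite /hker hc /rker -{2}ss.
    have -> : n%:R * u + (th + s) + c = s + (n%:R * u + th + c) by ring.
    by field; rewrite gt_eqF.
  have bc : bmf (fun s => cos (s + (n%:R * u + th + c))) by exact: bmf_shift (@bmf_cos R).
  rewrite -EFin_bmf_integral; last first.
    apply: bmf_powR (ltW q0) _.
    have -> : (fun s => hker (th + (s, u).1) (s, u).2) =
      (fun s => rker u * cos (s + (n%:R * u + th + c))) by apply/funext => s; exact: hE.
    exact: bmfZ.
  congr EFin; rewrite -(pnormX _ _ q0).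
  have -> : pnorm q 0 (fun s => hker (th + (s, u).1) (s, u).2) =
     `|rker u| * pnorm q 0 (fun s => cos (s + (n%:R * u + th + c))).
    rewrite -pnormZ//; by apply: eq_pnorm => s /=; rewrite hE.
  rewrite powRM ?pnorm_ge0// mulrC; congr (_ * _).
  rewrite (@pnorm_shift R q 0 0)//; [exact: ltW|exact: bmf_cos|].
  by move=> x; have := periodic_cos_nat 1 x 0; rewrite !mul1r !addr0.
under [in X in _ = X -> _]eq_integral do rewrite inner.
rewrite -EFin_bmf_integral; last by apply: bmfZ (bmf_powR (ltW q0) bmf_rker).
have inner2 s : (\int[mu]_(y in `[a, (a + per)%R]) (F (s, y))%:E =
    (pnorm q a (hker (th + s)) `^ q)%:E)%E.
  by rewrite pnormX// (EFin_bmf_integral _ _ (bmf_powR (ltW q0) (bmf_hker _))).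
under eq_integral do rewrite inner2.
move=> /(congr1 fine) /= h; rewrite /Rintegral h.
rewrite powRM ?pnorm_ge0// [X in _ = _ * X]pnormX// RintegralZl//.
exact: (bmf_integrable _ _ (bmf_powR (ltW q0) bmf_rker)).
Qed.

(** Translation by [(th' - th) / n] turns the phase [th] of the numerator into [th'] and preserves
    the norm. Only the slow factor [1 / (1 - rh e^(iu))] has moved, and [pnum_shift] controls it. *)
Lemma hker_lipschitz a th th' :
  `|pnorm q a (hker th) - pnorm q a (hker th')| <=
  `|th' - th| / (n%:R * (1 - rh)) * pnorm q a rker.
Proof.
pose d : R := (th' - th) / n%:R.
have nN : n%:R != 0 :> R by rewrite pnatr_eq0.
have r1 : 0 < 1 - rh by rewrite subr_gt0.
have -> : pnorm q a (hker th) = pnorm q a (fun u => hker th (u + d)).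
  by rewrite (@pnorm_shift R q a a)//; [exact: ltW|exact: bmf_hker|exact: periodic_hker].
have -> : `|th' - th| / (n%:R * (1 - rh)) * pnorm q a rker =
   pnorm q a (fun u => `|th' - th| / (n%:R * (1 - rh)) * rker u).
  rewrite pnormZ//; last exact: bmf_rker.
  by rewrite [X in _ = X * _]ger0_norm// divr_ge0// mulr_ge0// ltW.
apply: pnorm_dist; [exact: ltW| | exact: bmf_hker | exact: bmfZ bmf_rker | ].
  exact: bmf_shift (bmf_hker _).
move=> u _; rewrite /hker.
have -> : n%:R * (u + d) + th = n%:R * u + th' by rewrite /d; field.
apply: (le_trans (pnum_shift _ _ _)).
rewrite addrAC subrr add0r [leRHS]ger0_norm; last first.
  by rewrite mulr_ge0 ?(ltW (rker_gt0 u))// divr_ge0// mulr_ge0// ltW.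
rewrite le_eqVlt; apply/orP; left; apply/eqP.
rewrite /d normrM normfV [`|n%:R|]ger0_norm ?ler0n//; field.
by rewrite nat1r nN gt_eqF.
Qed.

(* Averaging over the phase [th] separates the oscillation from the envelope [rker], and
   the norm moves little with [th] because a change of phase is a translation by at most
   [2 pi / n]. *)
Lemma hker_norm a th :
  `|pnorm q a (hker th) * per `^ q^-1 - pnorm q 0 cos * pnorm q a rker| <=
  per / (n%:R * (1 - rh)) * pnorm q a rker * per `^ q^-1.
Proof.
pose L := pnorm q a rker / (n%:R * (1 - rh)).
have r1 : 0 < 1 - rh by rewrite subr_gt0.
have L0 : 0 <= L by rewrite divr_ge0 ?pnorm_ge0// mulr_ge0// ltW.
(* As a function of the phase shift the norm [P] is Lipschitz, and its own [L_q] norm over a period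
   is the product to be reached; it is compared with the constant [P 0]. *)
pose P s := pnorm q a (hker (th + s)).
have lip s s' : `|P s - P s'| <= L * `|s - s'|.
  apply: (le_trans (hker_lipschitz _ _ _)).
  rewrite opprD addrACA subrr add0r distrC le_eqVlt; apply/orP; left; apply/eqP.
  by rewrite /L; ring.
have cP : continuous P.
  move=> s; apply/cvgrPdist_lt => e e0.
  have L1 : 0 < L + 1 by rewrite ltr_wpDl.
  apply/nbhs_ballP; exists (e / (L + 1)) => /=; first by rewrite divr_gt0.
  move=> t; rewrite /ball/= => h; apply: (le_lt_trans (lip _ _)).
  apply: (@le_lt_trans _ _ ((L + 1) * `|s - t|)).
    by rewrite ler_wpM2r// lerDl.
  by rewrite -ltr_pdivlMl// mulrC.
have bP : bmf P.
  apply: (@bmf_continuous_bounded _ _ (pnorm q a rker)) => // s.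
  rewrite ger0_norm ?pnorm_ge0//; apply: ler_pnorm => //.
  - exact: bmf_hker.
  - exact: bmf_rker.
  - by move=> u _; rewrite [leRHS]gtr0_norm ?rker_gt0// norm_hker.
have CP : pnorm q 0 P = pnorm q 0 cos * pnorm q a rker.
  have root z : 0 <= z -> (z `^ q) `^ q^-1 = z.
    by move=> z0; rewrite -powRrM mulfV ?gt_eqF// powRr1.
  rewrite -[LHS]root ?pnorm_ge0// pnormX//.
  under eq_Rintegral do rewrite ger0_norm ?pnorm_ge0//.
  by rewrite hker_average root// mulr_ge0// pnorm_ge0.
have c0 : pnorm q 0 (fun=> P 0) = pnorm q a (hker th) * per `^ q^-1.
  by rewrite pnorm_cst// /P addr0 ger0_norm ?pnorm_ge0.
rewrite -CP -c0.
have -> : per / (n%:R * (1 - rh)) * pnorm q a rker * per `^ q^-1 =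
    pnorm q 0 (fun=> per * L).
  have p0 : 0 <= per :> R by rewrite mulr_ge0// pi_ge0.
  rewrite pnorm_cst//.
  have -> : per / (n%:R * (1 - rh)) * pnorm q a rker = per * L by rewrite /L; ring.
  by rewrite ger0_norm// mulr_ge0.
apply: pnorm_dist; [exact: ltW|exact: bmf_cst|by []|exact: bmf_cst|].
move=> s; rewrite add0r => /andP[s0' s1].
have p0 : 0 <= per :> R by rewrite mulr_ge0// pi_ge0.
rewrite [leRHS]ger0_norm; last exact: mulr_ge0.
apply: (le_trans (lip _ _)); rewrite sub0r normrN ger0_norm// mulrC.
by rewrite ler_wpM2r.
Qed.

End AveragedNorm.

(** * Comparison of the envelope with [(l ^ 2 + u ^ 2) ^ (- 1 / 2)] *)

Section KernelSize.
Context {R : realType}.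
Local Notation mu := (@lebesgue_measure R).
Local Notation per := (2 * pi : R).
Variables (l q : R).
Hypotheses (l0 : 0 < l) (l1 : l <= 100^-1) (q1 : 1 < q).
Local Notation rh := (expR (- l)).
Local Notation den := (pden (expR (- l))).

Let q0 : 0 < q. Proof. by have := q1; lra. Qed.
Let rh0 : 0 < rh. Proof. exact: expR_gt0. Qed.
Let rh1 : rh < 1. Proof. by rewrite -expR0 ltr_expR oppr_lt0. Qed.

Lemma pdenE (a u : R) : pden a u = (1 - a) ^+ 2 + 2 * a * (1 - cos u).
Proof. by rewrite /pden; ring. Qed.

Let rhl : 1 - l <= rh. Proof. by have := expR_ge1Dx (- l); lra. Qed.
Let rhu : l * (1 - l) <= 1 - rh.
Proof.
have h : rh * expR l = 1 by rewrite -expRD addNr expR0.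
have := expR_ge1Dx l; have := rh0; have := l0; move: rhl h.
move: (expR l) rh => e a; nra.
Qed.

Lemma pden_le_sq u : den u <= sq l u.
Proof.
rewrite pdenE /sq; have h := one_sub_cos_le u.
have h0 : 0 <= 1 - cos u by rewrite subr_ge0 cos_le1.
have h1 : (1 - rh) ^+ 2 <= l ^+ 2.
  by rewrite ler_pXn2r ?nnegrE//; [move: rhl; lra | rewrite subr_ge0 ltW | exact: ltW].
have h2 : rh * (1 - cos u) <= 1 - cos u by rewrite ler_piMl// ltW.
rewrite -mulrA; move: (rh * _) h1 h2 h => z; lra.
Qed.

Lemma sq_sub_pden u : sq l u - den u <= 2 * l * sq l u + sq l u ^+ 2 / 12.
Proof.
rewrite pdenE /sq; have h := one_sub_cos_ge_quartic u.
have h0 : 0 <= 1 - cos u by rewrite subr_ge0 cos_le1.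
have hc := one_sub_cos_le u.
have h1 : (l * (1 - l)) ^+ 2 <= (1 - rh) ^+ 2.
  rewrite ler_pXn2r ?nnegrE//; last by rewrite subr_ge0 ltW.
  by rewrite mulr_ge0 ?(ltW l0)//; have := l1; lra.
have h2 : (1 - l) * (1 - cos u) <= rh * (1 - cos u) by rewrite ler_wpM2r.
have h3 : l * (1 - cos u) <= l * (u ^+ 2 / 2) by rewrite ler_wpM2l// ltW.
have h4 : 0 <= l ^+ 4 by rewrite exprn_ge0 ?ltW.
have h5 : 0 <= l ^+ 2 * u ^+ 2 by rewrite mulr_ge0 ?sqr_ge0.
have h6 : 0 <= l * u ^+ 2 by rewrite mulr_ge0 ?sqr_ge0// ltW.
have e1 : (l * (1 - l)) ^+ 2 = l ^+ 2 - 2 * l ^+ 3 + l ^+ 4 by ring.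
have e2 : (l ^+ 2 + u ^+ 2) ^+ 2 = l ^+ 4 + 2 * (l ^+ 2 * u ^+ 2) + u ^+ 4 by ring.
have e3 : 2 * l * (l ^+ 2 + u ^+ 2) = 2 * l ^+ 3 + 2 * (l * u ^+ 2) by ring.
have e4 : (1 - l) * (1 - cos u) = (1 - cos u) - l * (1 - cos u) by ring.
have e5 : l * (u ^+ 2 / 2) = (l * u ^+ 2) / 2 by ring.
rewrite e1 in h1; rewrite e4 in h2; rewrite e5 in h3; rewrite e2 e3 -mulrA.
move: h1 h2 h3 h4 h5 h6 h.
move: ((1 - rh) ^+ 2) (rh * (1 - cos u)) (l * (1 - cos u)) (l * u ^+ 2) (l ^+ 2 * u ^+ 2).
move=> x1 x2 x3 x4 x5; lra.
Qed.

Lemma pden_ge_sq u : - pi <= u <= pi -> sq l u / 10 <= den u.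
Proof.
move=> hu; rewrite pdenE /sq; have h := one_sub_cos_ge hu.
have h0 : 0 <= 1 - cos u by rewrite subr_ge0 cos_le1.
have h1 : (l * (1 - l)) ^+ 2 <= (1 - rh) ^+ 2.
  rewrite ler_pXn2r ?nnegrE//; last by rewrite subr_ge0 ltW.
  by rewrite mulr_ge0 ?(ltW l0)//; have := l1; lra.
have h2 : 99 / 100 * (1 - cos u) <= rh * (1 - cos u).
  by rewrite ler_wpM2r//; move: rhl l1; lra.
have h3 : (l * (99 / 100)) ^+ 2 <= (l * (1 - l)) ^+ 2.
  rewrite ler_pXn2r ?nnegrE//; last 2 first.
  - by rewrite mulr_ge0 ?(ltW l0)//; have := l1; lra.
  - by rewrite mulr_ge0 ?(ltW l0)//; have := l1; lra.
  by rewrite ler_pM2l//; have := l1; lra.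
have h4 := sqr_ge0 l; have h5 := sqr_ge0 u.
rewrite (_ : (l * (99 / 100)) ^+ 2 = l ^+ 2 * (9801 / 10000)) in h3; last by field.
rewrite -mulrA; move: (rh * _) h1 h2 h3 h4 h5 h => z; lra.
Qed.

Lemma gker_root u : gker q l u `^ q^-1 = (Num.sqrt (sq l u))^-1.
Proof.
rewrite /gker -powRrM.
have -> : - (q / 2) * q^-1 = - 2^-1 by field; rewrite gt_eqF.
by rewrite powRN powR12_sqrt// ltW// sq_gt0.
Qed.

(** With [y] and [z] the square roots of [sq l u] and [den u], the upper bound reads
    [y <= z * (1 + 8 * y)]. For [y >= 7 / 20] the crude ratio 10 of [pden_ge_sq] suffices, as
    [(1 + 8 * y) ^ 2 >= 10]; for smaller [y], [l <= y] turns [sq_sub_pden] into a relative error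
    [2 * y + y ^ 2 / 12]. *)
Lemma rker_gker u : - pi <= u <= pi ->
  gker q l u `^ q^-1 <= rker rh u <= gker q l u `^ q^-1 + 8.
Proof.
move=> hu; rewrite gker_root /rker.
have D0 : 0 < den u by exact: pden_gt0.
have S0 : 0 < sq l u by exact: sq_gt0.
have z0 : 0 < Num.sqrt (den u) by rewrite sqrtr_gt0.
have y0 : 0 < Num.sqrt (sq l u) by rewrite sqrtr_gt0.
rewrite lef_pV2 ?posrE// ler_wsqrtr ?pden_le_sq//=.
have yl : l <= Num.sqrt (sq l u).
  by rewrite -[leLHS]ger0_norm ?(ltW l0)// -sqrtr_sqr ler_wsqrtr// /sq lerDl sqr_ge0.
have h1 := sq_sub_pden u; have h2 := pden_ge_sq hu.
have Dz : Num.sqrt (den u) ^+ 2 = den u by rewrite sqr_sqrtr// ltW.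
have Sy : Num.sqrt (sq l u) ^+ 2 = sq l u by rewrite sqr_sqrtr// ltW.
rewrite -Dz -Sy in h1 h2; clear Dz Sy; move: h1 h2.
move: (Num.sqrt (den u)) (Num.sqrt (sq l u)) z0 y0 yl => z y z0 y0 yl h1 h2.
have zy : y <= z * (1 + 8 * y).
  rewrite -ler_sqr ?nnegrE ?(ltW y0)//; last first.
    by rewrite mulr_ge0 ?(ltW z0)// addr_ge0// mulr_ge0// ltW.
  rewrite exprMn.
  have y2 : 0 < y ^+ 2 by rewrite exprn_gt0.
  have [yb|yb] := leP (7 / 20) y.
    have : y ^+ 2 / 10 * (1 + 8 * y) ^+ 2 <= z ^+ 2 * (1 + 8 * y) ^+ 2.
      by rewrite ler_wpM2r// sqr_ge0.
    apply: le_trans; have : 10 <= (1 + 8 * y) ^+ 2 by nra.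
    by move/(ler_wpM2l (ltW y2)); lra.
  have hz : y ^+ 2 * (1 - 2 * y - y ^+ 2 / 12) <= z ^+ 2.
    have : 2 * l * y ^+ 2 <= 2 * y * y ^+ 2 by rewrite ler_pM2r// ler_pM2l.
    have -> : y ^+ 2 * (1 - 2 * y - y ^+ 2 / 12) = y ^+ 2 - 2 * y * y ^+ 2 - (y ^+ 2) ^+ 2 / 12.
      by field.
    lra.
  have : y ^+ 2 * (1 - 2 * y - y ^+ 2 / 12) * (1 + 8 * y) ^+ 2 <= z ^+ 2 * (1 + 8 * y) ^+ 2.
    by rewrite ler_wpM2r// sqr_ge0.
  apply: le_trans; rewrite -mulrA -[leLHS]mulr1 ler_pM2l//.
  nra.
rewrite -(ler_pM2l z0) mulfV ?gt_eqF// mulrDr -(ler_pM2r y0) mul1r.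
by rewrite mulrDl divfK ?gt_eqF//; apply: (le_trans zy); lra.
Qed.

Lemma bmf_gker_root : bmf (fun u => gker q l u `^ q^-1).
Proof.
have -> : (fun u => gker q l u `^ q^-1) = (fun u => `|gker q l u| `^ q^-1).
  by apply/funext => u; rewrite gtr0_norm// gker_gt0.
apply: bmf_powR (bmf_gker q1 l0); rewrite invr_ge0; exact: ltW.
Qed.

Definition gkernorm := pnorm q (- pi) (fun u => gker q l u `^ q^-1).

Lemma rker_norm : `|pnorm q (- pi) (rker rh) - gkernorm| <= 8 * per `^ q^-1.
Proof.
have -> : 8 * per `^ q^-1 = pnorm q (- pi) (fun=> 8) by rewrite pnorm_cst// ger0_norm.
apply: pnorm_dist.
- exact: ltW.
- exact: bmf_rker.
- exact: bmf_gker_root.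
- exact: bmf_cst.
move=> u hu; rewrite [leRHS]ger0_norm// ler_norml.
have /andP[h1 h2] : gker q l u `^ q^-1 <= rker rh u <= gker q l u `^ q^-1 + 8.
  by apply: rker_gker; move: hu; rewrite (_ : - pi + per = pi)//; ring.
by apply/andP; split; lra.
Qed.

Lemma gkernormX : gkernorm `^ q = 2 * \int[mu]_(u in `[0, pi]) gker q l u.
Proof.
rewrite pnormX//.
have -> : - pi + per = pi by ring.
have e u : `|gker q l u `^ q^-1| `^ q = gker q l u.
  rewrite ger0_norm ?powR_ge0// -powRrM mulVf ?gt_eqF// powRr1//.
  by rewrite ltW// gker_gt0.
under eq_Rintegral do rewrite e.
apply: Rintegral_even; [exact: pi_ge0|exact: continuous_gker|exact: bmf_gker|].
by move=> u; rewrite /gker /sq sqrrN.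
Qed.

End KernelSize.

(** * The threshold and the final estimate *)

Section Threshold.
Context {R : realType}.
Variables (alpha r p : R).
Hypotheses (alpha0 : 0 < alpha) (r0 : 0 < r) (r1 : r < 1) (p1 : 1 < p).

(** Since [3 * pi > 9], the threshold is at most [1 / 729], and the logarithm is at least [1 / 2];
    so [w >= 729 / 2] at [nstar]. Both conclusions persist for larger indices, because [wid]
    increases and [lam] decreases with [n]. *)
Lemma nstar_large (m : nat) : (nstar alpha r p%:E <= m.+1)%N ->
  300 <= wid alpha r m /\ lam alpha r m * p <= 100^-1.
Proof.
move=> km.
have [k0 B _] : is_nstar alpha r p%:E (nstar alpha r p%:E).
  by apply: nstarP; rewrite ?r0 ?r1// lee_fin ltW.
move: (nstar _ _ _) k0 B km => k k0 B km.
have p0 : 0 < p by have := p1; lra.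
have pN1 : p == 1 = false by rewrite gt_eqF.
have pk0 : 0 < k%:R :> R by rewrite ltr0n.
have km' : k%:R <= m.+1%:R :> R by rewrite ler_nat.
have ar0 : 0 < alpha * r by rewrite mulr_gt0.
move: B; rewrite /below_threshold /threshold /chi pN1.
set T := _^-1 * _; have T1 : T <= 729^-1.
  have z9 : 9 <= 3 * pi :> R by have := @pi_gt3 R; lra.
  move: (3 * pi : R) z9 @T => z z9 T.
  have z3 : 729 <= z ^+ 3 by rewrite 2!exprS expr1; nra.
  have z0 : 0 < z ^+ 3 by apply: lt_le_trans z3; rewrite ltr0n.
  have c1 : (p - 1) / p <= 1 by rewrite ler_pdivrMr// mul1r gerBl.
  apply: (@le_trans _ _ (z ^+ 3)^-1).
    by rewrite /T ler_piMr// invr_ge0 ltW.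
  by rewrite -[leLHS]mul1r ler_pdivrMr// -ler_pdivrMl ?invr_gt0 ?ltr0n// invrK mulr1.
have l2 : 1 / 2 <= ln (pi * k%:R) :> R.
  have k1 : 1 <= k%:R :> R by rewrite ler1n.
  have pk : 3 <= pi * k%:R :> R.
    by rewrite -[leLHS]mulr1 ler_pM// ltW// pi_gt3.
  apply: (le_trans ln2_ge_half); rewrite ler_ln ?posrE//; lra.
have kr0 : 0 < alpha * r * k%:R `^ r by rewrite mulr_gt0// powR_gt0.
have kr1 : 0 < k%:R `^ (1 - r) :> R by rewrite powR_gt0.
move=> B.
have t1 : 0 <= ln (pi * k%:R) / (alpha * r * k%:R `^ r).
  by rewrite divr_ge0 ?(ltW kr0)//; lra.
have t2 : 0 <= alpha * r * p / k%:R `^ (1 - r).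
  by rewrite divr_ge0 ?(ltW kr1)// mulr_ge0 ?(ltW ar0) ?(ltW p0).
split.
  have : alpha * r * k%:R `^ r <= wid alpha r m.
    by rewrite /wid ler_pM2l// ge0_ler_powR ?nnegrE ?ler0n// ltW.
  apply: le_trans.
  have : ln (pi * k%:R) / (alpha * r * k%:R `^ r) <= 729^-1 by lra.
  rewrite ler_pdivrMr//; lra.
have : alpha * r * p / k%:R `^ (1 - r) <= 100^-1 by lra.
apply: le_trans; rewrite /lam (_ : r - 1 = - (1 - r)); last by ring.
rewrite powRN mulrAC ler_pM2l ?mulr_gt0// lef_pV2 ?posrE ?powR_gt0//.
by rewrite ge0_ler_powR ?nnegrE ?ler0n ?subr_ge0// ltW.
Qed.

End Threshold.

Section RootGap.
Context {R : realType}.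

(** From [G <= A] follows [G ^ q <= G * A ^ (q - 1)], so the powers differ by at least
    [(A - G) * A ^ (q - 1)]. *)
Lemma powR_root_gap (A G Y q : R) : 1 < q -> 0 < A -> 0 <= G <= A ->
  A `^ q - Y <= G `^ q -> A - G <= Y * A `^ (1 - q).
Proof.
move=> q1 A0 /andP[G0 GA] h.
have AE : A `^ q = A * A `^ (q - 1).
  by rewrite -{2}[A]powRr1 ?(ltW A0)// -powRD_pos//; congr (_ `^ _); ring.
have GE : G `^ q <= G * A `^ (q - 1).
  have [<-|GN] := eqVneq 0 G; first by rewrite powR0 ?mul0r// gt_eqF//; lra.
  have G0' : 0 < G by rewrite lt_neqAle GN.
  have -> : G `^ q = G * G `^ (q - 1).
    by rewrite -{2}[G]powRr1 ?(ltW G0')// -powRD_pos//; congr (_ `^ _); ring.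
  by rewrite ler_pM2l// ge0_ler_powR ?nnegrE ?subr_ge0 ?(ltW A0) ?(ltW q1).
have -> : 1 - q = - (q - 1) by ring.
rewrite powRN ler_pdivlMr ?powR_gt0// mulrBl -AE; lra.
Qed.

End RootGap.

(** * The model envelope: whole line against one period *)

Section MainTerm.
Context {R : realType}.
Local Notation per := (2 * pi : R).
Variables (p q l : R).
Hypotheses (p1 : 1 < p) (pq : p^-1 + q^-1 = 1) (l0 : 0 < l) (l1 : l * p <= 100^-1).
Local Notation J := (hypergeometric (1 / 2) ((3 - q) / 2) (3 / 2) 1 : R).

Let p0 : 0 < p. Proof. by have := p1; lra. Qed.
Let qV : 0 < q^-1 < 1.
Proof.
have h : p^-1 < 1 by rewrite invf_lt1.
have : 0 < p^-1 by rewrite invr_gt0.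
by have := pq; move: h; lra.
Qed.
Let q0 : 0 < q. Proof. by rewrite -invr_gt0; case/andP: qV. Qed.

Lemma conjugate_gt1 : 1 < q.
Proof. by have /andP[_] := qV; rewrite invf_lt1. Qed.
Let q1 := conjugate_gt1.

Let pE : q / (q - 1) = p.
Proof.
have e : q - 1 = q * p^-1.
  have -> : p^-1 = 1 - q^-1 by have := pq; lra.
  by field; rewrite gt_eqF.
by rewrite e; field; rewrite !gt_eqF.
Qed.

Let l1' : l <= 100^-1.
Proof. by apply: le_trans l1; rewrite ler_peMr ?(ltW l0)// ltW. Qed.

Let J0 : 0 < J.
Proof. by apply: lt_le_trans (hypergeometric_ge q1); rewrite powR_gt0. Qed.

(* The [L_q] norm over the whole line of [(l ^ 2 + u ^ 2) ^ (- 1 / 2)]. *)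
Definition Xroot : R := (2 * l `^ (1 - q) * J) `^ q^-1.

Let X0 : 0 < 2 * l `^ (1 - q) * J. Proof. by rewrite !mulr_gt0// powR_gt0. Qed.

Lemma Xroot_gt0 : 0 < Xroot. Proof. exact: powR_gt0. Qed.

Let lq : (l `^ (1 - q)) `^ q^-1 = l `^ (- p^-1).
Proof.
rewrite -powRrM; congr (_ `^ _).
have -> : p^-1 = 1 - q^-1 by have := pq; lra.
by field; rewrite gt_eqF.
Qed.

Lemma XrootE : Xroot = 2 `^ q^-1 * l `^ (- p^-1) * J `^ q^-1.
Proof. by rewrite /Xroot !powRM ?mulr_ge0 ?powR_ge0 ?(ltW J0)// lq. Qed.

Let powR_le_id (y : R) : 1 <= y -> y `^ q^-1 <= y.
Proof.
move=> y1; have /andP[_ h] := qV.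
rewrite -[leRHS](@powRr1 R) ?(le_trans ler01 y1)//.
by rewrite ler_powR// ltW.
Qed.

Lemma Xroot_le : Xroot <= 2 * (p `^ q^-1 * l `^ (- p^-1)).
Proof.
rewrite XrootE -mulrA; apply: ler_pM; rewrite ?mulr_ge0 ?powR_ge0//.
  by apply: powR_le_id; lra.
rewrite mulrC ler_pM2r ?powR_gt0//.
rewrite ge0_ler_powR ?nnegrE ?(ltW J0) ?invr_ge0 ?(ltW q0) ?(ltW p0)//.
by rewrite -pE; exact: hypergeometric_le.
Qed.

(** The product is at most [2 * (l * p) ^ (1 / q)], which is why smallness is asked of [l * p] and
    not just of [l]. *)
Lemma lam_Xroot_le : l * Xroot <= 2.
Proof.
apply: (le_trans (ler_wpM2l (ltW l0) Xroot_le)).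
have -> : l * (2 * (p `^ q^-1 * l `^ (- p^-1))) = 2 * (l * p) `^ q^-1.
  rewrite powRM ?(ltW l0) ?(ltW p0)//.
  have -> : q^-1 = 1 + - p^-1 by have := pq; lra.
  rewrite [l `^ (1 + _)]powRD_pos// powRr1 ?(ltW l0)//; ring.
rewrite -[leRHS]mulr1 ler_pM2l//.
have -> : 1 = 1 `^ q^-1 :> R by rewrite powR1.
rewrite ge0_ler_powR ?nnegrE ?mulr_ge0 ?invr_ge0 ?(ltW l0) ?(ltW p0) ?(ltW q0)//.
by apply: (le_trans l1); rewrite invf_le1// ler1n.
Qed.

Lemma gkernorm_le : gkernorm l q <= Xroot.
Proof.
have G0 : 0 <= gkernorm l q by exact: pnorm_ge0.
have -> : gkernorm l q = (gkernorm l q `^ q) `^ q^-1.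
  by rewrite -powRrM mulfV ?gt_eqF// powRr1.
have XE : 0 <= gkernorm l q `^ q by exact: powR_ge0.
rewrite ge0_ler_powR ?nnegrE ?invr_ge0 ?(ltW q0) ?(ltW X0)//.
rewrite gkernormX// -mulrA ler_pM2l//.
by apply: gker_integral_le => //; exact: pi_ge0.
Qed.

(** The line beyond [pi] adds at most [2 * pi ^ (1 - q) / (q - 1)] to the [q]-th power, and
    [powR_root_gap] multiplies this by [Xroot ^ (1 - q)]. The lower bound on [J] gives
    [J ^ (- 1 / p) <= 2 ^ (q - 1)], which [pi ^ (1 - q)] absorbs. *)
Lemma Xroot_sub_gkernorm : Xroot - gkernorm l q <= 2 * l `^ ((q - 1) / p) / (q - 1).
Proof.
have q10 : 0 < q - 1 by rewrite subr_gt0.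
pose Y : R := 2 * (pi `^ (1 - q) / (q - 1)).
have Xq : Xroot `^ q = 2 * l `^ (1 - q) * J.
  by rewrite /Xroot -powRrM mulVf ?gt_eqF// powRr1// ltW.
have hG : Xroot `^ q - Y <= gkernorm l q `^ q.
  rewrite Xq gkernormX// /Y -mulrA -mulrBr ler_pM2l// lerBlDr.
  by apply: le_gker_integral => //; exact: pi_gt0.
have GX : 0 <= gkernorm l q <= Xroot by rewrite pnorm_ge0 gkernorm_le.
apply: (le_trans (powR_root_gap q1 Xroot_gt0 GX hG)).
have e1 : q^-1 * (1 - q) = - p^-1.
  have -> : p^-1 = 1 - q^-1 by have := pq; lra.
  by field; rewrite gt_eqF.
have e2 : q / p = q - 1.
  rewrite [q / p](_ : _ = q * (1 - q^-1)); first by field; rewrite gt_eqF.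
  by congr (_ * _); have := pq; lra.
have -> : Xroot `^ (1 - q) = 2 `^ (- p^-1) * l `^ ((q - 1) / p) * J `^ (- p^-1).
  rewrite /Xroot -powRrM e1 !powRM ?mulr_ge0 ?powR_ge0 ?(ltW J0)//.
  congr (_ * _ * _); rewrite -powRrM; congr (_ `^ _); ring.
have h2 : 2 `^ (- p^-1) <= 1 :> R.
  rewrite -[leRHS](@powRr0 R 2) ler_powR ?ler1n// oppr_le0 invr_ge0; exact: ltW.
have hJ : J `^ (- p^-1) <= 2 `^ (q - 1).
  apply: (@le_trans _ _ ((2 `^ (- (q / 2))) `^ (- p^-1))).
    have hh := hypergeometric_ge q1.
    have h0 : 0 < 2 `^ (- (q / 2)) :> R by exact: powR_gt0.
    rewrite [X in X <= _]powRN [X in _ <= X]powRN lef_pV2 ?posrE ?powR_gt0//.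
    rewrite ge0_ler_powR ?nnegrE ?invr_ge0 ?powR_ge0 ?(ltW J0) ?(ltW p0)//.
  rewrite -powRrM.
  have -> : - (q / 2) * - p^-1 = (q - 1) / 2 by rewrite -e2; field; rewrite gt_eqF.
  by rewrite ler_powR ?ler1n//; lra.
have hpi : pi `^ (1 - q) * 2 `^ (q - 1) <= 1 :> R.
  have -> : 1 - q = - (q - 1) by ring.
  rewrite powRN ler_pdivrMl ?powR_gt0 ?pi_gt0// mulr1.
  rewrite ge0_ler_powR ?nnegrE ?(ltW q10) ?pi_ge0//.
  by have := @pi_gt3 R; lra.
set L := l `^ _; have L0 : 0 < L by exact: powR_gt0.
have -> : Y * (2 `^ (- p^-1) * L * J `^ (- p^-1)) =
  2 * L / (q - 1) * (2 `^ (- p^-1) * (pi `^ (1 - q) * J `^ (- p^-1))) by rewrite /Y; ring.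
rewrite ler_piMr ?divr_ge0 ?mulr_ge0 ?(ltW L0) ?(ltW q10)//.
rewrite mulr_ile1 ?powR_ge0 ?mulr_ge0 ?powR_ge0//.
by apply: le_trans hpi; rewrite ler_wpM2l// powR_ge0.
Qed.

End MainTerm.

Section KernelNorm.
Context {R : realType}.
Local Notation per := (2 * pi : R).
Variables (alpha r beta p q : R) (m : nat) (x : R).
Hypotheses (alpha0 : 0 < alpha) (r0 : 0 < r) (r1 : r < 1).
Hypotheses (p1 : 1 < p) (pq : p^-1 + q^-1 = 1).
Local Notation n := m.+1.
Local Notation N := m.*2.+1.
Local Notation l := (lam alpha r m).
Local Notation w := (wid alpha r m).
Local Notation rh := (rho alpha r m).
Local Notation C := (pnorm q 0 cos : R).
Hypotheses (w300 : 300 <= w) (lp : l * p <= 100^-1).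

Let l0 : 0 < l. Proof. exact: lam_gt0. Qed.
Let q1 : 1 < q. Proof. exact: conjugate_gt1 p1 pq. Qed.
Let q0 : 0 < q. Proof. by have := q1; lra. Qed.
Let ll : l <= 100^-1.
Proof. by apply: le_trans lp; rewrite ler_peMr ?(ltW l0)// ltW. Qed.
Let l1 : l <= 1. Proof. by apply: (le_trans ll); rewrite invf_le1// ler1n. Qed.
Let w0 : 0 < w. Proof. by have := w300; lra. Qed.
Let rh0 : 0 < rh. Proof. exact: rho_gt0. Qed.
Let rh1 : rh < 1. Proof. exact: rho_lt1. Qed.

(* The remainder factor of [interp_bound] times [n ^ ((1 - r) / p)]. *)
Definition rem_scale : R :=
  1 + (alpha * r) `^ ((q - 1) / p) / (q - 1) + p `^ q^-1 * l `^ (- p^-1) / w.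

Let K1 : R := p `^ q^-1 * l `^ (- p^-1).

Let per8 : 1 <= per `^ q^-1 <= 8.
Proof.
have h3 := @pi_gt3 R; have h4 := @pi_lt4 R.
have h1 : 1 <= per by lra.
have qV : 0 <= q^-1 <= 1 by rewrite invr_ge0 (ltW q0) invf_le1// ltW.
case/andP: qV => qV0 qV1; apply/andP; split.
  by rewrite -[leLHS](@powRr0 R per) ler_powR.
apply: (@le_trans _ _ (per `^ 1)); first by rewrite ler_powR.
by rewrite powRr1; lra.
Qed.

Let cC : R := C / per `^ q^-1.

Let cC01 : 0 <= cC <= 1.
Proof.
have /andP[h _] := per8; have pq0 : 0 < per `^ q^-1 by lra.
rewrite /cC divr_ge0 ?pnorm_ge0 ?(ltW pq0)//= ler_pdivrMr// mul1r.
have -> : per `^ q^-1 = pnorm q 0 (fun=> 1) by rewrite pnorm_cst// normr1 mul1r.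
apply: ler_pnorm => //; [exact: bmf_cos|exact: bmf_cst|].
by move=> u _; rewrite normr1 cos_max.
Qed.

Local Notation Rn := (pnorm q (- pi) (rker rh)).
Local Notation Hn := (pnorm q (- pi) (hker rh m (phase beta m x))).

Let Rn_gap : `|Rn - gkernorm l q| <= 64.
Proof.
apply: (le_trans (rker_norm l0 ll q1)); have /andP[_ h] := per8; lra.
Qed.

(** The relative error [2 * pi / (n * (1 - rho))] of averaging is at most [8 / (w / 2)], since
    [1 - rho >= lam / 2] and [n * lam = w]. *)
Let Hn_gap : `|Hn - cC * Rn| <= 16 / w * Rn.
Proof.
have /andP[h _] := per8; have pq0 : 0 < per `^ q^-1 by lra.
have hk := hker_norm m rh0 rh1 q1 (- pi) (phase beta m x).
have Rn0 : 0 <= Rn by exact: pnorm_ge0.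
rewrite -(ler_pM2r pq0) -{1}[per `^ q^-1]gtr0_norm// -normrM.
have -> : (Hn - cC * Rn) * per `^ q^-1 = Hn * per `^ q^-1 - C * Rn.
  by rewrite /cC; field; rewrite gt_eqF.
apply: (le_trans hk); rewrite ler_pM2r//; apply: ler_wpM2r => //.
have rl := one_sub_rho_ge alpha0 r0 l1.
have n0 : 0 < n%:R :> R by rewrite ltr0n.
have nr0 : 0 < n%:R * (1 - rh) by rewrite mulr_gt0// subr_gt0.
rewrite ler_pdivrMr// mulrAC ler_pdivlMr// -lam_n.
have h4 := @pi_lt4 R.
have : n%:R * (l / 2) <= n%:R * (1 - rh) by rewrite ler_pM2l.
have nl : 0 < l * n%:R by rewrite mulr_gt0.
have : per * (l * n%:R) <= 8 * (l * n%:R) by rewrite ler_pM2r//; lra.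
rewrite [n%:R * (l / 2)](_ : _ = l * n%:R / 2); last by ring.
lra.
Qed.

(** Count of the constants: 42 goes with [K1 / w] and 2 with the term over [q - 1]. The rest is 2
    from [l * Xroot], less than 1 from [64 * l], at most 64 from [64 * (21 / w)] and 64 from the
    envelope comparison, less than 150 in all. *)
Let main_gap : `|Hn - cC * Xroot q l| + (l + 5 / w) * Rn <= 150 * rem_scale.
Proof.
have /andP[c0 c1] := cC01.
have w5 : 0 <= 5 / w by rewrite divr_ge0// ltW.
have w16 : 0 <= 16 / w by rewrite divr_ge0// ltW.
have Rn0 : 0 <= Rn by exact: pnorm_ge0.
have X0 := Xroot_gt0 p1 pq l0.
have GX := gkernorm_le p1 pq l0.
have XG := Xroot_sub_gkernorm p1 pq l0.
have XK : Xroot q l <= 2 * K1 := Xroot_le p1 pq l0.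
have lX := lam_Xroot_le p1 pq l0 lp.
have K10 : 0 <= K1 by rewrite mulr_ge0 ?powR_ge0.
have q10 : 0 < q - 1 by rewrite subr_gt0.
have T2 : l `^ ((q - 1) / p) / (q - 1) <= (alpha * r) `^ ((q - 1) / p) / (q - 1).
  rewrite ler_pM2r ?invr_gt0//.
  have ar0 : 0 < alpha * r by rewrite mulr_gt0.
  rewrite ge0_ler_powR ?nnegrE ?(ltW l0) ?(ltW ar0)//.
    by rewrite divr_ge0 ?(ltW q10)//; have := p1; lra.
  rewrite ler_piMr ?(ltW ar0)//.
  rewrite -[leRHS](@powRr0 R n%:R) ler_powR ?ler1n//; have := r1; lra.
move: Rn_gap Hn_gap; rewrite !ler_norml => /andP[g1 g2] /andP[h1 h2].
have RX : Rn <= Xroot q l + 64 by lra.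
have t1 : 16 / w * Rn + (l + 5 / w) * Rn <= (l + 21 / w) * (Xroot q l + 64).
  rewrite -mulrDl; have -> : 16 / w + (l + 5 / w) = l + 21 / w by field; rewrite gt_eqF.
  by apply: ler_wpM2l RX; rewrite addr_ge0 ?(ltW l0)// divr_ge0// ltW.
have t2 : 21 / w * Xroot q l <= 42 * (K1 / w).
  have -> : 42 * (K1 / w) = 21 / w * (2 * K1) by field; rewrite gt_eqF.
  by rewrite ler_wpM2l// divr_ge0// ltW.
have t3 : 21 / w <= 1 by rewrite ler_pdivrMr// mul1r; have := w300; lra.
have t4 : (l + 21 / w) * (Xroot q l + 64) = l * Xroot q l + 21 / w * Xroot q l + 64 * l + 64 * (21 / w).
  by ring.
have u1 : cC * (Xroot q l - Rn) <= Xroot q l - gkernorm l q + 64.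
  apply: (@le_trans _ _ (cC * (Xroot q l - gkernorm l q + 64))).
    by rewrite ler_wpM2l//; lra.
  by rewrite ler_piMl//; lra.
have u2 : - 64 <= cC * (Xroot q l - Rn).
  apply: (@le_trans _ _ (cC * (- 64))); first by lra.
  by rewrite ler_wpM2l//; lra.
have hh : `|Hn - cC * Xroot q l| <= 16 / w * Rn + (Xroot q l - gkernorm l q + 64).
  rewrite ler_norml.
  have -> : Hn - cC * Xroot q l = (Hn - cC * Rn) - cC * (Xroot q l - Rn) by ring.
  by apply/andP; split; lra.
have K1w : 0 <= K1 / w by rewrite divr_ge0// ltW.
have T20 : 0 <= l `^ ((q - 1) / p) / (q - 1) by rewrite divr_ge0 ?powR_ge0// ltW.
rewrite /rem_scale -/K1; rewrite -mulrA in XG.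
rewrite t4 in t1.
have X64 := ll.
lra.
Qed.

Local Notation a0 := (pcoef alpha r n).
Local Notation sx := (`|sin (N%:R * x / 2)|).

Lemma ekernel_norm_gap :
  `|pnorm q 0 (ekernel alpha r beta m x) - 2 * sx * a0 * (cC * Xroot q l)| <=
  2 * sx * a0 * (150 * rem_scale).
Proof.
have Ke : pnorm q 0 (ekernel alpha r beta m x) =
    pnorm q (- pi) (fun u => ekernel alpha r beta m x (x + u)).
  rewrite -(@pnorm_shift R q (- pi) 0 x)//; first by under eq_fun do rewrite addrC.
  - exact: ltW.
  - exact: bmf_ekernel.
  - exact: periodic_ekernel.
rewrite Ke.
have A0 : 0 <= 2 * sx * a0 by rewrite !mulr_ge0// ltW// pcoef_gt0.
have bh := bmf_hker m rh0 rh1 (phase beta m x).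
have br := bmf_rker rh0 rh1.
have lw : 0 <= l + 5 / w by rewrite addr_ge0 ?(ltW l0)// divr_ge0// ltW.
have Alw : 0 <= 2 * sx * a0 * (l + 5 / w) by exact: mulr_ge0.
have AE : `|2 * sin (N%:R * x / 2) * a0| = 2 * sx * a0.
  by rewrite normrM normrM [`|2|]ger0_norm// [`|a0|]gtr0_norm// pcoef_gt0.
have d1 : `|pnorm q (- pi) (fun u => ekernel alpha r beta m x (x + u)) - 2 * sx * a0 * Hn| <=
    2 * sx * a0 * (l + 5 / w) * Rn.
  rewrite -[in X in _ - X * _]AE -pnormZ//.
  have -> : 2 * sx * a0 * (l + 5 / w) * Rn =
      pnorm q (- pi) (fun u => 2 * sx * a0 * (l + 5 / w) * rker rh u).
    by rewrite pnormZ// (ger0_norm Alw).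
  apply: pnorm_dist; [exact: ltW| |exact: bmfZ|exact: bmfZ|].
    have := bmf_shift x (bmf_ekernel beta m alpha0 r0 x).
    by under eq_fun do rewrite addrC.
  move=> u _; rewrite [leRHS]ger0_norm; last first.
    by rewrite (mulr_ge0 Alw)// ltW// rker_gt0.
  exact: (ekernel_estimate beta x alpha0 r0 r1 l1 w300 u).
have -> : pnorm q (- pi) (fun u => ekernel alpha r beta m x (x + u)) -
    2 * sx * a0 * (cC * Xroot q l) =
    (pnorm q (- pi) (fun u => ekernel alpha r beta m x (x + u)) - 2 * sx * a0 * Hn) +
    2 * sx * a0 * (Hn - cC * Xroot q l) by ring.
apply: (le_trans (ler_normD _ _)).
rewrite [`|2 * sx * a0 * (_ - _)|]normrM (ger0_norm A0).
apply: (le_trans (lerD d1 (lexx _))).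
rewrite -mulrA -mulrDr ler_wpM2l// addrC; exact: main_gap.
Qed.

Let lE : l `^ (- p^-1) = n%:R `^ ((1 - r) / p) / (alpha * r) `^ p^-1.
Proof.
have ar0 : 0 < alpha * r by rewrite mulr_gt0.
rewrite /lam powRM ?powR_ge0 ?(ltW ar0)// -powRrM powRN mulrC; congr (_ `^ _ * _).
by ring.
Qed.

Lemma normLp_cos : normLp q%:E cos = C.
Proof.
by rewrite /normLp Lnorm_period Lnorm_pmeasure//; exact: bmf_cos.
Qed.

(** The factors [2 ^ (1 / q)] of [Xroot] and of the period cancel; the extra [1 / pi] is the one in
    front of the Poisson integral. *)
Lemma main_term_scaled :
  n%:R `^ ((1 - r) / p) * (normLp q%:E cos / (pi `^ (1 + q^-1) * (alpha * r) `^ p^-1)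
       * hypergeometric (1 / 2) ((3 - q) / 2) (3 / 2) 1 `^ q^-1) = cC * Xroot q l / pi.
Proof.
have ar0 : 0 < alpha * r by rewrite mulr_gt0.
rewrite normLp_cos (@XrootE R p q)// lE /cC.
have -> : per `^ q^-1 = 2 `^ q^-1 * pi `^ q^-1 by rewrite powRM ?pi_ge0.
have -> : pi `^ (1 + q^-1) = pi * pi `^ q^-1 :> R.
  by rewrite powRD_pos ?pi_gt0// powRr1 ?pi_ge0.
have h1 : (2 : R) `^ q^-1 != 0 by rewrite gt_eqF// powR_gt0.
have h2 : (pi : R) `^ q^-1 != 0 by rewrite gt_eqF// powR_gt0// pi_gt0.
have h3 : (alpha * r) `^ p^-1 != 0 by rewrite gt_eqF// powR_gt0.
have h4 : (pi : R) != 0 by rewrite gt_eqF// pi_gt0.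
have key (n' c P P' b b' J : R) : b != 0 -> P' != 0 -> b' != 0 -> P != 0 ->
    n' * (c / (P * P' * b') * J) = c / (b * P') * (b * (n' / b') * J) / P.
  by move=> k1 k2 k3 k4; field; rewrite k1 k2 k3 k4.
exact: key.
Qed.

Lemma remainder_scaled :
  n%:R `^ ((1 - r) / p) *
   ((1 + (alpha * r) `^ ((q - 1) / p) / (q - 1)) * (1 / n%:R `^ ((1 - r) / p))
     + p `^ q^-1 / ((alpha * r) `^ (1 + p^-1) * n%:R `^ r)) = rem_scale.
Proof.
have ar0 : 0 < alpha * r by rewrite mulr_gt0.
rewrite /rem_scale lE /wid powRD_pos// powRr1 ?(ltW ar0)//.
have h1 : (n%:R : R) `^ ((1 - r) / p) != 0 by rewrite gt_eqF// powR_gt0.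
have h2 : (n%:R : R) `^ r != 0 by rewrite gt_eqF// powR_gt0.
have h3 : (alpha * r) `^ p^-1 != 0 by rewrite gt_eqF// powR_gt0.
have h4 : alpha * r != 0 by rewrite gt_eqF.
have h5 : q - 1 != 0 by rewrite gt_eqF// subr_gt0.
move: (alpha * r) h3 h4 ((_ : R) `^ ((q - 1) / p)) => a h3 h4 T.
by field; rewrite ?h1 ?h2 ?h3 ?h4 ?h5.
Qed.

Lemma rem_scale_ge1 : 1 <= rem_scale.
Proof.
have h1 : 0 <= (alpha * r) `^ ((q - 1) / p) / (q - 1).
  by rewrite divr_ge0 ?powR_ge0 ?subr_ge0 ?(ltW q1).
have h2 : 0 <= p `^ q^-1 * l `^ (- p^-1) / w by rewrite divr_ge0 ?(ltW w0)// mulr_ge0 ?powR_ge0.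
by rewrite /rem_scale -addrA lerDl addr_ge0.
Qed.

(** [gamma] is obtained by solving the required equation, so one value, independent of [E], serves
    the inequality and the equality; [ekernel_norm_gap] bounds it by [150 / pi]. *)
Lemma ekernel_norm_bound : exists gamma : R, `|gamma| < 20 * pi ^+ 4 /\
  forall E, pi^-1 * pnorm q 0 (ekernel alpha r beta m x) * E =
    interp_bound alpha r p q n x gamma E.
Proof.
have pi3 := @pi_gt3 R; have pi0 : 0 < pi :> R by lra.
have a00 : 0 < a0 by exact: pcoef_gt0.
have bE gamma E : interp_bound alpha r p q n x gamma E =
    2 * a0 * sx * (cC * Xroot q l / pi + gamma * rem_scale) * E.
  rewrite -main_term_scaled -remainder_scaled /interp_bound -/(pcoef alpha r n).
  have -> : (2 * n%:R - 1) / 2 * x = N%:R * x / 2 :> R.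
    by rewrite -muln2 -!natr1 natrM; field.
  ring.
have [s0|sN] := eqVneq (sin (N%:R * x / 2)) 0.
  exists 0; split; first by rewrite normr0 mulr_gt0// exprn_gt0.
  move=> E; rewrite bE s0 normr0.
  have -> : pnorm q 0 (ekernel alpha r beta m x) = 0.
    have -> : ekernel alpha r beta m x = fun=> 0.
      by apply/funext => t; exact: ekernel_node.
    by rewrite pnorm_cst// normr0 mul0r.
  by rewrite !(mulr0, mul0r).
have s0 : 0 < sx by rewrite normr_gt0.
have rs := rem_scale_ge1; have rs0 : 0 < rem_scale by lra.
set kap := pnorm q 0 _; pose gamma := (kap / (2 * sx * a0) - cC * Xroot q l) / (pi * rem_scale).
exists gamma; split; last first.
  have key (k s a c P t E : R) : s != 0 -> a != 0 -> P != 0 -> t != 0 ->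
      P^-1 * k * E = 2 * a * s * (c / P + (k / (2 * s * a) - c) / (P * t) * t) * E.
    by move=> h1 h2 h3 h4; field; rewrite h1 h2 h3 h4.
  by move=> E; rewrite bE; apply: key; rewrite gt_eqF.
have A0 : 0 < 2 * sx * a0 by rewrite !mulr_gt0.
have gE : gamma = (kap - 2 * sx * a0 * (cC * Xroot q l)) / (2 * sx * a0 * (pi * rem_scale)).
  have key (k s a c P t : R) : s != 0 -> a != 0 -> P != 0 -> t != 0 ->
      (k / (2 * s * a) - c) / (P * t) = (k - 2 * s * a * c) / (2 * s * a * (P * t)).
    by move=> h1 h2 h3 h4; field; rewrite h1 h2 h3 h4.
  by apply: key; rewrite gt_eqF.
have B0 : 0 < 2 * sx * a0 * (pi * rem_scale) by rewrite mulr_gt0// mulr_gt0.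
(* As [pi > 3], [150 / pi] is below 60, far less than [20 * 3 ^ 4]. *)
apply: (@le_lt_trans _ _ (150 / pi)).
  rewrite gE normrM normfV (gtr0_norm B0) ler_pdivrMr//.
  apply: (le_trans ekernel_norm_gap).
  have key (A t P : R) : P != 0 -> A * (150 * t) = 150 / P * (A * (P * t)).
    by move=> h; field.
  by rewrite (key _ _ pi) ?gt_eqF.
apply: (@lt_le_trans _ _ 60).
  by rewrite ltr_pdivrMr//; lra.
have p4 : 3 ^+ 4 <= pi ^+ 4 :> R by rewrite lerXn2r ?nnegrE ?(ltW pi0)// ltW.
rewrite (_ : 3 ^+ 4 = 81) in p4; last by rewrite -natrX.
lra.
Qed.

End KernelNorm.

Theorem mainTheorem1 (R : realType) (alpha r p q beta : R)
  (hr : 0 < r < 1) (halpha : 0 < alpha) (hp : 1 < p)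
  (hpq : p^-1 + q^-1 = 1) :
  (forall (n : nat) (x : R) (f phi : R -> R),
     (0 < n)%N -> (nstar alpha r p%:E <= n)%N ->
     poisson_class alpha r beta (Lp p%:E) f ->
     is_gen_derivative alpha r beta (Lp p%:E) f phi ->
     exists gamma : R,
       `|gamma| < 20 * pi ^+ 4 /\
       `|interp_error n f x| <=
         interp_bound alpha r p q n x gamma (best_approx n p%:E phi))
  /\
  (forall (n : nat) (x : R) (f phi : R -> R),
     (0 < n)%N -> (nstar alpha r p%:E <= n)%N ->
     poisson_class alpha r beta (Lp p%:E) f ->
     is_gen_derivative alpha r beta (Lp p%:E) f phi ->
     exists F Phi : R -> R,
       [/\ poisson_class alpha r beta (Lp p%:E) F,
           is_gen_derivative alpha r beta (Lp p%:E) F Phi,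
           best_approx n p%:E Phi = best_approx n p%:E phi &
           exists gamma : R,
             `|gamma| < 20 * pi ^+ 4 /\
             `|interp_error n F x| =
               interp_bound alpha r p q n x gamma (best_approx n p%:E phi)]).
Proof.
have /andP[r0 r1] := hr.
split=> -[//|m] x f phi _ /(nstar_large halpha r0 r1 hp)[w300 lp] cf dphi.
  have [gamma [g1 g2]] := ekernel_norm_bound beta x halpha r0 r1 hp hpq w300 lp.
  by exists gamma; split=> //; rewrite -g2; exact: (interp_error_le m x halpha r0 hp hpq dphi).
have [F [Phi [h1 h2 h3 h4]]] := interp_error_attained m x halpha r0 hp hpq cf dphi.
exists F, Phi; split=> //.
have [gamma [g1 g2]] := ekernel_norm_bound beta x halpha r0 r1 hp hpq w300 lp.
by exists gamma; split=> //; rewrite -g2.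
Qed.
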